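(* Any allowable integral symmetric $n\times n$ matrix $M$ represents the Gordon-Litherland pairing for some checkerboard colorable virtual knot. That is, there exist a closed, connected, oriented surface $\Sigma$, a knot $K\subset\Sigma\times I$, a spanning surface $F\subset\Sigma\times I$ with $\partial F=K$, and a basis of $H_1(F;\mathbb Z)$ with respect to which the Gordon-Litherland pairing $\mathcal G_F$ has matrix $M$.
   Context: A symmetric integer matrix $M=(m_{ij})$ of size $n\times n$ is allowable if either $n$ is even or $m_{ii}$ is odd for some $i$. $I=[0,1]$, $p\colon\Sigma\times I\to\Sigma$ is the projection. A virtual knot is a stable equivalence class of knots in thickened surfaces; it is checkerboard colorable if and only if it is represented by some knot $K\subset\Sigma\times I$ bounding a spanning surface (compact, possibly nonorientable surface $F\subset\Sigma\times I$ with $\partial F=K$, no closed components). For disjoint oriented $J,K\subset\Sigma\times I$, $\ell k_\Sigma(J,K)$ is the signed count of crossings where $J$ passes over $K$ (equivalently $J\cdot B$ for a 2-chain $B$ with $\partial B=K+c$, $c$ a 1-cycle in $\Sigma\times\{1\}$). A closed tubular neighborhood of $F$ is a $[-1,1]$-bundle over $F$; let $\widetilde F\to F$ be the associated $\{\pm1\}$-bundle and $\tau\colon H_1(F;\mathbb Z)\to H_1(\widetilde F;\mathbb Z)$ the transfer. The Gordon-Litherland pairing is $\mathcal G_F(\alpha,\beta)=\ell k_\Sigma(\tau\alpha,\beta)-p_*(\alpha)\cdot p_*(\beta)$ on $H_1(F;\mathbb Z)$, with $\cdot$ the intersection form on $H_1(\Sigma;\mathbb Z)$. *)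

(* Defs.v *)
(* Library: MathComp, with the real numbers of MathComp-Analysis.

   All topology is piecewise linear.  Surfaces are finite simplicial complexes,
   and objects in Sigma x I are given by vertex positions, extended linearly
   over each simplex; a simplex must land in a single prism sigma x I, which is
   convex, so that the linear extension makes sense. *)
From HB Require Import structures.
From mathcomp Require Import all_boot all_order all_algebra.
From mathcomp Require Import boolp reals.
Set Implicit Arguments.
Unset Strict Implicit.
Unset Printing Implicit Defensive.
Import Order.TTheory GRing.Theory Num.Theory.
Local Open Scope ring_scope.

Definition allowable (n : nat) (M : 'M[int]_n) : Prop :=
  M^T = M /\ (~~ odd n \/ exists i : 'I_n, odd `|M i i|%N).

(** ** Simplicial complexes and surfaces *)

Section Complexes.
Variable V : finType.
Implicit Types (K : {set {set V}}) (e s t : {set V}).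

Definition simplicial_complex K : Prop :=
  [/\ set0 \notin K, forall v, [set v] \in K
    & forall s t, s \in K -> t \subset s -> t != set0 -> t \in K].

Definition adjacent K : rel V := fun u v => (u != v) && ([set u; v] \in K).

Definition opposite K e : {set V} := [set v | (v \notin e) && (v |: e \in K)].

Definition link_adjacent K (v : V) : rel V :=
  fun a b => [&& a != b, a != v, b != v & [set v; a; b] \in K].

(* The link of [v] is a graph, in which the degree of [a] is the number of
   triangles on the edge {v, a}.  A nonempty connected graph all of whose
   degrees are 1 or 2 is an arc or a circle. *)
Definition compact_surface K : Prop :=
  [/\ simplicial_complex K,
      forall s, s \in K -> exists t, [/\ t \in K, s \subset t & #|t| = 3%N],
      forall u v, adjacent K u v -> (#|opposite K [set u; v]| <= 2)%N
    & forall v a b, adjacent K v a -> adjacent K v b ->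
        connect (link_adjacent K v) a b].

Definition boundary_edge K : rel V :=
  fun u v => adjacent K u v && (#|opposite K [set u; v]| == 1)%N.

Definition no_closed_component K : Prop :=
  forall v, exists u w, boundary_edge K u w /\ connect (adjacent K) v u.

Definition closed_connected_surface K : Prop :=
  [/\ compact_surface K, forall u v, ~~ boundary_edge K u v, (0 < #|V|)%N
    & forall u v, connect (adjacent K) u v].

(** ** Simplicial chains and first homology

   A chain is an alternating function of ordered simplices: [c u v] is the
   coefficient of the oriented edge from [u] to [v], and [w u v x] that of the
   triangle oriented by (u, v, x). *)

Definition chain1 K (c : V -> V -> int) : Prop :=
  (forall u v, c v u = - c u v) /\
  (forall u v, c u v != 0 -> [set u; v] \in K).

Definition chain2 K (w : V -> V -> V -> int) : Prop :=
  [/\ forall u v x, w v u x = - w u v x,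
      forall u v x, w u x v = - w u v x
    & forall u v x, w u v x != 0 -> [set u; v; x] \in K].

Definition boundary2 (w : V -> V -> V -> int) : V -> V -> int :=
  fun u v => \sum_x w u v x.

Definition cycle1 K (c : V -> V -> int) : Prop :=
  chain1 K c /\ forall u, \sum_v c u v = 0.

Definition homologous K (c c' : V -> V -> int) : Prop :=
  exists2 w, chain2 K w & forall u v, c u v - c' u v = boundary2 w u v.

Definition basis_H1 K (n : nat) (z : 'I_n -> V -> V -> int) : Prop :=
  let comb (k : 'I_n -> int) u v := \sum_i k i * z i u v in
  [/\ forall i, cycle1 K (z i),
      forall c, cycle1 K c -> exists k, homologous K c (comb k)
    & forall k, homologous K (comb k) (fun _ _ => 0) -> forall i, k i = 0].

Definition fundamental_cycle K (o : V -> V -> V -> int) : Prop :=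
  [/\ chain2 K o,
      forall u v x, #|[set u; v; x]| = 3%N -> [set u; v; x] \in K ->
        `|o u v x| = 1
    & forall u v, boundary2 o u v = 0].

(* Points of the geometric realization, in barycentric coordinates. *)
Definition support (R : realType) (x : V -> R) : {set V} := [set v | x v != 0].

Definition realization (R : realType) K (x : V -> R) : Prop :=
  [/\ forall v, 0 <= x v, \sum_v x v = 1 & support x \in K].

End Complexes.

Record oriented_surface := OrientedSurface {
  svert : finType;
  scplx : {set {set svert}};
  sorient : svert -> svert -> svert -> int;
  _ : closed_connected_surface scplx;
  _ : fundamental_cycle scplx sorient
}.

Arguments sorient : clear implicits.

(** ** Knots and spanning surfaces in Sigma x I *)

Section Thickened.
Variables (R : realType) (S : oriented_surface).

(* Ambient spaces: barycentric coordinates on Sigma, and a height. *)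
Definition spoint : Type := {ffun svert S -> R^o}.
Definition tpoint : Type := (spoint * R^o)%type.

Definition in_surface (x : spoint) : Prop := realization (scplx S) x.

Definition in_thickened (P : tpoint) : Prop :=
  in_surface P.1 /\ 0 <= P.2 <= 1.

Definition unit_interval (t : R) : bool := 0 <= t <= 1.

Definition interp (T : lmodType R) (e : T * T) (t : R) : T :=
  (1 - t) *: e.1 + t *: e.2.

Definition in_simplex (s : {set svert S}) (x : spoint) : Prop :=
  support x \subset s.

(* Closed polygons: [ordS] is the cyclic successor.  Injectivity forces at
   least three vertices. *)
Definition polygon_edge (m : nat) (k : 'I_m -> tpoint) (i : 'I_m) :
  tpoint * tpoint := (k i, k (ordS i)).

Definition knot (m : nat) (k : 'I_m -> tpoint) : Prop :=
  [/\ (0 < m)%N, forall i, in_thickened (k i),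
      forall i, exists2 s, s \in scplx S &
        in_simplex s (k i).1 /\ in_simplex s (k (ordS i)).1
    & forall i j t t', 0 <= t < 1 -> 0 <= t' < 1 ->
        interp (polygon_edge k i) t = interp (polygon_edge k j) t' ->
        i = j /\ t = t'].

Definition polygon_points (m : nat) (k : 'I_m -> tpoint) (P : tpoint) : Prop :=
  exists i t, unit_interval t /\ P = interp (polygon_edge k i) t.

Definition linear_extension (V : finType) (T : lmodType R) (f : V -> T)
  (x : V -> R) : T := \sum_v x v *: f v.

Record embedded_surface := EmbeddedSurface {
  fvert : finType;
  fcplx : {set {set fvert}};
  fpos : fvert -> tpoint;
  _ : compact_surface fcplx;
  _ : forall v, in_thickened (fpos v);
  _ : forall s, s \in fcplx -> exists2 r, r \in scplx S &
        forall v, v \in s -> in_simplex r (fpos v).1;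
  _ : forall x y : fvert -> R, realization fcplx x -> realization fcplx y ->
        linear_extension fpos x = linear_extension fpos y -> x =1 y
}.

Definition boundary_points (F : embedded_surface) (P : tpoint) : Prop :=
  exists u v t, [/\ boundary_edge (fcplx F) u v, unit_interval t
    & P = interp (fpos u, fpos v) t].

Definition spanning_surface (F : embedded_surface) (m : nat)
  (k : 'I_m -> tpoint) : Prop :=
  no_closed_component (fcplx F) /\
  forall P, boundary_points F P <-> polygon_points k P.

(** ** Tubular neighbourhoods and the transfer

   The {+1,-1}-bundle F~ -> F is given by transition signs on the edges: its
   vertices are the pairs (v, b), and its simplices are the lifts of those of
   F along functions [b] compatible with the signs.  Every double cover of a
   simplicial complex arises so.

   The [-1,1]-bundle is the mapping cylinder of F~ -> F: the interval fibre
   over x is the union of the segments t in [0,1] starting at x, one for each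
   of the two points of F~ over x.  The closed tubular neighbourhood is an
   embedding of this cylinder which is F at t = 0; the positions of F~, at
   t = 1, are [tpos]. *)

Definition compatible (V : finType) (sg : V -> V -> bool) (s : {set V})
  (b : V -> bool) : Prop :=
  forall u v, u \in s -> v \in s -> b v = b u (+) sg u v.

Definition bundle_point (F : embedded_surface)
  (g : fvert F * bool -> tpoint) (b : fvert F -> bool) (x : fvert F -> R)
  (t : R) : tpoint :=
  interp (linear_extension (@fpos F) x,
          linear_extension (fun v => g (v, b v)) x) t.

Record tubular_neighborhood (F : embedded_surface) := TubularNeighborhood {
  tsign : fvert F -> fvert F -> bool;
  tpos : fvert F * bool -> tpoint;
  _ : forall u v w, [set u; v; w] \in fcplx F ->
        tsign u v (+) tsign v w = tsign u w;
  _ : forall p, in_thickened (tpos p);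
  _ : forall s b, s \in fcplx F -> compatible tsign s b ->
        exists2 r, r \in scplx S & forall v, v \in s ->
          in_simplex r (fpos v).1 /\ in_simplex r (tpos (v, b v)).1;
  _ : forall x x' b b' t t',
        realization (fcplx F) x -> realization (fcplx F) x' ->
        compatible tsign (support x) b -> compatible tsign (support x') b' ->
        unit_interval t -> unit_interval t' ->
        bundle_point tpos b x t = bundle_point tpos b' x' t' ->
        [/\ x =1 x', t = t' & t = 0 \/ {in support x, b =1 b'}]
}.

Definition transfer (F : embedded_surface) (N : tubular_neighborhood F)
  (c : fvert F -> fvert F -> int) :
  fvert F * bool -> fvert F * bool -> int :=
  fun p q => if q.2 == p.2 (+) tsign N p.1 q.1 then c p.1 q.1 else 0.

(** ** Polygonal chains, crossings and linking numbers *)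

(* Formal integer combinations of oriented segments. *)
Definition polygonal_chain (T : Type) : Type := seq (int * (T * T)).

(* Each edge is listed once, in one of its orientations. *)
Definition realize (V : finType) (T : Type) (f : V -> T)
  (c : V -> V -> int) : polygonal_chain T :=
  [seq (c e.1 e.2, (f e.1, f e.2)) | e <- enum {: V * V}
     & (enum_rank e.1 < enum_rank e.2)%N].

Definition project_segment (e : tpoint * tpoint) : spoint * spoint :=
  (e.1.1, e.2.1).

Definition project (J : polygonal_chain tpoint) : polygonal_chain spoint :=
  [seq (a.1, project_segment a.2) | a <- J].

(* As the orientation is alternating, this is the sum over the triangles
   (a,b,c), positively oriented, of the 3x3 determinants of the (a,b,c)
   coordinates of x, u, w.  If x and the tangent vectors u, w are carried by a
   single triangle, only that triangle contributes, and the sign of the result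
   tells whether (u, w) is a positive or a negative frame. *)
Definition frame_form (x u w : spoint) : R :=
  \sum_a \sum_b \sum_c (sorient S a b c)%:~R * (x a * u b * w c).

Definition segment_form (e e' : spoint * spoint) : R :=
  frame_form e.1 (e.2 - e.1) (e'.2 - e'.1).

Definition meet (e e' : spoint * spoint) : Prop :=
  exists t t', [/\ unit_interval t, unit_interval t'
    & interp e t = interp e' t'].

(* Segments meet only in transverse double points, interior to both of them.
   The form vanishes when the crossing lies on an edge of Sigma. *)
Definition transverse_segments (e e' : spoint * spoint) : Prop :=
  forall t t', unit_interval t -> unit_interval t' ->
    interp e t = interp e' t' ->
    [/\ 0 < t < 1, 0 < t' < 1 & segment_form e e' != 0].

Definition transverse (J L : polygonal_chain spoint) : Prop :=
  forall a b, a \in J -> b \in L -> a.1 != 0 -> b.1 != 0 ->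
    transverse_segments a.2 b.2.

Definition intersection_count (J L : polygonal_chain spoint) : int :=
  \sum_(a <- J) \sum_(b <- L)
    a.1 * b.1 * (if `[< meet a.2 b.2 >] then sgz (segment_form a.2 b.2) else 0).

Definition passes_over (e e' : tpoint * tpoint) : Prop :=
  exists t t', [/\ unit_interval t, unit_interval t',
    interp (project_segment e) t = interp (project_segment e') t'
    & (interp e' t').2 < (interp e t).2].

(* A crossing is positive when the directions of the over-strand and of the
   under-strand, in this order, form a positive frame. *)
Definition linking_count (J L : polygonal_chain tpoint) : int :=
  \sum_(a <- J) \sum_(b <- L)
    a.1 * b.1 * (if `[< passes_over a.2 b.2 >]
                 then sgz (segment_form (project_segment a.2)
                                        (project_segment b.2))
                 else 0).

(** ** The intersection form on the first homology of Sigma *)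

Definition polygonal_cycle (J : polygonal_chain spoint) : Prop :=
  (forall a, a \in J -> a.1 != 0 ->
     [/\ in_surface a.2.1, in_surface a.2.2 & exists2 s, s \in scplx S &
       in_simplex s a.2.1 /\ in_simplex s a.2.2]) /\
  (forall x : spoint,
     \sum_(a <- J) (a.1 *+ (a.2.2 == x) - a.1 *+ (a.2.1 == x)) = 0).

Definition simplicial_approximation (phi : spoint -> svert S) : Prop :=
  forall x, in_surface x -> phi x \in support x.

Definition approximate (phi : spoint -> svert S) (J : polygonal_chain spoint) :
  svert S -> svert S -> int :=
  fun u v => \sum_(a <- J)
    (a.1 *+ ((phi a.2.1 == u) && (phi a.2.2 == v))
     - a.1 *+ ((phi a.2.1 == v) && (phi a.2.2 == u))).

(* Equality of classes in the simplicial homology group H_1(Sigma; Z).  By the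
   simplicial approximation theorem, [phi] does not matter. *)
Definition homologous_in_surface (J L : polygonal_chain spoint) : Prop :=
  exists2 phi, simplicial_approximation phi &
    homologous (scplx S) (approximate phi J) (approximate phi L).

(* [d] is the intersection number of the homology classes of J and L: the
   signed count of intersections of transverse representatives. *)
Definition intersection_number (J L : polygonal_chain spoint) (d : int) :
  Prop :=
  exists J' L',
    [/\ polygonal_cycle J' /\ polygonal_cycle L',
        homologous_in_surface J' J /\ homologous_in_surface L' L,
        transverse J' L' & d = intersection_count J' L'].

(** ** The Gordon-Litherland pairing *)

(* [m] is the value of the pairing on the classes of the cycles [alpha] and
   [beta].  The linking number is that of the classes of the transfer of alpha
   and of beta, and is counted on representatives in the 1-skeleta of F~ and F
   whose projections to Sigma are transverse; the first one is disjoint from F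
   since the tubular neighbourhood is embedded. *)
Definition gordon_litherland (F : embedded_surface)
  (alpha beta : fvert F -> fvert F -> int) (m : int) : Prop :=
  exists (N : tubular_neighborhood F) a b d,
    let ta := realize (tpos N) (transfer N a) in
    let rb := realize (@fpos F) b in
    [/\ cycle1 (fcplx F) a /\ cycle1 (fcplx F) b,
        homologous (fcplx F) a alpha /\ homologous (fcplx F) b beta,
        transverse (project ta) (project rb),
        intersection_number (project (realize (@fpos F) alpha))
                            (project (realize (@fpos F) beta)) d
      & m = linking_count ta rb - d].

End Thickened.

(* Main.v *)
(* The spanning surface is a union of discs joined by strips.  The discs over the
   same star of Sigma are stacked at various heights, and first homology classes
   are flows along the strips.  A strip leaving a disc passes over or under the
   other discs of the stack, and the linking number of the transfer of a flow with
   another one, minus the intersection number, counts such passages with the signs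
   of the differences of heights; a half twist in a strip also contributes.

   The strips form a braid with two strands for each basis element, issued from
   one disc and closed up in pairs by n discs.  Sliding a strand u next to a strand
   v and back changes the entries of the matrix at the pairs (u, v) and (v, u) by
   a sign of our choice, or a diagonal entry by 2 or -2, and does not change the
   boundary up to homeomorphism.  It remains to start from a diagram with connected
   boundary and the right diagonal modulo 2.  If a diagonal entry is odd, a change
   of basis makes all of them odd, and each loop gets a half twist.  Otherwise n is
   even, and consecutive loops are interlaced in pairs. *)
Require Import Defs.
From HB Require Import structures.
From mathcomp Require Import all_boot all_order all_algebra.
From mathcomp Require Import boolp reals.
From mathcomp Require Import ring lra zify.
Set Implicit Arguments.
Unset Strict Implicit.
Unset Printing Implicit Defensive.
Import Order.TTheory GRing.Theory Num.Theory.
Local Open Scope ring_scope.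

(** * Cycles in 2-regular graphs *)

(** Each strip crosses an edge of Sigma of its own, so different strips never cross in projection.
    What remains is the crossing of a strip with the rims of the discs stacked over the star that it
    leaves or enters, and of the two edges of a half twisted strip. Room for any number of strips
    between consecutive stars is bought by genus. The two cycles to be paired run along opposite
    edges of the strips, and the lifted one is drawn on slightly smaller rims. Their projections are
    then transverse, and the same pair of cycles serves for the linking number and for the
    intersection number: the pairing becomes a sum over pairs of edges. The half twist shapes the
    geometry. It is a fold, whose two sheets overlap in projection and must have disjoint
    thickenings. The numerical constants place the sheets, at every fibre parameter, in explicit
    planes, so that disjointness reduces to linear inequalities. Twisted strips only leave a disc
    that is alone in its level, where the rim can be deformed freely. *)

Lemma next_next_neq (V : eqType) (s : seq V) u : uniq s -> (2 < size s)%N -> u \in s ->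
  next s (next s u) != u.
Proof.
move=> Us sz us; apply/eqP => E; case/rot_to: us E => i q Eq.
rewrite -!(next_rot i Us); move: Us sz; rewrite -(rot_uniq i) -(size_rot i) {}Eq.
case: q => [|a [|a' q]] //=; rewrite !inE !negb_or eqxx => /andP[/and3P[ua ua' _] _] _.
by rewrite eq_sym (negPf ua) eqxx => E; rewrite E eqxx in ua'.
Qed.

Section TwoRegular.
Variables (V : finType) (r : rel V) (B : pred V).
Hypothesis rsym : symmetric r.
Hypothesis rirr : irreflexive r.
Hypothesis rdeg : forall v, v \in B -> #|[set w | r v w]| = 2.
Hypothesis rB : forall u v, r u v -> u \in B.
Hypothesis rconn : forall u v, u \in B -> v \in B -> connect r u v.

Let unextendable x p := forall y, r y x -> y \in x :: p.

Lemma maximal_path x p : x \in B -> uniq (x :: p) -> path r x p ->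
  exists x' p', [/\ x' \in B, uniq (x' :: p'), path r x' p' & unextendable x' p'].
Proof.
have [n] := ubnP (#|V| - size p); elim: n x p => // n IH x p le_n xB Up Pp.
have [/forallP ext|] := boolP [forall y, r y x ==> (y \in x :: p)].
  by exists x, p; split=> // y ryx; have /implyP := ext y; apply.
rewrite negb_forall => /existsP[y]; rewrite negb_imply => /andP[ryx yNp].
apply: (IH y (x :: p)).
- have : (size (y :: x :: p) <= #|V|)%N.
    by rewrite -(card_uniqP _) ?max_card // cons_uniq yNp.
  by move: le_n => /=; lia.
- exact: rB ryx.
- by rewrite cons_uniq yNp.
- by rewrite /= ryx.
Qed.

Lemma two_neighbours v a b c : v \in B -> r v a -> r v b -> r v c ->
  a != b -> c = a \/ c = b.
Proof.
move=> vB ra rb rc ab; have [->|ca] := eqVneq c a; first by left.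
have [->|cb] := eqVneq c b; first by right.
have : ([set x in [:: a; b; c]] \subset [set w | r v w]).
  by apply/subsetP => x; rewrite !inE => /or3P[]/eqP->.
have U : uniq [:: a; b; c] by rewrite /= !inE negb_or ab eq_sym ca eq_sym cb.
by move=> /subset_leq_card; rewrite rdeg // cardsE; move/card_uniqP: U => ->.
Qed.

Lemma ex_neighbour v a : v \in B -> exists2 b, r v b & b != a.
Proof.
move=> vB; have /set0Pn[b] : [set w | r v w] :\ a != set0.
  apply: contra_eqN (rdeg vB) => /eqP E; have := cardsD1 a [set w | r v w].
  by rewrite E cards0 => ->; case: (_ \in _).
by rewrite !inE => /andP[]; exists b.
Qed.

(** Let [b] be a neighbour of the start [x] of a maximal path, other than the second vertex. If [b]
    were not the last vertex, it would have three neighbours: its predecessor, its successor and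
    [x]. So the path closes up; the cycle contains all neighbours of its vertices, hence everything
    by connectedness. *)
Lemma hamiltonian_cycle v0 : v0 \in B -> exists s : seq V,
  [/\ uniq s, cycle r s, (2 < size s)%N, forall v, v \in B -> v \in s
    & forall u v, r u v -> v = next s u \/ u = next s v].
Proof.
move=> v0B; have [x [p [xB Up Pp ext]]] := @maximal_path v0 [::] v0B isT isT.
have {ext}ext y : r x y -> y \in p.
  move=> rxy; have := ext y; rewrite rsym rxy inE => /(_ isT).
  by case/orP=> // /eqP yx; rewrite yx rirr in rxy.
have [b rxb bNh] := ex_neighbour (head x p) xB.
have bp := ext _ rxb.
have szp : (1 < size p)%N.
  by case: p bp bNh {Up Pp ext} => [//|a [|//]]; rewrite /= inE => /eqP->; rewrite eqxx.
have bl : b = last x p.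
  case/splitPr: bp Up Pp ext bNh szp => p1 [|c p2] Up Pp ext bNh szp.
    by rewrite last_cat.
  case: p1 Up Pp ext bNh szp => [|h p1] Up Pp ext bNh szp.
    by rewrite eqxx in bNh.
  move: Pp; rewrite cat_path => /and3P[/= /andP[rxh Ph] rlb /andP[rbc _]].
  have bB := rB rbc.
  have lx : last h p1 != x.
    apply/eqP => E; move: Up; rewrite cons_uniq => /andP[/negP[]].
    by rewrite -E mem_cat mem_last.
  have rbl : r b (last h p1) by rewrite rsym.
  have rbx : r b x by rewrite rsym.
  have [E|E] := two_neighbours bB rbl rbx rbc lx.
  - move: Up; rewrite -cat_cons cat_uniq => /and3P[_ /hasPn /(_ c)].
    have cm : c \in x :: h :: p1 by rewrite E in_cons mem_last orbT.
    by rewrite /= cm in_cons mem_head orbT => /(_ isT).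
  - by move: Up; rewrite /= E inE !mem_cat !inE eqxx !orbT.
have Cy : cycle r (x :: p) by rewrite /= rcons_path Pp -bl rsym.
have sz3 : (2 < size (x :: p))%N by [].
have clos u v : u \in x :: p -> r u v -> v = next (x :: p) u \/ u = next (x :: p) v.
  move=> us ruv.
  have r1 := next_cycle Cy us; have := prev_cycle Cy us; rewrite rsym => r2.
  have ne : next (x :: p) u != prev (x :: p) u.
    by apply: contra_neq (next_next_neq Up sz3 us) => ->; rewrite next_prev.
  have [->|->] := two_neighbours (rB ruv) r1 r2 ruv ne; first by left.
  by right; rewrite next_prev.
have all v : v \in B -> v \in x :: p.
  have stay q z : z \in x :: p -> path r z q -> last z q \in x :: p.
    elim: q z => //= y q IH z zs /andP[rzy]; apply: IH.
    case: (clos _ _ zs rzy) => [->|E]; first by rewrite mem_next.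
    by rewrite -(mem_next (x :: p)) -E.
  by move=> vB; have /connectP[q Pq ->] := rconn xB vB; rewrite stay ?mem_head.
by exists (x :: p); split=> // u v ruv; apply: clos => //; apply: all; apply: rB ruv.
Qed.
End TwoRegular.

(** * Complexes generated by triangles *)

Section GeneratedComplex.
Variables (V T : finType) (tri : T -> {set V}).
Hypothesis tri3 : forall t, #|tri t| = 3.
Hypothesis tri_cover : forall v, exists t, v \in tri t.

Definition generated : {set {set V}} :=
  [set s | (s != set0) && [exists t, s \subset tri t]].

Lemma generatedP s : reflect (s != set0 /\ exists t, s \subset tri t) (s \in generated).
Proof.
rewrite inE; apply: (iffP andP) => -[s0].
  by move=> /existsP.
by move=> ?; split=> //; apply/existsP.
Qed.

Lemma generated_pair u v t : u \in tri t -> v \in tri t -> [set u; v] \in generated.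
Proof.
move=> ut vt; apply/generatedP; split; first by apply/set0Pn; exists u; rewrite !inE eqxx.
by exists t; apply/subsetP => x; rewrite !inE => /orP[]/eqP->.
Qed.

Lemma generated_triple u v w t : u \in tri t -> v \in tri t -> w \in tri t ->
  [set u; v; w] \in generated.
Proof.
move=> ut vt wt; apply/generatedP; split; first by apply/set0Pn; exists u; rewrite !inE eqxx.
by exists t; apply/subsetP => x; rewrite !inE -orbA => /or3P[]/eqP->.
Qed.

Lemma generated_pairP u v : [set u; v] \in generated ->
  exists t, u \in tri t /\ v \in tri t.
Proof.
move=> /generatedP[_ [t /subsetP st]]; exists t.
by split; apply: st; rewrite !inE eqxx ?orbT.
Qed.

Lemma generated_tripleP u v w : [set u; v; w] \in generated ->
  exists t, [/\ u \in tri t, v \in tri t & w \in tri t].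
Proof.
move=> /generatedP[_ [t /subsetP st]]; exists t.
by split; apply: st; rewrite !inE eqxx ?orbT.
Qed.

Lemma generated_simplicial : simplicial_complex generated.
Proof.
split=> [|v|s t /generatedP[_ [r sr]] ts t0].
- by rewrite inE eqxx.
- have [t vt] := tri_cover v; apply/generatedP; split; last by exists t; rewrite sub1set.
  by apply/set0Pn; exists v; rewrite inE.
- by apply/generatedP; split=> //; exists r; apply: subset_trans sr.
Qed.

Lemma generated_pure s : s \in generated ->
  exists t, [/\ t \in generated, s \subset t & #|t| = 3%N].
Proof.
move=> /generatedP[s0 [t st]]; exists (tri t); split=> //; apply/generatedP.
by split; [rewrite -card_gt0 tri3 | exists t].
Qed.

Lemma generated_opposite u v x : x \in opposite generated [set u; v] ->
  [/\ x != u, x != v & exists t, [/\ u \in tri t, v \in tri t & x \in tri t]].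
Proof.
rewrite !inE negb_or => /andP[/andP[-> ->]] /andP[_ /existsP[t /subsetP st]].
by split=> //; exists t; split; apply: st; rewrite !inE eqxx ?orbT.
Qed.

Lemma mem_opposite u v x t : x != u -> x != v -> u \in tri t -> v \in tri t ->
  x \in tri t -> x \in opposite generated [set u; v].
Proof.
move=> xu xv ut vt xt; rewrite !inE negb_or xu xv /=; apply/andP; split.
  by apply/set0Pn; exists u; rewrite !inE eqxx !orbT.
apply/existsP; exists t; apply/subsetP => y.
by rewrite !inE => /or3P[]/eqP->.
Qed.

Lemma generated_link v a b t : a != b -> a != v -> b != v -> v \in tri t ->
  a \in tri t -> b \in tri t -> connect (link_adjacent generated v) a b.
Proof.
move=> ab av bv vt att bt; apply: connect1.
by rewrite /link_adjacent ab av bv (generated_triple vt att bt).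
Qed.

Lemma link_sym v : symmetric (link_adjacent generated v).
Proof.
move=> a b; rewrite /link_adjacent eq_sym setUAC.
by case: (a == v); case: (b == v); rewrite ?andbF.
Qed.

(** Both hypotheses speak of the generating triangles only. The two candidates [x], [y] bound the
    number of triangles on an edge, and the hub [a] connects the link of [v] since link adjacency is
    symmetric. *)
Lemma compact_generated :
  (forall u v, u != v -> exists x y, forall t z, u \in tri t -> v \in tri t ->
     z \in tri t -> z != u -> z != v -> z = x \/ z = y) ->
  (forall v, exists a, forall t b, v \in tri t -> b \in tri t -> b != v ->
     connect (link_adjacent generated v) a b) ->
  compact_surface generated.
Proof.
move=> deg lk; split.
- exact: generated_simplicial.
- exact: generated_pure.
- move=> u v /andP[uv _]; have [x [y xy]] := deg u v uv.
  apply: leq_trans (_ : #|[set x; y]| <= 2)%N; last by rewrite cards2; case: eqP.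
  apply/subset_leq_card/subsetP => z /generated_opposite[zu zv [t [ut vt zt]]].
  by have [->|->] := xy t z ut vt zt zu zv; rewrite !inE eqxx ?orbT.
- move=> v a b /andP[va /generated_pairP[t [vt att]]] /andP[vb /generated_pairP[t' [vt' bt']]].
  have [c cc] := lk v; apply: (@connect_trans _ _ c); last by apply: cc vt' bt' _; rewrite eq_sym.
  rewrite (sym_connect_sym (link_sym v)).
  by apply: cc vt att _; rewrite eq_sym.
Qed.
End GeneratedComplex.

(** * Elementary edge chains, and sums over the edges of a realized chain *)

Section Deltas.
Variable V : finType.

Definition edge_chain (s t u v : V) : int :=
  ((s == u) && (t == v))%:Z - ((s == v) && (t == u))%:Z.

Lemma edge_chainC s t u v : edge_chain s t v u = - edge_chain s t u v.
Proof. by rewrite /edge_chain opprB. Qed.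

Lemma sum_indicator (I : finType) (R : pzRingType) (i : I) (F : I -> R) :
  \sum_j F j * (i == j)%:R = F i.
Proof.
rewrite (bigD1 i) //= eqxx mulr1 big1 ?addr0 // => j /negPf ji.
by rewrite eq_sym ji mulr0.
Qed.

Lemma sum_edge_chain s t u : \sum_v edge_chain s t u v = (s == u)%:Z - (t == u)%:Z.
Proof.
rewrite sumrB; congr (_ - _).
  rewrite -(sum_indicator t (fun=> (s == u)%:Z)); apply: eq_bigr => v _.
  by case: eqP; case: eqP.
rewrite -(sum_indicator s (fun=> (t == u)%:Z)); apply: eq_bigr => v _.
by case: eqP; case: eqP.
Qed.

(** [realize] keeps one orientation of each edge, chosen by [enum_rank]. Antisymmetrizing [A] turns
    the sum into one over all ordered pairs, from which this choice has disappeared. *)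
Lemma sum_realize_sym (T : Type) (f : V -> T) (c : V -> V -> int)
    (A : T -> T -> int) : (forall u v, c v u = - c u v) ->
  \sum_(a <- realize f c) a.1 * (A a.2.1 a.2.2 - A a.2.2 a.2.1) =
  \sum_u \sum_v c u v * A (f u) (f v).
Proof.
move=> alt; rewrite big_map big_filter big_enum_cond /= pair_big /=.
have c0 u : c u u = 0 by have := alt u u; lia.
rewrite [RHS](bigID (fun p : V * V => (enum_rank p.1 < enum_rank p.2)%N)) /=.
transitivity (\sum_(i : V * V | (enum_rank i.1 < enum_rank i.2)%N)
   c i.1 i.2 * A (f i.1) (f i.2) +
 \sum_(i : V * V | (enum_rank i.1 < enum_rank i.2)%N) c i.2 i.1 * A (f i.2) (f i.1)).
  by rewrite -big_split /=; apply: eq_bigr => -[u v] _; rewrite /= (alt u); ring.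
congr (_ + _).
rewrite (reindex_inj (h := fun p : V * V => (p.2, p.1))) /=; last first.
  by move=> [a b] [a' b'] [-> ->].
rewrite [RHS](bigID (fun p : V * V => p.1 == p.2)) /= [X in _ = X + _]big1 ?add0r.
  apply: eq_bigl => -[u v] /=; rewrite -leqNgt ltn_neqAle andbC.
  by rewrite (inj_eq val_inj) (inj_eq enum_rank_inj) eq_sym.
by move=> [u v] /= /andP[_ /eqP->]; rewrite c0 mul0r.
Qed.

(** As [G] is alternating, the orientation kept by [realize] does not matter. A chain written as a
    combination of edges, possibly repeated or degenerate, is thus evaluated term by term. *)
Lemma sum_realize_edges (T : Type) (f : V -> T) (E : finType) (k : E -> int)
    (s t : E -> V) (c : V -> V -> int) (G : T -> T -> int) :
  (forall x y, G y x = - G x y) ->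
  (forall u v, c u v = \sum_e k e * edge_chain (s e) (t e) u v) ->
  \sum_(a <- realize f c) a.1 * G a.2.1 a.2.2 = \sum_e k e * G (f (s e)) (f (t e)).
Proof.
move=> alt cE; rewrite big_map big_filter big_enum_cond /=.
under eq_bigr do rewrite cE mulr_suml.
rewrite exchange_big /=; apply: eq_bigr => e _.
under eq_bigr do rewrite -mulrA.
rewrite -mulr_sumr; congr (_ * _).
have G0 x : G x x = 0 by have := alt x x; lia.
have pick a b : (enum_rank a < enum_rank b)%N ->
    \sum_(i : V * V | (enum_rank i.1 < enum_rank i.2)%N)
      edge_chain a b i.1 i.2 * G (f i.1) (f i.2) = G (f a) (f b).
  move=> ab; rewrite (bigD1 (a, b)) //= big1 ?addr0.
    rewrite /edge_chain !eqxx /=; case: eqP => [Eab|]; last by rewrite subr0 mul1r.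
    by rewrite Eab ltnn in ab.
  move=> [u v] /= /andP[uv ne]; rewrite /edge_chain.
  case: (eqVneq a u) ne => [<-|au] ne.
    rewrite xpair_eqE eqxx /= eq_sym in ne; rewrite (negPf ne) /=.
    by case: (eqVneq b a) ab => [->|_]; rewrite ?ltnn ?andbF ?subrr ?mul0r.
  by rewrite /=; case: eqP => [av|]; case: eqP => [bu|]; rewrite ?subrr ?mul0r //; move: uv; rewrite -av -bu ltnNge ltnW.
case: (ltngtP (enum_rank (s e)) (enum_rank (t e))) => [/pick //|/pick p|].
  rewrite alt -p -sumrN; apply: eq_bigr => -[u v] _ /=; rewrite -mulNr; congr (_ * _).
  by rewrite /edge_chain opprB [X in _ = (nat_of_bool X)%:Z - _]andbC [X in _ = _ - (nat_of_bool X)%:Z]andbC.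
move=> /val_inj/enum_rank_inj ->; rewrite G0 big1 // => -[u v] _ /=.
by rewrite /edge_chain andbC subrr mul0r.
Qed.
End Deltas.

Lemma sum_on_seq (V : finType) (W : nmodType) (s : seq V) (F : V -> W) :
  uniq s -> (forall v, v \notin s -> F v = 0) -> \sum_v F v = \sum_(v <- s) F v.
Proof.
move=> Us F0; rewrite (bigID (mem s)) /= [X in _ + X]big1 ?addr0; last by move=> v /F0.
by rewrite big_uniq.
Qed.

Section Homologous.
Variables (V : finType) (K : {set {set V}}).

Lemma homologous_refl c c' : (forall u v, c u v = c' u v) -> homologous K c c'.
Proof.
move=> cc; exists (fun _ _ _ => 0); first by split=> *; rewrite ?oppr0 // eqxx.
by move=> u v; rewrite cc subrr /boundary2 big1.
Qed.
End Homologous.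

(** * The ambient surface *)

(* The star of [SA i] is a disc with boundary edges (b_j, c_k), i + j + k = 0 or 1.
   It meets the star of [SA (i + 1)] along those with i + j + k = 0, so that the
   stars follow one another cyclically. *)
Section Surface.
Variable m : nat.
Notation Zm := 'I_m.+2.

Inductive svertex := SA of Zm | SB of Zm | SC of Zm.

Definition svertex_code v : Zm + (Zm + Zm) :=
  match v with SA i => inl i | SB j => inr (inl j) | SC k => inr (inr k) end.
Definition svertex_decode (x : Zm + (Zm + Zm)) : svertex :=
  match x with inl i => SA i | inr (inl j) => SB j | inr (inr k) => SC k end.
Lemma svertex_codeK : cancel svertex_code svertex_decode.
Proof. by case. Qed.
HB.instance Definition _ := Countable.copy svertex (can_type svertex_codeK).
HB.instance Definition _ : isFinite svertex := CanIsFinite svertex_codeK.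

Lemma svertex_eqE : ((forall i i', (SA i == SA i') = (i == i')) *
  (forall i i', (SB i == SB i') = (i == i')) * (forall i i', (SC i == SC i') = (i == i')) *
  (forall i j, (SA i == SB j) = false) * (forall i j, (SA i == SC j) = false) *
  (forall i j, (SB i == SA j) = false) * (forall i j, (SB i == SC j) = false) *
  (forall i j, (SC i == SA j) = false) * (forall i j, (SC i == SB j) = false))%type.
Proof. by do !split. Qed.

Lemma sum_svertex (R : nmodType) (F : svertex -> R) :
  \sum_v F v = \sum_i F (SA i) + (\sum_j F (SB j) + \sum_k F (SC k)).
Proof.
rewrite (reindex svertex_decode) /=; last first.
  exists svertex_code => [[|[]]|] //; exact: in1W svertex_codeK.
by rewrite !big_sumType /=.
Qed.

(** Faces of a triangular embedding of the complete tripartite graph on three copies of Z/N, N = m +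
    2, of genus (N - 1)(N - 2)/2. Any two vertices of different kinds span an edge, lying on one
    triangle with i + j + k = 0 and one with i + j + k = 1; the boolean is this sum. *)
Definition striangle (t : Zm * Zm * bool) : {set svertex} :=
  [set SA t.1.1; SB t.1.2; SC (t.2%:R - t.1.1 - t.1.2)].

Definition surface_complex : {set {set svertex}} := generated striangle.

Lemma mem_striangle v t : (v \in striangle t) =
  match v with
  | SA i => i == t.1.1 | SB j => j == t.1.2 | SC k => k == t.2%:R - t.1.1 - t.1.2
  end.
Proof. by case: v => i; rewrite !inE !svertex_eqE ?orbF. Qed.

Lemma striangle_card t : #|striangle t| = 3.
Proof. by rewrite /striangle -setUA !cardsU1 cards1 !inE !svertex_eqE. Qed.

Lemma striangle_cover v : exists t, v \in striangle t.
Proof.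
case: v => i; first by exists (i, 0, false); rewrite mem_striangle.
  by exists (0, i, false); rewrite mem_striangle.
by exists (- i, 0, false); rewrite mem_striangle /=; apply/eqP; ring.
Qed.

Definition port_sign (s : Zm) : int := (s == 0)%:Z - (s == 1)%:Z.

Definition surface_orientation u v w : int :=
  match u, v, w with
  | SA i, SB j, SC k | SB j, SC k, SA i | SC k, SA i, SB j => port_sign (i + j + k)
  | SB j, SA i, SC k | SC k, SB j, SA i | SA i, SC k, SB j => - port_sign (i + j + k)
  | _, _, _ => 0
  end.

(** Each edge lies on one positive and one negative triangle; this is why the orientation is a
    cycle. *)
Lemma sum_port_sign s : \sum_i port_sign (s + i) = 0.
Proof.
rewrite (reindex_inj (addrI (- s))) /=; under eq_bigr do rewrite addNKr.
have E (i : Zm) : \sum_j (j == i)%:Z = 1.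
  rewrite (bigD1 i) //= eqxx big1 ?addr0 // => j /negPf ji.
  by rewrite ji.
by rewrite /port_sign sumrB !E.
Qed.

Lemma Zm_lt2 (s : Zm) : s != 0 -> s != 1 -> port_sign s = 0.
Proof. by rewrite /port_sign => /negPf-> /negPf->. Qed.

Lemma port_triangle i j k : port_sign (i + j + k) != 0 ->
  exists e : bool, k = e%:R - i - j.
Proof.
have [E _|n0] := eqVneq (i + j + k) 0.
  by exists false; change (k = 0 - i - j); rewrite -E; ring.
have [E _|n1] := eqVneq (i + j + k) 1; last by rewrite Zm_lt2 ?eqxx.
by exists true; change (k = 1 - i - j); rewrite -E; ring.
Qed.

Lemma surface_fundamental : fundamental_cycle surface_complex surface_orientation.
Proof.
split.
- split.
  + by move=> [i|i|i] [j|j|j] [k|k|k] //=; rewrite ?oppr0 ?opprK.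
  + by move=> [i|i|i] [j|j|j] [k|k|k] //=; rewrite ?oppr0 ?opprK.
  + have T i j k : port_sign (i + j + k) != 0 -> exists e : bool,
      [/\ SA i \in striangle (i, j, e), SB j \in striangle (i, j, e)
        & SC k \in striangle (i, j, e)].
      by move=> /port_triangle[e ->]; exists e; rewrite !mem_striangle !eqxx.
    move=> [i|i|i] [j|j|j] [k|k|k] //=; rewrite ?oppr_eq0 => /T[e [hA hB hC]];
    solve [ exact: generated_triple hA hB hC | exact: generated_triple hA hC hB
          | exact: generated_triple hB hA hC | exact: generated_triple hB hC hA
          | exact: generated_triple hC hA hB | exact: generated_triple hC hB hA ].
- move=> u v w s3.
  have nuv : u != v.
    by apply: contra_eqN s3 => /eqP E; rewrite E setUid cards2; case: (_ != _ :> svertex).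
  have nuw : u != w.
    by apply: contra_eqN s3 => /eqP E; rewrite E setUAC setUid cards2; case: (_ != _ :> svertex).
  have nvw : v != w.
    by apply: contra_eqN s3 => /eqP E; rewrite E -setUA setUid cards2; case: (_ != _ :> svertex).
  clear s3 => /generated_tripleP[[[i j] e]]; rewrite !mem_striangle /= => -[].
  have P : `|port_sign (i + j + (e%:R - i - j))| = 1.
    have ->: i + j + (e%:R - i - j) = e%:R by ring.
    by case: e; rewrite /port_sign.
  by case: u nuv nuw => a nuv nuw; case: v nuv nvw => b nuv nvw;
    case: w nuw nvw => c nuw nvw // /eqP ? /eqP ? /eqP ?; subst;
    rewrite ?eqxx // in nuv nuw nvw *; rewrite ?normrN.
- have S i j : \sum_k port_sign (i + j + k) = 0 := sum_port_sign _.
  have S2 i k : \sum_j port_sign (i + j + k) = 0.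
    by under eq_bigr do rewrite addrAC; exact: sum_port_sign.
  have S1 j k : \sum_i port_sign (i + j + k) = 0.
    by under eq_bigr do rewrite -addrA addrC; exact: sum_port_sign.
  by move=> [i|i|i] [j|j|j]; rewrite /boundary2 sum_svertex /= ?sumrN ?S ?S1 ?S2
    ?big1 // ?oppr0 ?addr0.
Qed.

(** [P j] and [P (j + 1)] have the common neighbour [Q (c - j)]. The links of the vertices of Sigma
    and those of the centers of the discs both have this shape. *)
Lemma zigzag_connect (V : finType) (r : rel V) (P Q : Zm -> V) (c : Zm) :
  symmetric r -> (forall j, r (P j) (Q (c - j))) ->
  (forall j, r (P j) (Q (1 + c - j))) ->
  (forall j, connect r (P 0) (P j)) /\ (forall k, connect r (P 0) (Q k)).
Proof.
move=> rs r0 r1.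
have H j : connect r (P 0) (P j).
  rewrite -[j]natr_Zp; elim: (val j) => [|n IH]; first by rewrite mulr0n connect0.
  apply: connect_trans IH _.
  apply: (@connect_trans _ _ (Q (c - n%:R))); first exact: connect1.
  apply: connect1; rewrite rs; have := r1 n.+1%:R.
  by rewrite -natr1 opprD addrA addrAC [1 + c]addrC addrK.
split=> // k; apply: connect_trans (H (c - k)) _; apply: connect1.
by have := r0 (c - k); rewrite subKr.
Qed.

Lemma surface_opposite (u v : svertex) : u != v -> exists x y,
  forall t z, u \in striangle t -> v \in striangle t ->
    z \in striangle t -> z != u -> z != v -> z = x \/ z = y.
Proof.
have AB i j (t : Zm * Zm * bool) z : SA i \in striangle t -> SB j \in striangle t ->
    z \in striangle t -> z != SA i -> z != SB j ->
    z = SC (0 - i - j) \/ z = SC (1 - i - j).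
  case: t => -[i' j'] e; rewrite !mem_striangle /= => /eqP<- /eqP<-.
  case: z => k /eqP->; rewrite ?eqxx // => _ _.
  by case: e; [right|left].
have AC i k (t : Zm * Zm * bool) z : SA i \in striangle t -> SC k \in striangle t ->
    z \in striangle t -> z != SA i -> z != SC k ->
    z = SB (0 - i - k) \/ z = SB (1 - i - k).
  case: t => -[i' j'] e; rewrite !mem_striangle /= => /eqP<- /eqP->.
  have E : j' = e%:R - i - (e%:R - i - j') by ring.
  case: z => k' /eqP->; rewrite ?eqxx // => _ _.
  by case: e E => E; [right|left]; rewrite {1}E.
have BC j k (t : Zm * Zm * bool) z : SB j \in striangle t -> SC k \in striangle t ->
    z \in striangle t -> z != SB j -> z != SC k ->
    z = SA (0 - j - k) \/ z = SA (1 - j - k).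
  case: t => -[i' j'] e; rewrite !mem_striangle /= => /eqP<- /eqP->.
  have E : i' = e%:R - j - (e%:R - i' - j) by ring.
  case: z => k' /eqP->; rewrite ?eqxx // => _ _.
  by case: e E => E; [right|left]; rewrite {1}E.
have same w w' (P : Prop) : w = w' -> w != w' -> P by move=> ->; rewrite eqxx.
case: u => i; case: v => j uv.
- exists (SA i), (SA i) => t z; rewrite !mem_striangle => /eqP Ei /eqP Ej.
  by apply: same uv; rewrite Ei Ej.
- by do 2!eexists; exact: AB.
- by do 2!eexists; exact: AC.
- by exists (SC (0 - j - i)), (SC (1 - j - i)) => t z *; exact: (AB _ _ t).
- exists (SA i), (SA i) => t z; rewrite !mem_striangle => /eqP Ei /eqP Ej.
  by apply: same uv; rewrite Ei Ej.
- by do 2!eexists; exact: BC.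
- by exists (SB (0 - j - i)), (SB (1 - j - i)) => t z *; exact: (AC _ _ t).
- by exists (SA (0 - j - i)), (SA (1 - j - i)) => t z *; exact: (BC _ _ t).
- exists (SA i), (SA i) => t z; rewrite !mem_striangle => /eqP Ei /eqP Ej.
  by apply: same uv; rewrite Ei Ej.
Qed.

Lemma surface_triangles i j k (e : bool) : i + j + k = e%:R ->
  [/\ SA i \in striangle (i, j, e), SB j \in striangle (i, j, e)
    & SC k \in striangle (i, j, e)].
Proof. by rewrite !mem_striangle !eqxx /= => <-; split=> //; apply/eqP; ring. Qed.

Lemma surface_compact : compact_surface surface_complex.
Proof.
apply: compact_generated; [exact: striangle_card|exact: striangle_cover| |].
  exact: surface_opposite.
have L (v x y : svertex) i j k (e : bool) : i + j + k = e%:R -> [/\ v != x, v != y & x != y] ->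
    {subset [:: v; x; y] <= [:: SA i; SB j; SC k]} ->
    link_adjacent surface_complex v x y.
  move=> /surface_triangles[hA hB hC] [vx vy xy] sub.
  rewrite /link_adjacent xy eq_sym vx eq_sym vy /=.
  have In w : w \in [:: v; x; y] -> w \in striangle (i, j, e).
    by move=> /sub; rewrite !in_cons in_nil orbF => /or3P[]/eqP->.
  by apply: (@generated_triple _ _ _ _ _ _ (i, j, e)); apply: In; rewrite !inE eqxx ?orbT.
case=> i.
- have [] := @zigzag_connect _ (link_adjacent surface_complex (SA i)) SB SC (- i).
  + exact: link_sym.
  + move=> j; apply: (@L _ _ _ i j (- i - j) false) => //; first by rewrite mulr0n; ring.
  + move=> j; apply: (@L _ _ _ i j (1 + - i - j) true) => //; first by rewrite mulr1n; ring.
  move=> cB cC; exists (SB 0) => -[[i' j'] e] [k|k|k] //; rewrite !mem_striangle /=.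
  by move=> /eqP-> /eqP->; rewrite eqxx.
- have [] := @zigzag_connect _ (link_adjacent surface_complex (SB i)) SA SC (- i).
  + exact: link_sym.
  + move=> j; apply: (@L _ _ _ j i (- i - j) false) => //; first by rewrite mulr0n; ring.
    by move=> w; rewrite !inE => /or3P[]/eqP->; rewrite eqxx ?orbT.
  + move=> j; apply: (@L _ _ _ j i (1 + - i - j) true) => //; first by rewrite mulr1n; ring.
    by move=> w; rewrite !inE => /or3P[]/eqP->; rewrite eqxx ?orbT.
  move=> cA cC; exists (SA 0) => -[[i' j'] e] [k|k|k] //; rewrite !mem_striangle /=.
  by move=> /eqP-> /eqP->; rewrite eqxx.
- have [] := @zigzag_connect _ (link_adjacent surface_complex (SC i)) SA SB (- i).
  + exact: link_sym.
  + move=> j; apply: (@L _ _ _ j (- i - j) i false) => //; first by rewrite mulr0n; ring.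
    by move=> w; rewrite !inE => /or3P[]/eqP->; rewrite eqxx ?orbT.
  + move=> j; apply: (@L _ _ _ j (1 + - i - j) i true) => //; first by rewrite mulr1n; ring.
    by move=> w; rewrite !inE => /or3P[]/eqP->; rewrite eqxx ?orbT.
  move=> cA cB; exists (SA 0) => -[[i' j'] e] [k|k|k] //; rewrite !mem_striangle /=.
  by move=> /eqP-> /eqP->; rewrite eqxx.
Qed.

Lemma surface_no_boundary u v : ~~ boundary_edge surface_complex u v.
Proof.
apply/negP => /andP[/andP[uv /generated_pairP[t [ut vt]]] /cards1P[x Ex]].
have opp z (t' : Zm * Zm * bool) : u \in striangle t' -> v \in striangle t' ->
    z \in striangle t' -> z != u -> z != v -> z = x.
  move=> ut' vt' zt' zu zv; apply/set1P; rewrite -Ex.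
  exact: mem_opposite zu zv ut' vt' zt'.
clear Ex; case: t ut vt => -[i j] e; rewrite !mem_striangle /=.
have ne (a : Zm) : 0 + a <> 1 + a by move/addIr.
have TA a b := @surface_triangles a b (0 - a - b) false ltac:(by rewrite mulr0n; ring).
have TA' a b := @surface_triangles a b (1 - a - b) true ltac:(by rewrite mulr1n; ring).
have TB a c := @surface_triangles a (0 - a - c) c false ltac:(by rewrite mulr0n; ring).
have TB' a c := @surface_triangles a (1 - a - c) c true ltac:(by rewrite mulr1n; ring).
have TC b c := @surface_triangles (0 - b - c) b c false ltac:(by rewrite mulr0n; ring).
have TC' b c := @surface_triangles (1 - b - c) b c true ltac:(by rewrite mulr1n; ring).
have AB a b : (SA a = u /\ SB b = v) \/ (SA a = v /\ SB b = u) -> False.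
  case=> -[E1 E2]; move: opp; rewrite -E1 -E2 => opp;
  have [? ? ?] := TA a b; have [? ? ?] := TA' a b;
  (have e0 : SC (0 - a - b) = x by apply: (opp _ (a, b, false)));
  (have e1 : SC (1 - a - b) = x by apply: (opp _ (a, b, true)));
  by move: e0; rewrite -e1 => /eqP; rewrite svertex_eqE -!addrA => /eqP; exact: ne.
have AC a c : (SA a = u /\ SC c = v) \/ (SA a = v /\ SC c = u) -> False.
  case=> -[E1 E2]; move: opp; rewrite -E1 -E2 => opp;
  have [? ? ?] := TB a c; have [? ? ?] := TB' a c;
  (have e0 : SB (0 - a - c) = x by apply: (opp _ (a, 0 - a - c, false)));
  (have e1 : SB (1 - a - c) = x by apply: (opp _ (a, 1 - a - c, true)));
  by move: e0; rewrite -e1 => /eqP; rewrite svertex_eqE -!addrA => /eqP; exact: ne.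
have BC b c : (SB b = u /\ SC c = v) \/ (SB b = v /\ SC c = u) -> False.
  case=> -[E1 E2]; move: opp; rewrite -E1 -E2 => opp;
  have [? ? ?] := TC b c; have [? ? ?] := TC' b c;
  (have e0 : SA (0 - b - c) = x by apply: (opp _ (0 - b - c, b, false)));
  (have e1 : SA (1 - b - c) = x by apply: (opp _ (1 - b - c, b, true)));
  by move: e0; rewrite -e1 => /eqP; rewrite svertex_eqE -!addrA => /eqP; exact: ne.
move: uv AB AC BC; clear; case: u => a; case: v => b uv AB AC BC;
  try by move=> /eqP Ea /eqP Eb; move: uv; rewrite Ea Eb eqxx.
- by move=> _ _; apply: AB; left.
- by move=> _ _; apply: AC; left.
- by move=> _ _; apply: AB; right.
- by move=> _ _; apply: BC; left.
- by move=> _ _; apply: AC; right.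
- by move=> _ _; apply: BC; right.
Qed.

Lemma surface_connected u v : connect (adjacent surface_complex) u v.
Proof.
have sym : symmetric (adjacent surface_complex).
  by move=> x y; rewrite /adjacent eq_sym setUC.
have cB a b : connect (adjacent surface_complex) (SA a) (SB b).
  apply: connect1; rewrite /adjacent svertex_eqE /=.
  by apply: (@generated_pair _ _ _ _ _ (a, b, false)); rewrite mem_striangle /=.
have c0 w : connect (adjacent surface_complex) (SB 0) w.
  case: w => a; first by rewrite (sym_connect_sym sym).
    apply: (@connect_trans _ _ (SA 0)) => //.
    by rewrite (sym_connect_sym sym).
  apply: connect1; rewrite /adjacent svertex_eqE /=.
  apply: (@generated_pair _ _ _ _ _ (- a, 0, false)); rewrite mem_striangle //=.
  by apply/eqP; rewrite mulr0n; ring.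
by apply: (@connect_trans _ _ (SB 0)); rewrite // (sym_connect_sym sym).
Qed.

Lemma surface_closed : closed_connected_surface surface_complex.
Proof.
split; [exact: surface_compact|exact: surface_no_boundary| |exact: surface_connected].
by apply/card_gt0P; exists (SA 0).
Qed.

Definition tripartite_surface : oriented_surface :=
  OrientedSurface surface_closed surface_fundamental.
End Surface.

(** * Discs joined by strips *)

Section PieceVertices.
Variables (m : nat) (Nd Gt : finType).
Notation Zm := 'I_m.+2.

(* [O], [Pb], [Pc]: center and rim of a disc; [Rb], [Rc]: ends of the middle of a strip. *)
Inductive fvertex := O of Nd | Pb of Nd & Zm | Pc of Nd & Zm | Rb of Gt | Rc of Gt.

Definition fvertex_code v : Nd + (Nd * Zm + (Nd * Zm + (Gt + Gt))) :=
  match v with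
  | O n => inl n | Pb n j => inr (inl (n, j)) | Pc n k => inr (inr (inl (n, k)))
  | Rb g => inr (inr (inr (inl g))) | Rc g => inr (inr (inr (inr g))) end.
Definition fvertex_decode (x : Nd + (Nd * Zm + (Nd * Zm + (Gt + Gt)))) :=
  match x with
  | inl n => O n | inr (inl p) => Pb p.1 p.2 | inr (inr (inl p)) => Pc p.1 p.2
  | inr (inr (inr (inl g))) => Rb g | inr (inr (inr (inr g))) => Rc g end.
Lemma fvertex_codeK : cancel fvertex_code fvertex_decode.
Proof. by case. Qed.
HB.instance Definition _ := Countable.copy fvertex (can_type fvertex_codeK).
HB.instance Definition _ : isFinite fvertex := CanIsFinite fvertex_codeK.

Lemma fvertex_eqE : (((forall n n', (O n == O n') = (n == n')) *
  (forall n j n' j', (Pb n j == Pb n' j') = (n == n') && (j == j')) *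
  (forall n j n' j', (Pc n j == Pc n' j') = (n == n') && (j == j')) *
  (forall g g', (Rb g == Rb g') = (g == g')) *
  (forall g g', (Rc g == Rc g') = (g == g'))) *
  ((forall n n' j, (O n == Pb n' j) = false) * (forall n n' j, (O n == Pc n' j) = false) *
   (forall n g, (O n == Rb g) = false) * (forall n g, (O n == Rc g) = false)) *
  ((forall n n' j, (Pb n' j == O n) = false) * (forall n n' j, (Pc n' j == O n) = false) *
   (forall n g, (Rb g == O n) = false) * (forall n g, (Rc g == O n) = false)) *
  ((forall n n' j j', (Pb n j == Pc n' j') = false) *
   (forall n j g, (Pb n j == Rb g) = false) * (forall n j g, (Pb n j == Rc g) = false)) *
  ((forall n n' j j', (Pc n j == Pb n' j') = false) *
   (forall n j g, (Pc n j == Rb g) = false) * (forall n j g, (Pc n j == Rc g) = false)) *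
  ((forall n j g, (Rb g == Pb n j) = false) * (forall n j g, (Rb g == Pc n j) = false) *
   (forall g g', (Rb g == Rc g') = false)) *
  ((forall n j g, (Rc g == Pb n j) = false) * (forall n j g, (Rc g == Pc n j) = false) *
   (forall g g', (Rc g == Rb g') = false)))%type.
Proof. by do !split. Qed.

End PieceVertices.
Arguments O {m Nd Gt}.
Arguments Pb {m Nd Gt}.
Arguments Pc {m Nd Gt}.
Arguments Rb {m Nd Gt}.
Arguments Rc {m Nd Gt}.

(* Nodes are discs and gates are strips.  The disc of a node of level i is a
   smaller copy of the star of [SA i]; a strip of column j leaves the disc [low]
   through the edge of b_j, and enters the disc [upp] of the next level. *)
Record diagram (m : nat) := Diagram {
  node : finType;
  gate : finType;
  lev : node -> 'I_m.+2;
  low : gate -> node;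
  upp : gate -> node;
  col : gate -> 'I_m.+2;
  tw : gate -> bool;
  lev_upp : forall g, lev (upp g) = lev (low g) + 1;
  port_inj : forall g g', lev (low g) = lev (low g') -> col g = col g' -> g = g'
}.

(** * The triangulated surface of a diagram *)

Section DiagramComplex.
Variables (m : nat) (D : diagram m).
Notation Zm := 'I_m.+2.
Notation Nd := (node D).
Notation Gt := (gate D).
Notation fv := (fvertex m Nd Gt).
Implicit Types (n : Nd) (g : Gt) (j k : Zm).

Definition nd g (e : bool) := if e then upp g else low g.
(** The strip crosses the edge of b_(col g) and c_(kap g), common to the stars of the two levels:
    with the lower level the indices add up to 0, with the upper one to 1. [kapE] treats both ends
    uniformly. *)
Definition kap g : Zm := - lev (low g) - col g.

Definition rim (x : bool) n j k : fv := if x then Pc n k else Pb n j.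
Definition gv (s : bool) g : fv := if s then Rc g else Rb g.
Definition att (s : bool) g (e : bool) :=
  rim (s (+) (tw g && ~~ e)) (nd g e) (col g) (kap g).

(* The half of a strip on the side of the disc [nd g e] is made of two triangles.
   At its lower end a twisted strip is attached with its two corners exchanged. *)
Definition ftriangle (t : Nd * Zm * bool + Gt * bool * bool) : {set fv} :=
  match t with
  | inl (n, j, e) => [set O n; Pb n j; Pc n (e%:R - lev n - j)]
  | inr (g, e, false) => [set gv e g; gv (~~ e) g; att (~~ e) g e]
  | inr (g, e, true) => [set gv e g; att e g e; att (~~ e) g e]
  end.

Definition fcomplex := generated ftriangle.

Lemma kapE g (e : bool) : kap g = e%:R - lev (nd g e) - col g.
Proof. by case: e; rewrite /kap /= ?mulr0n ?mulr1n ?lev_upp; ring. Qed.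

Lemma nd_neq g : nd g true != nd g false.
Proof.
apply/eqP => /(congr1 (@lev m D)); rewrite /= lev_upp => E.
have : (1 : Zm) = 0 by rewrite -(subrr (lev (low g))) -{1}E addrC addKr.
by [].
Qed.

Lemma nd_inj g e e' : nd g e = nd g e' -> e = e'.
Proof. by case: e; case: e' => // E; have := nd_neq g; rewrite E eqxx. Qed.

Lemma kap_inj g g' : col g = col g' -> kap g = kap g' -> g = g'.
Proof. by move=> c; rewrite /kap c => /addIr/oppr_inj l; apply: port_inj. Qed.

Lemma cell_gate_inj g g' e : nd g e = nd g' e -> col g = col g' -> g = g'.
Proof.
move=> n c; apply: kap_inj => //.
by rewrite !(kapE _ e) n c.
Qed.

Lemma rim_eq x n j k x' n' j' k' : rim x n j k = rim x' n' j' k' ->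
  [/\ x = x', n = n' & if x then k = k' else j = j'].
Proof. by case: x; case: x' => //= -[-> ->]. Qed.

Lemma gv_eq s g s' g' : gv s g = gv s' g' -> s = s' /\ g = g'.
Proof. by case: s; case: s' => //= -[->]. Qed.

Lemma gv_rim s g x n j k : gv s g <> rim x n j k.
Proof. by case: s; case: x. Qed.

Lemma gv_att s g s' g' e : gv s g != att s' g' e.
Proof. by apply/eqP/gv_rim. Qed.

Lemma gv_neg (e : bool) g : gv e g != gv (~~ e) g.
Proof. by apply/eqP => /gv_eq[]; case: e. Qed.

Lemma gv_neq (s s' : bool) g : s != s' -> gv s g != gv s' g.
Proof. by move=> ss; apply/eqP => /gv_eq[Es _]; rewrite Es eqxx in ss. Qed.

Lemma att_neg (e s : bool) g : att s g e != att (~~ s) g e.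
Proof. by apply/eqP => /rim_eq[]; case: s; case: (_ && _). Qed.

Lemma ftriangle_card t : #|ftriangle t| = 3.
Proof.
have c3 (V : finType) (a b c : V) : a != b -> a != c -> b != c -> #|[set a; b; c]| = 3.
  by move=> ab ac bc; rewrite -setUA !cardsU1 cards1 !inE negb_or ab ac bc.
by case: t => [[[n j] e]|[[g e] [|]]] /=; apply: c3;
  rewrite ?fvertex_eqE ?gv_att ?gv_neg ?att_neg.
Qed.

Lemma ftriangle_cover v : exists t, v \in ftriangle t.
Proof.
case: v => [n|n j|n k|g|g].
- by exists (inl (n, 0, false)); rewrite !inE eqxx.
- by exists (inl (n, j, false)); rewrite !inE eqxx orbT.
- exists (inl (n, - lev n - k, false)); rewrite !inE; apply/orP; right.
  by apply/eqP; congr (Pc _ _); rewrite mulr0n; ring.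
- by exists (inr (g, false, false)); rewrite !inE eqxx.
- by exists (inr (g, true, false)); rewrite !inE eqxx.
Qed.

Lemma mem_disc v n j (e : bool) : v \in ftriangle (inl (n, j, e)) ->
  [\/ v = O n, v = Pb n j | v = Pc n (e%:R - lev n - j)].
Proof. by rewrite !inE -orbA => /or3P[]/eqP->; [constructor 1|constructor 2|constructor 3]. Qed.

Lemma mem_arm v g e x : v \in ftriangle (inr (g, e, x)) ->
  [\/ v = gv e g, ~~ x /\ v = gv (~~ e) g, x /\ v = att e g e | v = att (~~ e) g e].
Proof.
by case: x; rewrite !inE -orbA => /or3P[]/eqP->;
  [constructor 1|constructor 3|constructor 4|constructor 1|constructor 2|constructor 4].
Qed.

Lemma arm_cell g e s : att s g e \in ftriangle (inl (nd g e, col g, e)).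
Proof. by rewrite /att /rim /= -kapE; case: ifP; rewrite !inE eqxx ?orbT. Qed.

Lemma gv_mem s g t : gv s g \in ftriangle t -> exists e x, t = inr (g, e, x).
Proof.
case: t => [[[n j] e] /mem_disc[]|[[g' e] x] /mem_arm[]].
- by case: s.
- by case: s.
- by case: s.
- by move=> /gv_eq[_ ->]; exists e, x.
- by case=> _ /gv_eq[_ ->]; exists e, x.
- by case=> _ /eqP; rewrite (negPf (gv_att _ _ _ _ _)).
- by move/eqP; rewrite (negPf (gv_att _ _ _ _ _)).
Qed.

Lemma rim_mem y n j k t : rim y n j k \in ftriangle t ->
  (exists e : bool, t = inl (n, if y then e%:R - lev n - k else j, e)) \/
  (exists g e x s, [/\ t = inr (g, e, x), n = nd g e & rim y n j k = att s g e]).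
Proof.
case: t => [[[n' j'] e] /mem_disc[]|[[g' e] x] /mem_arm[]].
- by case: y.
- by case: y => //= -[<- <-]; left; exists e.
- case: y => //= -[<- ->]; left; exists e; congr (inl (_, _, _)); ring.
- by move=> /esym/gv_rim.
- by case=> _ /esym/gv_rim.
- by case=> _ E; right; exists g', e, x, e; split=> //; have [] := rim_eq E.
- by move=> E; right; exists g', e, x, (~~ e); split=> //; have [] := rim_eq E.
Qed.

Lemma O_mem n t : O n \in ftriangle t -> exists j e, t = inl (n, j, e).
Proof.
case: t => [[[n' j'] e] /mem_disc[]|[[g' e] x] /mem_arm[]] //.
- by case=> ->; exists j', e.
- by case: e.
- by case=> _; case: e.
- by case=> _; rewrite /att /rim; case: ifP.
- by rewrite /att /rim; case: ifP.
Qed.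

Lemma arm_gv s g e x : gv s g \in ftriangle (inr (g, e, x)) -> s = e \/ ~~ x.
Proof.
move=> /mem_arm[/gv_eq[-> _]|[-> _]|[_ E]|E]; [by left|by right| |].
  by have := gv_att s g e g e; rewrite E eqxx.
by have := gv_att s g (~~ e) g e; rewrite E eqxx.
Qed.

Lemma arm_att s g e e' x : att s g e \in ftriangle (inr (g, e', x)) ->
  e = e' /\ (s = ~~ e' \/ x).
Proof.
move=> /mem_arm[E|[_ E]|[xT E]|E].
- by have := gv_att e' g s g e; rewrite E eqxx.
- by have := gv_att (~~ e') g s g e; rewrite E eqxx.
- by have [_ /nd_inj -> _] := rim_eq E; split=> //; right.
- have [_ /nd_inj Ee _] := rim_eq E; split=> //; left; rewrite Ee in E.
  by have := att_neg e' s g; rewrite E; case: (s) (e') => -[] //; rewrite eqxx.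
Qed.

Lemma arm_att_inj s g e s' e' : att s g e = att s' g e' -> s = s' /\ e = e'.
Proof.
move=> E; have [_ /nd_inj Ee _] := rim_eq E; split=> //; rewrite Ee in E.
by have := att_neg e' s g; rewrite E; case: (s) (s') => -[] //; rewrite eqxx.
Qed.

Let Degree (u v : fv) := exists x y, forall t z, u \in ftriangle t -> v \in ftriangle t ->
    z \in ftriangle t -> z != u -> z != v -> z = x \/ z = y.

Lemma degree_sym u v : Degree u v -> Degree v u.
Proof. by case=> x [y H]; exists x, y => t z *; apply: (H t). Qed.

Lemma degree_O n v : O n != v -> Degree (O n) v.
Proof.
move=> ne.
suff: exists f : bool -> fv, forall t z, O n \in ftriangle t -> v \in ftriangle t ->
    z \in ftriangle t -> z != O n -> z != v -> exists e, z = f e.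
  case=> f H; exists (f false), (f true) => t z h1 h2 h3 h4 h5.
  by case: (H t z h1 h2 h3 h4 h5) => -[] ->; [right|left].
case: v ne => [n'|n' j|n' k|g|g] ne.
- exists (fun=> O n) => t z /O_mem[j [e ->]] /mem_disc[] //.
  by move=> E; rewrite E eqxx in ne.
- exists (fun e : bool => Pc n (e%:R - lev n - j)).
  move=> t z /O_mem[j' [e ->]] /mem_disc[] // [-> ->] /mem_disc[->|->|->];
    rewrite ?eqxx // => _ _; by exists e.
- exists (fun e : bool => Pb n (e%:R - lev n - k)).
  move=> t z /O_mem[j' [e ->]] /mem_disc[] // [-> ->] /mem_disc[->|->|->];
    rewrite ?eqxx // => _ _; exists e; congr (Pb _ _); ring.
- by exists (fun=> O n) => t z /O_mem[j [e ->]] /mem_disc[].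
- by exists (fun=> O n) => t z /O_mem[j [e ->]] /mem_disc[].
Qed.

Lemma degree_gv_gv s g s' g' : gv s g != gv s' g' -> Degree (gv s g) (gv s' g').
Proof.
move=> ne; exists (att true g false), (att false g true) => t z h h'.
have [e [x Et]] := gv_mem h; rewrite Et in h h' *.
have Eg : g' = g by have [e' [x' [-> _ _]]] := gv_mem h'.
rewrite {g'}Eg in ne h' *.
have {ne} Es : s' = ~~ s by case: (s) (s') ne => -[] //; rewrite eqxx.
rewrite {s'}Es in h' *.
have {h'}xF : ~~ x by case: (arm_gv h) (arm_gv h') => [->|//] []; case: (e).
move=> /mem_arm[->|[_ ->]|[xT _]|->].
- by case: (e); case: (s); rewrite ?eqxx.
- by case: (e); case: (s); rewrite ?eqxx.
- by rewrite xT in xF.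
- by case: (e); [right|left].
Qed.

Lemma gv_rim_mem s g y n j k t : gv s g \in ftriangle t -> rim y n j k \in ftriangle t ->
  exists e x s', t = inr (g, e, x) /\ rim y n j k = att s' g e.
Proof.
move=> /gv_mem[e [x ->]] /rim_mem[[//]|[g' [e' [x' [s' [[-> -> ->] _ ->]]]]]].
by exists e', x', s'.
Qed.

Lemma degree_gv_rim s g y n j k : Degree (gv s g) (rim y n j k).
Proof.
have [[t [h1 h2]]|none] := pselect (exists t, gv s g \in ftriangle t /\ rim y n j k \in ftriangle t);
  last by exists (O n), (O n) => t z h1 h2; case: none; exists t.
have [e [x [s' [_ ->]]]] := gv_rim_mem h1 h2.
exists (gv (~~ s) g), (att (~~ s') g e) => {h1 h2}t z h1 h2.
have [e1 [x1 Et]] := gv_mem h1; rewrite Et in h1 h2 *.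
have [Ee _] := arm_att h2; rewrite -Ee => {h1 h2}.
move=> /mem_arm[->|[_ ->]|[_ ->]|->].
- by case: (e); case: (s); rewrite ?eqxx //; left.
- by case: (e); case: (s); rewrite ?eqxx //; left.
- by case: (e); case: (s'); rewrite ?eqxx //; right.
- by case: (e); case: (s'); rewrite ?eqxx //; right.
Qed.

Lemma att_pair g e s : exists y, att s g e = rim y (nd g e) (col g) (kap g) /\
  att (~~ s) g e = rim (~~ y) (nd g e) (col g) (kap g).
Proof. by exists (s (+) (tw g && ~~ e)); rewrite /att addNb. Qed.

(** The two corners at an end of a strip give both its column and its [kap], which determine the
    strip. *)
Lemma att_pair_inj g e s g' e' s' : att s g e = att s' g' e' ->
  att (~~ s) g e = att (~~ s') g' e' -> g = g' /\ e = e'.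
Proof.
have [y [-> ->]] := att_pair g e s; have [y' [-> ->]] := att_pair g' e' s'.
move=> /rim_eq[Ey En E1] /rim_eq[_ _ E2]; have Eg : g = g'.
  by apply: kap_inj; case: (y) E1 E2.
by split=> //; move: En; rewrite Eg => /nd_inj.
Qed.

Lemma rim_rim_arm y n j k y' n' j' k' g e x :
  rim y n j k != rim y' n' j' k' ->
  rim y n j k \in ftriangle (inr (g, e, x)) -> rim y' n' j' k' \in ftriangle (inr (g, e, x)) ->
  x /\ exists s, rim y n j k = att s g e /\ rim y' n' j' k' = att (~~ s) g e.
Proof.
move=> ne /mem_arm[/esym/gv_rim|[_ /esym/gv_rim]|[xT E1]|E1] //.
  move=> /mem_arm[/esym/gv_rim|[_ /esym/gv_rim]|[_ E2]|E2] //.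
    by rewrite E1 E2 eqxx in ne.
  by split=> //; exists e.
move=> /mem_arm[/esym/gv_rim|[_ /esym/gv_rim]|[xT E2]|E2] //.
  by split=> //; exists (~~ e); rewrite negbK.
by rewrite E1 E2 eqxx in ne.
Qed.

(** A rim edge lies on one disc triangle and on at most one strip triangle, by [att_pair_inj]. The
    third vertices are the center of the disc and a middle corner of the strip. *)
Lemma degree_rim_rim y n j k y' n' j' k' : rim y n j k != rim y' n' j' k' ->
  Degree (rim y n j k) (rim y' n' j' k').
Proof.
move=> ne.
have [[g [e [s [E1 E2]]]]|none] := pselect (exists g e s,
  rim y n j k = att s g e /\ rim y' n' j' k' = att (~~ s) g e).
  exists (O n), (gv e g) => -[[[n1 j1] e1]|[[g1 e1] x1]] z h h'.
    move=> zt z1 z2; left.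
    have R : forall w, w \in ftriangle (inl (n1, j1, e1)) -> w <> O n1 ->
      exists q, w = rim q n1 j1 (e1%:R - lev n1 - j1).
      by move=> w /mem_disc[//|->|->] _; [exists false|exists true].
    have [|q Eq] := R _ h; first by case: (y).
    have [|q' Eq'] := R _ h'; first by case: (y').
    have En : n = n1 by case: (rim_eq Eq).
    case: (mem_disc zt) => [->|E|E]; first by rewrite En.
      by move: ne z1 z2; rewrite Eq Eq' E; case: (q); case: (q'); rewrite /= ?eqxx.
    by move: ne z1 z2; rewrite Eq Eq' E; case: (q); case: (q'); rewrite /= ?eqxx.
  have [xT [s1 [F1 F2]]] := rim_rim_arm ne h h'.
  have [Eg Ee] : g1 = g /\ e1 = e.
    by apply: (@att_pair_inj _ _ s1 _ _ s); rewrite -?F1 -?F2.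
  rewrite F1 F2 xT Eg Ee => /mem_arm[->|[]//|[_ ->]|->]; first by right.
    by case: (e); case: (s1); rewrite ?eqxx.
  by case: (e); case: (s1); rewrite ?eqxx.
exists (O n), (O n) => -[[[n1 j1] e1]|[[g1 e1] x1]] z h h'; last first.
  have [xT [s1 [F1 F2]]] := rim_rim_arm ne h h'.
  by case: none; exists g1, e1, s1.
move=> zt z1 z2; left.
have R : forall w, w \in ftriangle (inl (n1, j1, e1)) -> w <> O n1 ->
  exists q, w = rim q n1 j1 (e1%:R - lev n1 - j1).
  by move=> w /mem_disc[//|->|->] _; [exists false|exists true].
have [|q Eq] := R _ h; first by case: (y).
have [|q' Eq'] := R _ h'; first by case: (y').
have En : n = n1 by case: (rim_eq Eq).
case: (mem_disc zt) => [->|E|E]; first by rewrite En.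
  by move: ne z1 z2; rewrite Eq Eq' E; case: (q); case: (q'); rewrite /= ?eqxx.
by move: ne z1 z2; rewrite Eq Eq' E; case: (q); case: (q'); rewrite /= ?eqxx.
Qed.

Lemma fcomplex_degree u v : u != v -> Degree u v.
Proof.
have kind w : [\/ exists n, w = O n, exists y n j, w = rim y n j j | exists s g, w = gv s g].
  case: w => [n|n j|n j|g|g].
  - by constructor 1; exists n.
  - by constructor 2; exists false, n, j.
  - by constructor 2; exists true, n, j.
  - by constructor 3; exists false, g.
  - by constructor 3; exists true, g.
move=> uv; case: (kind u) => [[n Eu]|[y [n [j Eu]]]|[s [g Eu]]].
- by rewrite Eu in uv *; apply: degree_O.
- case: (kind v) => [[n' Ev]|[y' [n' [j' Ev]]]|[s [g Ev]]]; rewrite Eu Ev in uv *.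
  + by apply/degree_sym/degree_O; rewrite eq_sym.
  + exact: degree_rim_rim.
  + exact/degree_sym/degree_gv_rim.
- case: (kind v) => [[n' Ev]|[y' [n' [j' Ev]]]|[s' [g' Ev]]]; rewrite Eu Ev in uv *.
  + by apply/degree_sym/degree_O; rewrite eq_sym.
  + exact/degree_gv_rim.
  + exact: degree_gv_gv.
Qed.

(** For a rim vertex the hub is the center of the disc, from which a strip is reached through the
    other end of the attaching edge. For a middle corner of a strip it is the other middle corner.
    The link of a center is the whole rim, a zigzag. *)
Lemma fcomplex_link (v : fv) : exists a, forall t b, v \in ftriangle t -> b \in ftriangle t ->
  b != v -> connect (link_adjacent fcomplex v) a b.
Proof.
have L t a b c : a \in ftriangle t -> b \in ftriangle t -> c \in ftriangle t ->
    a != b -> a != c -> b != c -> connect (link_adjacent fcomplex a) b c.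
  move=> aT bT cT ab ac bc.
  by apply: (generated_link (t := t)) => //; rewrite eq_sym.
have disc n j (e : bool) : [/\ O n \in ftriangle (inl (n, j, e)),
    Pb n j \in ftriangle (inl (n, j, e)) &
    Pc n (e%:R - lev n - j) \in ftriangle (inl (n, j, e))].
  by rewrite !inE !eqxx ?orbT.
have link_rim y n j k : exists a, forall t b, rim y n j k \in ftriangle t ->
    b \in ftriangle t -> b != rim y n j k ->
    connect (link_adjacent fcomplex (rim y n j k)) a b.
  exists (O n) => t b vt; have [[e Et]|[g [e [x [s [Et En Ea]]]]]] := rim_mem vt => bt bv.
    rewrite Et in vt bt; have [->|bO] := eqVneq b (O n); first exact: connect0.
    by apply: L vt _ bt _ _ _; rewrite 1?eq_sym //; [case: (disc n (if y then e%:R - lev n - k else j) e)|case: (y)].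
  rewrite Ea Et in vt bt bv *; rewrite {Et Ea}En.
  have oc s' : O (nd g e) != att s' g e by rewrite /att /rim; case: ifP.
  have o1 : connect (link_adjacent fcomplex (att s g e)) (O (nd g e)) (att (~~ s) g e).
    apply: (L (inl (nd g e, col g, e))); rewrite ?arm_cell ?att_neg ?oc //.
      by case: (disc (nd g e) (col g) e).
    by rewrite eq_sym oc.
  have [a1 a2 a3] : [/\ gv e g \in ftriangle (inr (g, e, true)),
     att s g e \in ftriangle (inr (g, e, true)) & att (~~ s) g e \in ftriangle (inr (g, e, true))].
    by case: (e); case: (s); rewrite !inE !eqxx ?orbT.
  have o2 : connect (link_adjacent fcomplex (att s g e)) (att (~~ s) g e) (gv e g).
    by apply: L a2 a3 a1 _ _ _; rewrite ?att_neg // eq_sym gv_att.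
  have o12 := connect_trans o1 o2.
  case: (mem_arm bt) bv => [->|[xF Eb]|[_ ->]|->] bv //.
  - case: (arm_att vt) => _ [Es|xT]; last by rewrite xT in xF.
    apply: connect_trans o12 _.
    have Ex : x = false by case: (x) xF.
    rewrite Ex in vt bt; rewrite Eb in bt bv *.
    apply: L vt _ bt _ _ _; rewrite ?gv_neg 1?eq_sym ?gv_att //.
    by rewrite !inE eqxx.
  - by case: (e) (s) bv o1 => -[]; rewrite ?eqxx.
  - by case: (e) (s) bv o1 => -[]; rewrite ?eqxx.
have link_gv s g : exists a, forall t b, gv s g \in ftriangle t ->
    b \in ftriangle t -> b != gv s g -> connect (link_adjacent fcomplex (gv s g)) a b.
  exists (gv (~~ s) g) => t b vt bt bv.
  have [e [x Et]] := gv_mem vt; rewrite Et in vt bt.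
  have [a1 a2 a3] : [/\ gv s g \in ftriangle (inr (g, e, false)),
     gv (~~ s) g \in ftriangle (inr (g, e, false)) & att (~~ e) g e \in ftriangle (inr (g, e, false))].
    by case: (e); case: (s); rewrite !inE !eqxx ?orbT.
  have o1 : connect (link_adjacent fcomplex (gv s g)) (gv (~~ s) g) (att (~~ e) g e).
    by apply: L a1 a2 a3 _ _ _; rewrite ?gv_neg ?gv_att.
  case: (mem_arm bt) bv => [->|[_ ->]|[xT Eb]|->] bv //.
  - by case: (e) (s) bv o1 => -[]; rewrite ?eqxx.
  - by case: (e) (s) bv o1 => -[]; rewrite ?eqxx.
  have Es : s = e by case: (arm_gv vt); rewrite ?xT.
  apply: connect_trans o1 _; rewrite Eb xT Es in vt bt *.
  apply: L vt _ bt _ _ _; rewrite ?gv_att // 1?eq_sym ?att_neg //.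
  by rewrite !inE eqxx orbT.
case: v => [n|n j|n k|g|g].
- have [] := @zigzag_connect _ _ (link_adjacent fcomplex (O n)) (Pb n) (Pc n) (- lev n).
  + exact: link_sym.
  + move=> j; have := disc n j false; rewrite mulr0n sub0r => -[h1 h2 h3].
    by rewrite /link_adjacent !fvertex_eqE; apply: (generated_triple h1 h2 h3).
  + move=> j; have := disc n j true; rewrite mulr1n => -[h1 h2 h3].
    by rewrite /link_adjacent !fvertex_eqE; apply: (generated_triple h1 h2 h3).
  move=> cB cC; exists (Pb n 0) => t b /O_mem[j [e ->]] /mem_disc[->|->|->] //.
  by rewrite eqxx.
- exact: (link_rim false n j j).
- exact: (link_rim true n k k).
- exact: (link_gv false g).
- exact: (link_gv true g).
Qed.

Lemma fcomplex_compact : compact_surface fcomplex.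
Proof.
apply: compact_generated; [exact: ftriangle_card|exact: ftriangle_cover| |].
  exact: fcomplex_degree.
exact: fcomplex_link.
Qed.

End DiagramComplex.

(** * The boundary of the spanning surface *)

Section DiagramBoundary.
Variables (m : nat) (D : diagram m).
Notation Zm := 'I_m.+2.
Notation Nd := (node D).
Notation Gt := (gate D).
Notation fv := (fvertex m Nd Gt).
Implicit Types (n : Nd) (g : Gt) (j k : Zm) (e s : bool) (u v w : fv).
Local Notation bd := (boundary_edge (fcomplex D)).

Definition cell_gate n j e := [pick g : Gt | (nd g e == n) && (col g == j)].

Variant cell_gate_spec n j e : option Gt -> Prop :=
  | CellGate g of nd g e = n & col g = j : cell_gate_spec n j e (Some g)
  | FreeCell of (forall g, nd g e = n -> col g = j -> False) : cell_gate_spec n j e None.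

Lemma cell_gateP n j e : cell_gate_spec n j e (cell_gate n j e).
Proof.
rewrite /cell_gate; case: pickP => [g /andP[/eqP En /eqP Ec]|none]; first by constructor.
by constructor=> g En Ec; have := none g; rewrite En Ec !eqxx.
Qed.

Lemma cell_gateE g e : cell_gate (nd g e) (col g) e = Some g.
Proof.
case: cell_gateP => [g' En Ec|/(_ g)]; first by rewrite (cell_gate_inj En Ec).
by move=> F; case: F.
Qed.

Definition opp_spoke n j e : Zm := e%:R - lev n - j.

Lemma opp_spokeK n e : involutive (fun j => opp_spoke n j e).
Proof. by move=> j; rewrite /opp_spoke subKr. Qed.

Lemma opp_spoke_gate g e : opp_spoke (nd g e) (kap g) e = col g.
Proof. by rewrite (kapE _ e) -/(opp_spoke _ _ _) (opp_spokeK _ e). Qed.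

Lemma opp_spoke_neq n j : opp_spoke n j true != opp_spoke n j false.
Proof.
apply/eqP => /addIr/addIr; rewrite mulr0n mulr1n => /eqP.
by rewrite oner_eq0.
Qed.

(** The boundary graph is the union of two perfect matchings, one for each [e]. At a rim vertex [e]
    selects one of two disc triangles: the boundary follows the strip attached to it or, failing
    that, its rim edge. At a middle corner [e] selects the end of the strip. *)
Definition boundary_nbr v e : fv :=
  match v with
  | O n => O n
  | Pb n j => if cell_gate n j e is Some g then gv (tw g && ~~ e) g else Pc n (opp_spoke n j e)
  | Pc n k => if cell_gate n (opp_spoke n k e) e is Some g then gv (~~ (tw g && ~~ e)) g
              else Pb n (opp_spoke n k e)
  | Rb g => att false g e
  | Rc g => att true g e
  end.

Definition on_boundary v := if v is O _ then false else true.

Lemma nbr_gv s g e : boundary_nbr (gv s g) e = att s g e.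
Proof. by case: s. Qed.

Lemma nbr_att s g e : boundary_nbr (att s g e) e = gv s g.
Proof.
rewrite /att /rim; case: ifP => Ey /=.
  rewrite opp_spoke_gate cell_gateE; congr gv.
  by case: s Ey; case: (_ && _).
by rewrite cell_gateE; congr gv; case: s Ey; case: (_ && _).
Qed.

Lemma att_on_boundary s g e : on_boundary (att s g e).
Proof. by rewrite /att /rim; case: ifP. Qed.

Lemma nbr_on_boundary v e : on_boundary v -> on_boundary (boundary_nbr v e).
Proof.
case: v => [//|n j|n k|g|g] _; rewrite ?att_on_boundary //=; try exact: att_on_boundary.
  by case: cell_gateP => [g _ _|//]; case: (_ && _).
by case: cell_gateP => [g _ _|//]; case: (_ && _).
Qed.

Lemma nbrK e v : on_boundary v -> boundary_nbr (boundary_nbr v e) e = v.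
Proof.
case: v => [//|n j|n k|g|g] _; last 2 first.
- exact: (nbr_att false).
- exact: (nbr_att true).
- change (boundary_nbr (if cell_gate n j e is Some g then gv (tw g && ~~ e) g
    else Pc n (opp_spoke n j e)) e = Pb n j).
  case: cell_gateP => [g <- <-|none]; first by rewrite nbr_gv /att addbb.
  rewrite /= (opp_spokeK n e j); case: cell_gateP => [g En Ec|//].
  by case: (none g).
- change (boundary_nbr (if cell_gate n (opp_spoke n k e) e is Some g
    then gv (~~ (tw g && ~~ e)) g else Pb n (opp_spoke n k e)) e = Pc n k).
  case: cell_gateP => [g En Ec|none].
    rewrite nbr_gv /att addNb addbb /= En; congr (Pc _ _).
    by rewrite (kapE _ e) En Ec; apply: (opp_spokeK n e k).
  rewrite /= (opp_spokeK n e k); case: cell_gateP => [g En Ec|//].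
  by case: (none g).
Qed.

Lemma nbr_neq v : on_boundary v -> boundary_nbr v true != boundary_nbr v false.
Proof.
have G g g' s s' : nd g true = nd g' false -> gv s g != gv s' g'.
  by move=> E; apply/eqP => /gv_eq[_ Eg]; have := nd_neq g; rewrite {1}E -Eg eqxx.
have A s g : att s g true != att s g false.
  by apply/eqP => /arm_att_inj[_].
case: v => [//|n j|n k|g|g] _; rewrite ?(A false) ?(A true) //=.
- case: cell_gateP => [g En _|_]; case: cell_gateP => [g' En' _|_].
  + by apply: G; rewrite En En'.
  + by apply/eqP; case: (_ && _).
  + by apply/eqP; case: (_ && _).
  + by rewrite fvertex_eqE negb_and opp_spoke_neq orbT.
- case: cell_gateP => [g En _|_]; case: cell_gateP => [g' En' _|_].
  + by apply: G; rewrite En En'.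
  + by apply/eqP; case: (_ && _).
  + by apply/eqP; case: (_ && _).
  + by rewrite fvertex_eqE negb_and opp_spoke_neq orbT.
Qed.

Lemma disc_mem n j e : [/\ O n \in ftriangle (D := D) (inl (n, j, e)),
    Pb n j \in ftriangle (D := D) (inl (n, j, e)) &
    Pc n (opp_spoke n j e) \in ftriangle (D := D) (inl (n, j, e))].
Proof. by rewrite !inE !eqxx ?orbT. Qed.

Lemma arm_mem g e x : [/\ gv e g \in ftriangle (inr (g, e, x)),
  att (~~ e) g e \in ftriangle (inr (g, e, x)) &
  (if x then att e g e else gv (~~ e) g) \in ftriangle (inr (g, e, x))].
Proof. by case: x; rewrite !inE !eqxx ?orbT. Qed.

Lemma boundary_edge_sym : symmetric bd.
Proof. by move=> u v; rewrite /boundary_edge /adjacent eq_sym setUC. Qed.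

Lemma boundary_edge_mem u v : bd u v ->
  u != v /\ exists t, u \in ftriangle t /\ v \in ftriangle t.
Proof. by move=> /andP[/andP[-> /generated_pairP]]. Qed.

Lemma interior_edge u v x y t t' : u \in ftriangle (D := D) t -> v \in ftriangle t ->
  x \in ftriangle t -> u \in ftriangle t' -> v \in ftriangle t' ->
  y \in ftriangle t' -> x != u -> x != v -> y != u -> y != v -> x != y -> ~~ bd u v.
Proof.
move=> ut vt xt ut' vt' yt' xu xv yu yv xy; rewrite negb_and orbC.
apply/orP; left; apply/cards1P => -[z Ez].
have : x \in [set z] by rewrite -Ez; apply: mem_opposite xu xv ut vt xt.
have : y \in [set z] by rewrite -Ez; apply: mem_opposite yu yv ut' vt' yt'.
by move=> /set1P Ey /set1P Ex; rewrite Ex Ey eqxx in xy.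
Qed.

Lemma exterior_edge u v x t : u != v -> u \in ftriangle (D := D) t -> v \in ftriangle t ->
  x \in ftriangle t -> x != u -> x != v ->
  (forall t z, u \in ftriangle t -> v \in ftriangle t -> z \in ftriangle t ->
    z != u -> z != v -> z = x) -> bd u v.
Proof.
move=> uv ut vt xt xu xv uniq; apply/andP; split.
  by rewrite /adjacent uv (generated_pair ut vt).
apply/cards1P; exists x; apply/setP => z; rewrite in_set1; apply/idP/eqP => [|->].
  by move=> /generated_opposite[zu zv [t' [ut' vt' zt']]]; exact: (uniq t' z).
exact: mem_opposite xu xv ut vt xt.
Qed.

(** The rail from [gv s g] to [att s g e] is half of a side of the strip, and lies on one triangle
    only. Which of the two triangles of the half strip it is depends on [s == e], because of the
    diagonal. *)
Definition third s g e : fv := if s == e then att (~~ e) g e else gv e g.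

Lemma third_mem s g e : [/\ gv s g \in ftriangle (inr (g, e, s == e)),
  att s g e \in ftriangle (inr (g, e, s == e)) &
  third s g e \in ftriangle (inr (g, e, s == e))].
Proof.
by have [a1 a2 a3] := arm_mem g e (s == e); rewrite /third; move: a1 a2 a3; case: (s) (e) => -[].
Qed.

Lemma rail_third s g e t z : gv s g \in ftriangle t -> att s g e \in ftriangle t ->
  z \in ftriangle t -> z != gv s g -> z != att s g e -> z = third s g e.
Proof.
rewrite /third => ut vt zt zu zv; have [e' [x Et]] := gv_mem ut; rewrite Et in ut vt zt.
have [Ee' vx] := arm_att vt; rewrite -Ee' in ut vt zt vx; have ux := arm_gv ut.
case: (eqVneq s e) => [Es|Ns]; case: (mem_arm zt) => [E|[xF E]|[xT E]|E] //.
- by rewrite E Es eqxx in zu.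
- rewrite Es in vx; case: vx => [|xT]; last by rewrite xT in xF.
  by case: (e).
- by rewrite E Es eqxx in zv.
- by move: zu; rewrite E; move: Ns; case: (s) (e) => -[]; rewrite ?eqxx.
- by case: ux => [Es|]; [rewrite Es eqxx in Ns|rewrite xT].
- by move: zv; rewrite E; move: Ns; case: (s) (e) => -[]; rewrite ?eqxx.
Qed.

Lemma third_neq s g e : third s g e != gv s g /\ third s g e != att s g e.
Proof.
rewrite /third; case: (eqVneq s e) => [->|N].
  by rewrite eq_sym gv_att eq_sym att_neg.
by rewrite gv_att eq_sym gv_neq.
Qed.

Lemma rail_edge s g e : bd (gv s g) (att s g e).
Proof.
have [a1 a2 a3] := third_mem s g e; have [n1 n2] := third_neq s g e.
apply: (exterior_edge _ a1 a2 a3 n1 n2); first exact: gv_att.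
by move=> t z; apply: rail_third.
Qed.

Lemma opp_spoke_inj n j : injective (opp_spoke n j).
Proof.
by move=> [] [] // E; have := opp_spoke_neq n j; rewrite E eqxx.
Qed.

Lemma arm_rims n j k g e x : Pb n j \in ftriangle (inr (g, e, x)) ->
  Pc n k \in ftriangle (inr (g, e, x)) -> [/\ x, nd g e = n, col g = j & kap g = k].
Proof.
move=> h1 h2; have [//|xT [s [E1 E2]]] := @rim_rim_arm _ _ false n j k true n j k g e x _ h1 h2.
have [y [F1 F2]] := att_pair g e s; rewrite F1 in E1; rewrite F2 in E2.
have [Ey En Ej] := rim_eq E1; have [_ _ Ek] := rim_eq E2.
by split.
Qed.

Lemma free_rim_edge n j e : cell_gate n j e = None -> bd (Pb n j) (Pc n (opp_spoke n j e)).
Proof.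
case: cell_gateP => // free _; have [h1 h2 h3] := disc_mem n j e.
apply: (exterior_edge _ h2 h3 h1); rewrite ?fvertex_eqE //.
move=> [[[n' j'] e']|[[g e'] x]] z t1 t2.
  case/mem_disc: t1 => // -[En Ej]; rewrite -En -Ej in t2 *.
  case/mem_disc: t2 => // Ek /mem_disc[->|->|->] //; first by rewrite eqxx.
  by rewrite Ek eqxx.
have [_ En Ec Ek] := arm_rims t1 t2.
suff Ee : e' = e by rewrite Ee in En; case: (free g).
by apply: (@opp_spoke_inj n j); rewrite -Ek (kapE _ e') En Ec.
Qed.

Lemma nbr_edge v e : on_boundary v -> bd v (boundary_nbr v e).
Proof.
case: v => [//|n j|n k|g|g] _; last 2 first.
- exact: (rail_edge false).
- exact: (rail_edge true).
- rewrite /=; case E : (cell_gate n j e) => [g|]; last exact: free_rim_edge.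
  rewrite boundary_edge_sym; case: cell_gateP E => // g' En Ec [Eg].
  have -> : Pb n j = att (tw g && ~~ e) g e by rewrite /att addbb /= -Eg En Ec.
  exact: rail_edge.
- rewrite /=; case E : (cell_gate n (opp_spoke n k e) e) => [g|]; last first.
    by rewrite boundary_edge_sym -{2}[k](opp_spokeK n e); apply: free_rim_edge.
  rewrite boundary_edge_sym; case: cell_gateP E => // g' En Ec [Eg].
  suff -> : Pc n k = att (~~ (tw g && ~~ e)) g e by exact: rail_edge.
  by rewrite /att addNb addbb /= -Eg En (kapE _ e) En Ec -/(opp_spoke _ _ _) (opp_spokeK n e).
Qed.

Lemma spoke_interior n j e : ~~ bd (O n) (Pb n j) /\ ~~ bd (O n) (Pc n (opp_spoke n j e)).
Proof.
split.
  have [a1 a2 a3] := disc_mem n j true; have [b1 b2 b3] := disc_mem n j false.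
  by apply: (interior_edge a1 a2 a3 b1 b2 b3); rewrite ?fvertex_eqE // negb_and opp_spoke_neq orbT.
set k := opp_spoke n j e.
have [a1 a2 a3] := disc_mem n (opp_spoke n k true) true.
have [b1 b2 b3] := disc_mem n (opp_spoke n k false) false.
rewrite (opp_spokeK n true k) in a3; rewrite (opp_spokeK n false k) in b3.
by apply: (interior_edge a1 a3 a2 b1 b3 b2); rewrite ?fvertex_eqE // negb_and opp_spoke_neq orbT.
Qed.

Lemma att_interior s g e : ~~ bd (att s g e) (att (~~ s) g e).
Proof.
have [a1 _ _] := disc_mem (nd g e) (col g) e.
have [b1 b2 b3] := arm_mem g e true.
apply: (@interior_edge _ _ (O (nd g e)) (gv e g) (inl (nd g e, col g, e)) (inr (g, e, true)));
  rewrite ?arm_cell ?gv_att //.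
- by case: (s) (e) b2 b3 => -[].
- by case: (s) (e) b2 b3 => -[].
- by case E: (att s g e) (att_on_boundary s g e).
- by case E: (att (~~ s) g e) (att_on_boundary (~~ s) g e).
- by apply/eqP; case: (e).
Qed.

Lemma gv_interior s g : ~~ bd (gv s g) (gv (~~ s) g).
Proof.
have [a1 a2 a3] := arm_mem g s false; have [b1 b2 b3] := arm_mem g (~~ s) false.
rewrite negbK in b2 b3.
apply: (interior_edge a1 a3 a2 b3 b1 b2); rewrite 1?eq_sym ?gv_att //.
by apply/eqP => /arm_att_inj[_]; case: (s).
Qed.

Lemma diagonal_interior g e : ~~ bd (gv e g) (att (~~ e) g e).
Proof.
have [a1 a2 a3] := arm_mem g e false; have [b1 b2 b3] := arm_mem g e true.
apply: (interior_edge a1 a2 a3 b1 b2 b3); rewrite ?gv_att ?att_neg //.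
  by rewrite eq_sym gv_neg.
by rewrite eq_sym gv_att.
Qed.

Lemma boundary_edgeP u v : bd u v -> on_boundary u /\ exists e, v = boundary_nbr u e.
Proof.
pose C u v := on_boundary u /\ exists e, v = boundary_nbr u e.
have Csym u' v' : C u' v' -> C v' u'.
  by case=> bu [e ->]; split; [exact: nbr_on_boundary | exists e; rewrite nbrK].
have OB n w t : w \in ftriangle t -> O n \in ftriangle t -> w != O n -> ~~ bd (O n) w.
  move=> wt /O_mem[j [e Et]]; rewrite Et in wt.
  have [s1 s2] := spoke_interior n j e.
  by case: (mem_disc wt) => ->; rewrite ?eqxx.
have BC n j e : bd (Pb n j) (Pc n (opp_spoke n j e)) -> C (Pb n j) (Pc n (opp_spoke n j e)).
  move=> h; split=> //; exists e; rewrite /=.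
  case: cell_gateP => // g En Ec; move: h; rewrite -En -Ec /opp_spoke -kapE.
  have := att_interior (tw g && ~~ e) g e.
  by rewrite /att addNb addbb /= => /negPf->.
have GA s g e : C (gv s g) (att s g e).
  by split; [case: (s) | exists e; rewrite nbr_gv].
move=> uv; have [ne [t [ut vt]]] := boundary_edge_mem uv.
have [[n Eu]|nOu] := pselect (exists n, u = O n).
  by rewrite Eu in ut uv ne; rewrite (negPf (OB _ _ _ vt ut _)) // eq_sym in uv.
have [[n Ev]|nOv] := pselect (exists n, v = O n).
  by rewrite Ev boundary_edge_sym in uv; rewrite Ev in vt ne;
     rewrite (negPf (OB _ _ _ ut vt _)) in uv.
case: t ut vt => [[[n j] e] /mem_disc[Eu|Eu|Eu] /mem_disc[Ev|Ev|Ev]|[[g e] x]].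
- by case: nOu; exists n.
- by case: nOu; exists n.
- by case: nOu; exists n.
- by case: nOv; exists n.
- by rewrite Eu Ev eqxx in ne.
- by rewrite Eu Ev in uv *; apply: BC.
- by case: nOv; exists n.
- by rewrite Eu Ev in uv *; apply: Csym; apply: BC; rewrite boundary_edge_sym.
- by rewrite Eu Ev eqxx in ne.
move=> /mem_arm[Eu|[xu Eu]|[xu Eu]|Eu] /mem_arm[Ev|[xv Ev]|[xv Ev]|Ev];
  rewrite Eu Ev in uv ne *; rewrite ?eqxx // in ne.
- by rewrite (negPf (gv_interior _ _)) in uv.
- exact: GA.
- by rewrite (negPf (diagonal_interior _ _)) in uv.
- by rewrite boundary_edge_sym (negPf (gv_interior _ _)) in uv.
- by rewrite xv in xu.
- exact: GA.
- exact/Csym/GA.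
- by rewrite xu in xv.
- by rewrite (negPf (att_interior _ _ _)) in uv.
- by rewrite boundary_edge_sym (negPf (diagonal_interior _ _)) in uv.
- exact/Csym/GA.
- by rewrite boundary_edge_sym (negPf (att_interior _ _ _)) in uv.
Qed.

Lemma boundary_card v : on_boundary v -> #|[set w | bd v w]| = 2.
Proof.
move=> bv; have -> : [set w | bd v w] = [set boundary_nbr v true; boundary_nbr v false].
  apply/setP => w; rewrite !inE; apply/idP/orP => [/boundary_edgeP[_ [[] ->]]|[]/eqP->].
  - by left.
  - by right.
  - exact: nbr_edge.
  - exact: nbr_edge.
by rewrite cards2 nbr_neq.
Qed.

Lemma fcomplex_no_closed : no_closed_component (fcomplex D).
Proof.
move=> v; case E: v => [n|n j|n k|g|g].
  exists (Pb n 0), (boundary_nbr (Pb n 0) false); split; first exact: nbr_edge.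
  apply: connect1; rewrite /adjacent fvertex_eqE /=.
  by have [h1 h2 _] := disc_mem n 0 false; apply: generated_pair h1 h2.
all: by exists v, (boundary_nbr v false); rewrite E connect0; split=> //; apply: nbr_edge.
Qed.

Lemma boundary_cycle v0 : on_boundary v0 ->
  (forall u v, on_boundary u -> on_boundary v -> connect bd u v) ->
  exists s : seq fv, [/\ uniq s, cycle bd s, (2 < size s)%N
    & forall u v, bd u v -> v = next s u /\ u \in s \/ u = next s v /\ v \in s].
Proof.
move=> b0 conn.
have [||||||s [Us Cs sz mem nx]] := @hamiltonian_cycle _ bd on_boundary _ _ _ _ _ v0.
- exact: boundary_edge_sym.
- by move=> v; rewrite /boundary_edge /adjacent eqxx.
- exact: boundary_card.
- by move=> u v /boundary_edgeP[].
- by move=> u v; apply: conn.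
- by [].
exists s; split=> // u v uv; have [bu _] := boundary_edgeP uv.
move: (uv); rewrite boundary_edge_sym => /boundary_edgeP[bv _].
by case: (nx _ _ uv) => ->; [left|right]; rewrite mem.
Qed.
End DiagramBoundary.

(** * Positions in the thickened surface *)

Section SurfacePoints.
Variables (R : realType) (m : nat).
Notation Zm := 'I_m.+2.
Notation Sg := (tripartite_surface m).
Implicit Types (i j k : Zm) (A B C : R).

Definition pt i j k A B C : spoint R Sg :=
  [ffun u : svertex m => (match u with
   | SA i' => A *+ (i' == i) | SB j' => B *+ (j' == j) | SC k' => C *+ (k' == k) end : R)].

Lemma pt_add i j k A B C A' B' C' :
  pt i j k A B C + pt i j k A' B' C' = pt i j k (A + A') (B + B') (C + C').
Proof. by apply/ffunP => -[] l; rewrite !ffunE mulrnDl. Qed.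

Lemma pt_scale i j k A B C (a : R) : a *: pt i j k A B C = pt i j k (a * A) (a * B) (a * C).
Proof. by apply/ffunP => -[] l; rewrite !ffunE /= -mulrnAr. Qed.

Lemma pt_irrA i i' j k B C : pt i j k 0 B C = pt i' j k 0 B C.
Proof. by apply/ffunP => -[] l; rewrite !ffunE ?mul0rn. Qed.
Lemma pt_irrB i j j' k A C : pt i j k A 0 C = pt i j' k A 0 C.
Proof. by apply/ffunP => -[] l; rewrite !ffunE ?mul0rn. Qed.
Lemma pt_irrC i j k k' A B : pt i j k A B 0 = pt i j k' A B 0.
Proof. by apply/ffunP => -[] l; rewrite !ffunE ?mul0rn. Qed.

Lemma pt_inj i j k A B C i' j' k' A' B' C' :
  pt i j k A B C = pt i' j' k' A' B' C' ->
  [/\ A = A', B = B' & C = C'] /\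
  [/\ A != 0 -> i = i', B != 0 -> j = j' & C != 0 -> k = k'].
Proof.
have D (T : eqType) (a a' : T) (x x' : R) : x *+ (a == a) = x' *+ (a == a') ->
    x *+ (a' == a) = x' *+ (a' == a') -> x = x' /\ (x != 0 -> a = a').
  rewrite !eqxx !mulr1n eq_sym; have [->|_] := eqVneq a a'; first by rewrite mulr1n.
  by rewrite !mulr0n => -> <-; rewrite eqxx.
move=> /ffunP E.
have [-> EA] : A = A' /\ (A != 0 -> i = i').
  by apply: D; [have := E (SA i) | have := E (SA i')]; rewrite !ffunE.
have [-> EB] : B = B' /\ (B != 0 -> j = j').
  by apply: D; [have := E (SB j) | have := E (SB j')]; rewrite !ffunE.
have [-> EC] : C = C' /\ (C != 0 -> k = k').
  by apply: D; [have := E (SC k) | have := E (SC k')]; rewrite !ffunE.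
by split; split.
Qed.

Lemma support_pt i j k A B C (e : bool) : k = e%:R - i - j ->
  Defs.support (pt i j k A B C) \subset striangle (i, j, e).
Proof.
move=> Ek; apply/subsetP => -[l|l|l]; rewrite inE ffunE mem_striangle /=;
  by rewrite ?Ek; case: (_ == _ :> 'I_m.+2); rewrite // mulr0n eqxx.
Qed.

Lemma in_surface_pt i j k A B C (e : bool) : k = e%:R - i - j ->
  0 <= A -> 0 <= B -> 0 <= C -> A + B + C = 1 -> in_surface (pt i j k A B C).
Proof.
move=> Ek A0 B0 C0 ABC; split.
- by case=> l; rewrite ffunE mulrn_wge0.
- rewrite (sum_svertex (fun v => pt i j k A B C v)) /=.
  have S (l : Zm) (x : R) : \sum_l' x *+ (l' == l) = x.
    rewrite (bigD1 l) //= eqxx big1 ?addr0 // => l' /negPf ->.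
    by rewrite mulr0n.
  under eq_bigr do rewrite ffunE; rewrite S.
  under eq_bigr do rewrite ffunE; rewrite S.
  by under eq_bigr do rewrite ffunE; rewrite S addrA.
- apply/generatedP; split; last by exists (i, j, e); apply: support_pt.
  apply/set0Pn; apply: contrapT => none.
  have z v : pt i j k A B C v = 0.
    by apply/eqP/negPn/negP => nz; apply: none; exists v; rewrite inE.
  move: ABC; have := z (SA i); have := z (SB j); have := z (SC k).
  rewrite !ffunE !eqxx !mulr1n => -> -> ->; rewrite !addr0 => /esym/eqP.
  by rewrite oner_eq0.
Qed.

Lemma in_simplex_pt i j k A B C (e : bool) : k = e%:R - i - j ->
  in_simplex (S := Sg) (striangle (i, j, e)) (pt i j k A B C).
Proof. exact: support_pt. Qed.

Lemma striangle_complex (t : Zm * Zm * bool) : striangle t \in surface_complex m.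
Proof.
apply/generatedP; split; last by exists t.
by rewrite -card_gt0 striangle_card.
Qed.
End SurfacePoints.

(** [eps] is half the vertical thickness of the neighbourhood. The conditions on twisted strips make
    their lower disc alone in its level and forbid strips entering it from below. In [tw_height],
    80/3 = 40 * 2/3: the middle corner [Rb], with coordinate 2/3 at b, lies in the plane of slope 40
    * [eps] that contains the raised corner, at height 20 = 40 * 1/2. *)
Record layout (R : realType) (m : nat) (D : diagram m) := Layout {
  eps : R;
  hN : node D -> R;
  hG : gate D -> R;
  eps_gt0 : 0 < eps;
  eps_small : eps <= 1 / 1000;
  hN_range : forall n, 30 * eps <= hN n <= 1 - 30 * eps;
  hG_range : forall g, 30 * eps <= hG g <= 1 - eps;
  hN_sep : forall n n', lev n = lev n' -> n != n' -> 4 * eps <= `|hN n - hN n'|;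
  tw_base : forall (g : gate D) (n : node D), tw g -> lev n = lev (low g) -> n = low g;
  tw_bottom : forall g g' : gate D, tw g -> lev (upp g') != lev (low g);
  tw_height : forall g : gate D, tw g -> hG g = hN (low g) + 80 / 3 * eps
}.

Section Positions.
Variables (R : realType) (m : nat) (D : diagram m) (Y : layout R D).
Notation Zm := 'I_m.+2.
Notation Nd := (node D).
Notation Gt := (gate D).
Notation fv := (fvertex m Nd Gt).
Notation Sg := (tripartite_surface m).
Notation E := (eps Y).
Implicit Types (n : Nd) (g : Gt) (j k : Zm) (e : bool) (t x : R).

(* A twisted strip makes its half turn by folding over: the corner [Pb] of the
   disc to which it is attached is lifted. *)
Definition raised n j := if cell_gate n j false is Some g then tw g else false.

(* The parameter t in [-1, 1] runs through the fibre of the tubular neighbourhood.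
   The radius depends on |t|, so that the two lifts of a rim project to a circle
   inside the projection of the rim itself, and do not cross it. *)
Definition radius t : R := 1 / 2 - E / 4 * `|t|.
(** At every t the raised corner lies in the plane of height hN + eps t + 40 eps B, where B is the
    coordinate at b_j; the rest of the disc triangle is there with B = 0. Indeed 20 - 2 t = t + 40
    (1/2 - 3 t / 40). *)
Definition radius_b n j t : R := if raised n j then 1 / 2 - 3 / 40 * t else radius t.
Definition height_b n j t : R :=
  hN Y n + (if raised n j then E * 20 - 2 * E * t else E * t).
(** On a twisted strip the shift t / 20 keeps [Rb] in the plane just described for the parameter -
    t, the fibre being reversed at the twisted end: 80/3 + t = - t + 40 (2/3 + t / 20). *)
Definition beta g t : R := 2 / 3 + (if tw g then t / 20 else 0).

Definition pos (v : fv) t : tpoint R Sg :=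
  match v with
  | O n => (pt (lev n) 0 0 1 0 0, hN Y n + E * t)
  | Pb n j => (pt (lev n) j 0 (1 - radius_b n j t) (radius_b n j t) 0, height_b n j t)
  | Pc n k => (pt (lev n) 0 k (1 - radius t) 0 (radius t), hN Y n + E * t)
  | Rb g => (pt 0 (col g) (kap g) 0 (beta g t) (1 - beta g t), hG Y g + E * t)
  | Rc g => (pt 0 (col g) (kap g) 0 (1 / 3) (2 / 3), hG Y g + E * t)
  end.

Definition sg (b : bool) : R := if b then 1 else -1.
Definition fposition (v : fv) : tpoint R Sg := pos v 0.
Definition tposition (p : fv * bool) : tpoint R Sg := pos p.1 (sg p.2).

Lemma pair_scale (P : spoint R Sg) (z a : R) :
  a *: ((P, z) : tpoint R Sg) = (a *: P, a * z).
Proof. by []. Qed.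

Lemma pair_add (P Q : spoint R Sg) (z z' : R) :
  ((P, z) : tpoint R Sg) + (Q, z') = (P + Q, z + z').
Proof. by []. Qed.

Lemma pt_pair i j k (A B C z A' B' C' z' : R) : A = A' -> B = B' -> C = C' -> z = z' ->
  (pt i j k A B C, z) = (pt i j k A' B' C', z') :> tpoint R Sg.
Proof. by move=> -> -> -> ->. Qed.

Lemma radius0 : radius 0 = 1 / 2. Proof. by rewrite /radius normr0; lra. Qed.

Lemma radius_interp t b : 0 <= t -> (1 - t) * radius 0 + t * radius (sg b) = radius (sg b * t).
Proof.
move=> t0; rewrite /radius normrM (ger0_norm t0) normr0.
by case: b; rewrite /= ?normrN normr1; ring.
Qed.

(** Although [pos] involves |t|, it is affine on each half of a fibre. Points of the bundle are thus
    values of [pos] at a signed parameter in [-1, 1]. *)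
Lemma pos_interp v t b : 0 <= t ->
  interp (pos v 0, pos v (sg b)) t = pos v (sg b * t).
Proof.
move=> t0; have r := radius_interp b t0.
have rb n j : (1 - t) * radius_b n j 0 + t * radius_b n j (sg b) = radius_b n j (sg b * t).
  by rewrite /radius_b; case: ifP => // _; field.
case: v => [n|n j|n k|g|g]; rewrite /interp /= !pair_scale pair_add !pt_scale pt_add.
- by apply: pt_pair; ring.
- by rewrite -rb /height_b; case: ifP => _; apply: pt_pair; ring.
- by rewrite -r; apply: pt_pair; ring.
- by rewrite /beta; case: ifP => _; apply: pt_pair; field.
- by apply: pt_pair; ring.
Qed.
End Positions.

(** * Real inequalities behind embeddedness *)

Section PieceInequalities.
Variables (R : realType).
Implicit Types (E a b t s h H X u : R).

Lemma eq_of_small E a b : 0 < E -> `|a - b| <= 1 / 2 * `|a - b| -> a = b.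
Proof.
move=> E0 le; apply/eqP; rewrite -subr_eq0 -normr_eq0; apply/eqP.
by have := normr_ge0 (a - b); lra.
Qed.

Lemma radius_bounds E t : 0 < E -> E <= 1 / 1000 -> -1 <= t <= 1 ->
  49 / 100 <= 1 / 2 - E / 4 * `|t| <= 1 / 2.
Proof.
move=> E0 E1 t1; have : 0 <= `|t| <= 1 by rewrite normr_ge0 ler_norml.
by nra.
Qed.

Lemma norm_prod_le E t t' : 0 < E -> `|E / 4 * `|t'| - E / 4 * `|t| | <= E / 4 * `|t - t'|.
Proof.
move=> E0; rewrite -mulrBr normrM ger0_norm ?ler_pM2l; [|lra|lra].
by rewrite distrC; apply: ler_dist_dist.
Qed.

(** [X] is the total weight of the middle corners. The equation on radii bounds |X - X'| by E/2 |t -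
    t'|. The equation on heights bounds it below by E |t - t'|, as |H - h| <= 1. Hence t = t'. *)
Lemma arm_monotone E h H t t' X X' : 0 < E -> E <= 1 / 1000 ->
  `|H - h| <= 1 -> -1 <= t <= 1 -> -1 <= t' <= 1 -> 0 <= X <= 1 -> 0 <= X' <= 1 ->
  (1 - X) * (1 / 2 - E / 4 * `|t|) + X = (1 - X') * (1 / 2 - E / 4 * `|t'|) + X' ->
  h * (1 - X) + H * X + E * t = h * (1 - X') + H * X' + E * t' -> t = t' /\ X = X'.
Proof.
move=> E0 E1 Hh t1 t1' X1 X1' Eu Ez.
have r1 := radius_bounds E0 E1 t1.
have le1 : `|X - X'| <= E / 2 * `|t - t'|.
  have eq : (X - X') * (1 - (1 / 2 - E / 4 * `|t|)) = (1 - X') * (E / 4 * `|t| - E / 4 * `|t'|).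
    by lra.
  have : `|X - X'| * (1 - (1 / 2 - E / 4 * `|t|)) = (1 - X') * `|E / 4 * `|t| - E / 4 * `|t'| |.
    rewrite -[X in _ * X = _]ger0_norm -?normrM ?eq ?normrM; [|lra].
    by rewrite [`|1 - X'|]ger0_norm //; lra.
  have := norm_prod_le t' t E0; rewrite [`|t' - t|]distrC.
  have := normr_ge0 (X - X'); have := normr_ge0 (E / 4 * `|t| - E / 4 * `|t'|).
  set p : R := `|X - X'|; set q : R := `|_ * _ - _|; set d : R := `|t - t'| => q0 p0 qd eq'.
  have : (1 - X') * q <= q by apply: ler_piMl => //; lra.
  have : p * (1 / 2) <= p * (1 - (1 / 2 - E / 4 * `|t|)) by apply: ler_wpM2l => //; lra.
  lra.
have Et : t = t'.
  apply: (eq_of_small E0).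
  have : E * `|t - t'| <= `|X - X'|.
    rewrite -[E in X in X <= _]ger0_norm ?(ltW E0) // -normrM.
    have -> : E * (t - t') = - ((H - h) * (X - X')) by lra.
    by rewrite normrN normrM ler_piMl.
  move=> le2; have le3 := le_trans le2 le1.
  by rewrite -(ler_pM2l E0); lra.
split=> //; rewrite Et subrr normr0 mulr0 in le1.
by apply/eqP; rewrite -subr_eq0 -normr_eq0 eq_le le1 normr_ge0.
Qed.

(** A disc ends where the strips start, up to E/4, so a common point has X <= E/2 |t - t'| <= E. For
    distinct discs the heights then differ by at most 3 E, less than their distance; for a single
    disc the comparison of heights forces t = t' and X = 0. *)
Lemma disc_below_arm E h h' H t t' S X : 0 < E -> E <= 1 / 1000 ->
  `|H - h'| <= 1 -> -1 <= t <= 1 -> -1 <= t' <= 1 -> 0 <= S <= 1 -> 0 < X <= 1 ->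
  S * (1 / 2 - E / 4 * `|t|) = (1 - X) * (1 / 2 - E / 4 * `|t'|) + X ->
  h + E * t = h' * (1 - X) + H * X + E * t' ->
  h = h' \/ 4 * E <= `|h - h'| -> False.
Proof.
move=> E0 E1 Hh t1 t1' S1 X1 Eu Ez.
have r1 := radius_bounds E0 E1 t1; have r1' := radius_bounds E0 E1 t1'.
have le1 : X <= E / 2 * `|t - t'|.
  have := norm_prod_le t t' E0; rewrite ler_norml.
  move=> /andP[_ le].
  have : X * (1 / 2) <= X * (1 - (1 / 2 - E / 4 * `|t'|)) by apply: ler_wpM2l; lra.
  have : S * (1 / 2 - E / 4 * `|t|) <= 1 / 2 - E / 4 * `|t| by apply: ler_piMl; lra.
  by lra.
have le2 : `|h - h' + E * (t - t')| <= X.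
  have -> : h - h' + E * (t - t') = (H - h') * X by lra.
  by rewrite normrM [`|X|]ger0_norm ?ler_piMl //; lra.
have d2 : `|t - t'| <= 2 by rewrite ler_norml; lra.
case=> [Eh|far].
  rewrite Eh subrr add0r normrM (ger0_norm (ltW E0)) in le2.
  have le3 := le_trans le2 le1.
  have Et : t = t' by apply: (eq_of_small E0); rewrite -(ler_pM2l E0); lra.
  by rewrite Et subrr normr0 in le1; lra.
have := lerB_dist (h - h') (- (E * (t - t'))).
rewrite opprK normrN normrM (ger0_norm (ltW E0)) => le3.
have : E * `|t - t'| <= E * 2 by rewrite ler_pM2l.
have : E / 2 * `|t - t'| <= E / 2 * 2 by rewrite ler_pM2l; lra.
by lra.
Qed.

(** The vanishing products confine (p, q) to the broken line made of p = 0, 0 <= q <= X and of q =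
    X, p >= 0, along which a p + c q increases strictly. *)
Lemma two_triangles a c p q p' q' X : 0 < a -> 0 < c -> 0 <= p -> 0 <= p' -> 0 <= q <= X ->
  0 <= q' <= X -> p * (X - q) = 0 -> p' * (X - q') = 0 ->
  a * p + c * q = a * p' + c * q' -> p = p' /\ q = q'.
Proof.
move=> a0 c0 p0 p0' q0 q0' z z' Ee.
have [/eqP|/eqP] : p == 0 \/ X - q == 0 by apply/orP; rewrite -mulf_eq0; apply/eqP.
  move=> Ep; have [/eqP|/eqP] : p' == 0 \/ X - q' == 0 by apply/orP; rewrite -mulf_eq0; apply/eqP.
    move=> Ep'; split; first by rewrite Ep Ep'.
    by apply: (mulfI (lt0r_neq0 c0)); rewrite Ep Ep' in Ee; lra.
  move=> Eq'; have cq : c * q <= c * q' by rewrite ler_pM2l //; lra.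
  have Eap : a * p' = 0 by apply/eqP; rewrite eq_le mulr_ge0 ?(ltW a0) // andbT; rewrite Ep in Ee; lra.
  move/eqP: Eap; rewrite mulf_eq0 (gt_eqF a0) => /eqP Ep'.
  split; first by rewrite Ep Ep'.
  by apply: (mulfI (lt0r_neq0 c0)); rewrite Ep Ep' in Ee; lra.
move=> Eq; have [/eqP|/eqP] : p' == 0 \/ X - q' == 0 by apply/orP; rewrite -mulf_eq0; apply/eqP.
  move=> Ep'; have cq : c * q' <= c * q by rewrite ler_pM2l //; lra.
  have Eap : a * p = 0 by apply/eqP; rewrite eq_le mulr_ge0 ?(ltW a0) // andbT; rewrite Ep' in Ee; lra.
  move/eqP: Eap; rewrite mulf_eq0 (gt_eqF a0) => /eqP Ep.
  split; first by rewrite Ep Ep'.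
  by apply: (mulfI (lt0r_neq0 c0)); rewrite Ep Ep' in Ee; lra.
move=> Eq'; have Eqq : q = q' by lra.
by split=> //; apply: (mulfI (lt0r_neq0 a0)); rewrite Eqq in Ee; lra.
Qed.

(** The vertex of weight [r] is farther out than that of weight [p], as bt > rb. Lowering [r] at
    constant projection raises [p] by more than the loss and does not lower [q], so the total weight
    would grow. *)
Lemma fold_triangle rb rc bt p q r p' q' r' :
  0 < rb <= 23 / 40 -> 0 < rc -> 6 / 10 <= bt <= 1 ->
  rb * p + bt * r = rb * p' + bt * r' :> R ->
  rc * q + (1 - bt) * r = rc * q' + (1 - bt) * r' ->
  p' + q' + r' <= p + q + r -> r <= r'.
Proof.
move=> rb0 rc0 bt0 E1 E2 le; rewrite leNgt; apply/negP => lt.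
have d0 : 0 < r - r' by lra.
have dp : r - r' < p' - p.
  rewrite -(ltr_pM2l (_ : 0 < rb)); last by lra.
  have : (r - r') * rb < (r - r') * bt by rewrite ltr_pM2l //; lra.
  by lra.
have : 0 <= q' - q.
  rewrite -(pmulr_rge0 _ rc0).
  have -> : rc * (q' - q) = (1 - bt) * (r - r') by lra.
  by apply: mulr_ge0; lra.
by lra.
Qed.

(** Planes of the two faces of a folded half strip, at fibre parameter t: [Pb], [Pc], [Rb] satisfy
    the first equation without its last term, and [Pb], [Rb], [Rc] the second. The sign of the last
    term tells on which side of the plane the remaining corner lies. *)
Lemma twisted_identity E h wb wc rb rc t r : wb + wc + rb + rc = 1 ->
  let z := wb * (h + (E * 20 - 2 * E * - t)) + wc * (h + E * - t) +
           (rb + rc) * (h + 80 / 3 * E + E * t) in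
  let B := (1 / 2 - 3 / 40 * - t) * wb + (2 / 3 + t / 20) * rb + 1 / 3 * rc in
  let C := r * wc + (1 - (2 / 3 + t / 20)) * rb + 2 / 3 * rc in
  z - 40 * E * B = h - E * t + E * ((40 / 3 + 2 * t) * rc) /\
  z - 40 / 3 * E * (1 + B + C) = h + E * t - E * ((40 / 3 * (1 + r) + 2 * t) * wc).
Proof.
by move=> x1 /=; (have -> : wb = 1 - wc - rb - rc by lra); split; field.
Qed.
End PieceInequalities.

(** * Barycentric coordinates on the pieces of the surface *)

Section FacePoints.
Variables (R : realType) (m : nat) (D : diagram m) (Y : layout R D).
Notation Zm := 'I_m.+2.
Notation Nd := (node D).
Notation Gt := (gate D).
Notation fv := (fvertex m Nd Gt).
Notation Sg := (tripartite_surface m).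
Notation E := (eps Y).
Implicit Types (n : Nd) (g : Gt) (j k : Zm) (e : bool) (t x : R) (v : fv).

(* A disc triangle, or a point off the discs in half a strip; the product which
   vanishes in [fvalid] tells the two triangles of the half strip. *)
Inductive fpoint :=
  | Disc n j e (xo xb xc : R)
  | Arm g e (wb wc rb rc : R).

Definition twisted g e := tw g && ~~ e.

Definition fweight (p : fpoint) v : R :=
  match p, v with
  | Disc n j e xo xb xc, O n' => xo *+ (n' == n)
  | Disc n j e xo xb xc, Pb n' j' => xb *+ ((n' == n) && (j' == j))
  | Disc n j e xo xb xc, Pc n' k' => xc *+ ((n' == n) && (k' == opp_spoke n j e))
  | Arm g e wb wc rb rc, Pb n' j' => wb *+ ((n' == nd g e) && (j' == col g))
  | Arm g e wb wc rb rc, Pc n' k' => wc *+ ((n' == nd g e) && (k' == kap g))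
  | Arm g e wb wc rb rc, Rb g' => rb *+ (g' == g)
  | Arm g e wb wc rb rc, Rc g' => rc *+ (g' == g)
  | _, _ => 0
  end.

Definition fvalid (p : fpoint) : Prop :=
  match p with
  | Disc n j e xo xb xc => [/\ 0 <= xo, 0 <= xb, 0 <= xc & xo + xb + xc = 1]
  | Arm g e wb wc rb rc =>
    [/\ [/\ 0 <= wb, 0 <= wc, 0 <= rb & 0 <= rc], wb + wc + rb + rc = 1, 0 < rb + rc
      & (if e then wc * rb else (if tw g then wc else wb) * rc) = 0]
  end.

Definition fcell (p : fpoint) : seq fv :=
  match p with
  | Disc n j e _ _ _ => [:: O n; Pb n j; Pc n (opp_spoke n j e)]
  | Arm g e _ _ _ _ => [:: Pb (nd g e) (col g); Pc (nd g e) (kap g); Rb g; Rc g]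
  end.

Lemma fcell_uniq p : uniq (fcell p).
Proof.
by case: p => [n j e a b c|g e a b c d]; rewrite /fcell !cons_uniq !inE !fvertex_eqE.
Qed.

Lemma fweight_out p v : v \notin fcell p -> fweight p v = 0.
Proof.
by case: p v => [n j e xo xb xc|g e wb wc rb rc] [n'|n' j'|n' k'|g'|g'] //;
  rewrite /fcell !inE !fvertex_eqE ?orbF /= => /negPf->.
Qed.

(** On a strip t is the parameter at the middle corners; at a twisted end the rim corners are taken
    at - t. *)
Definition ppos (p : fpoint) (t : R) : tpoint R Sg :=
  match p with
  | Disc n j e xo xb xc =>
    let rb := radius_b Y n j t in let rc := radius Y t in
    (pt (lev n) j (opp_spoke n j e) (xo + (1 - rb) * xb + (1 - rc) * xc) (rb * xb) (rc * xc),
     xo * (hN Y n + E * t) + xb * height_b Y n j t + xc * (hN Y n + E * t))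
  | Arm g e wb wc sb sc =>
    let n := nd g e in
    let s := if twisted g e then - t else t in
    let rb := radius_b Y n (col g) s in let rc := radius Y s in
    (pt (lev n) (col g) (kap g) ((1 - rb) * wb + (1 - rc) * wc)
       (rb * wb + beta g t * sb + 1 / 3 * sc) (rc * wc + (1 - beta g t) * sb + 2 / 3 * sc),
     wb * height_b Y n (col g) s + wc * (hN Y n + E * s) + (sb + sc) * (hG Y g + E * t))
  end.

Definition rim_flip (p : fpoint) v : bool :=
  match p, v with
  | Arm g e _ _ _ _, Pb _ _ | Arm g e _ _ _ _, Pc _ _ => twisted g e
  | _, _ => false
  end.

Lemma fpoint_exists (x : fv -> R) : realization (fcomplex D) x ->
  exists p, fvalid p /\ x =1 fweight p.
Proof.
move=> [x0 x1 /generatedP[_ [t /subsetP sub]]].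
have out v : v \notin ftriangle t -> x v = 0.
  by move=> vt; apply/eqP/negPn/negP => nz; move/negP: vt; apply; apply: sub; rewrite inE.
have fin (p : fpoint) : (forall v, v \in fcell p -> x v = fweight p v) ->
    (forall v, v \notin fcell p -> x v = 0) -> x =1 fweight p.
  move=> h1 h2 v; case: (boolP (v \in fcell p)) => [/h1//|vp].
  by rewrite h2 // fweight_out.
case: t sub out => [[[n j] e]|[[g e] y]] sub out.
  pose p := Disc n j e (x (O n)) (x (Pb n j)) (x (Pc n (opp_spoke n j e))).
  have outp v : v \notin fcell p -> x v = 0.
    move=> vp; apply: out; move: vp; rewrite !inE.
    by rewrite !negb_or => /and3P[-> -> ->].
  exists p; split.
    split=> //; rewrite -[RHS]x1 (sum_on_seq (fcell_uniq p) outp) /=.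
    by rewrite !big_cons big_nil addr0 addrA.
  apply: (fin p _ outp) => v; rewrite !inE => /or3P[]/eqP-> /=;
  by rewrite !eqxx.
have outp v : v \notin [:: Pb (nd g e) (col g); Pc (nd g e) (kap g); Rb g; Rc g] -> x v = 0.
  move=> vp; apply: out; apply: contra vp.
  move=> /mem_arm[->|[_ ->]|[_ ->]|->]; rewrite !inE.
  - by case: (e); rewrite eqxx ?orbT.
  - by case: (e); rewrite eqxx ?orbT.
  - by rewrite /att /rim; case: ifP; rewrite eqxx ?orbT.
  - by rewrite /att /rim; case: ifP; rewrite eqxx ?orbT.
pose p := Arm g e (x (Pb (nd g e) (col g))) (x (Pc (nd g e) (kap g))) (x (Rb g)) (x (Rc g)).
have xp : x =1 fweight p.
  apply: (fin p _ outp) => v; rewrite !inE => /or4P[]/eqP-> /=;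
  by rewrite !eqxx.
have sum1 : x (Pb (nd g e) (col g)) + x (Pc (nd g e) (kap g)) + x (Rb g) + x (Rc g) = 1.
  by rewrite -[RHS]x1 (sum_on_seq (fcell_uniq p) outp) /= !big_cons big_nil addr0 !addrA.
have [pos|] := boolP (0 < x (Rb g) + x (Rc g)).
  exists p; split=> //; split=> //.
  have Z : ~~ y -> x (att e g e) = 0.
    move=> /negPf yF; apply: out; rewrite yF !inE !negb_or att_neg andbT.
    by rewrite !(eq_sym (att _ _ _)) !gv_att.
  have Z' : y -> x (gv (~~ e) g) = 0.
    by move=> yT; apply: out; rewrite yT !inE !negb_or eq_sym gv_neg !gv_att.
  case Ey : y; [have Zy := Z' Ey|have Zy := Z (negbT Ey)].
    by case: (e) Zy => /= ->; rewrite ?mulr0.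
  by move: Zy; rewrite /att /rim /=; case: (e) => /=; case: (tw g) => /= ->; rewrite mul0r.
rewrite lt_neqAle addr_ge0 // andbT negbK eq_sym paddr_eq0 // => /andP[/eqP Eb /eqP Ec].
rewrite Eb Ec !addr0 in sum1.
(* A point of an attaching edge is recorded on the disc, so that a point has only one of the two
   forms. *)
exists (Disc (nd g e) (col g) e 0 (x (Pb (nd g e) (col g))) (x (Pc (nd g e) (kap g)))).
split; first by split=> //; rewrite add0r.
move=> v; rewrite xp /= Eb Ec; case: v => [n|n j|n k|g'|g'] //; rewrite ?mul0rn //.
by rewrite (kapE _ e).
Qed.

Lemma pos_O n t j k : pos Y (O n) t = (pt (lev n) j k 1 0 0, hN Y n + E * t).
Proof. by rewrite /= (pt_irrB _ 0 j) (pt_irrC _ _ 0 k). Qed.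
Lemma pos_Pb n j t k : pos Y (Pb n j) t =
  (pt (lev n) j k (1 - radius_b Y n j t) (radius_b Y n j t) 0, height_b Y n j t).
Proof. by rewrite /= (pt_irrC _ _ 0 k). Qed.
Lemma pos_Pc n k t j : pos Y (Pc n k) t =
  (pt (lev n) j k (1 - radius Y t) 0 (radius Y t), hN Y n + E * t).
Proof. by rewrite /= (pt_irrB _ 0 j). Qed.
Lemma pos_Rb g t i : pos Y (Rb g) t =
  (pt i (col g) (kap g) 0 (beta g t) (1 - beta g t), hG Y g + E * t).
Proof. by rewrite /= (pt_irrA 0 i). Qed.
Lemma pos_Rc g t i : pos Y (Rc g) t =
  (pt i (col g) (kap g) 0 (1 / 3) (2 / 3), hG Y g + E * t).
Proof. by rewrite /= (pt_irrA 0 i). Qed.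

Lemma ppos_sum p t :
  \sum_v fweight p v *: pos Y v (if rim_flip p v then - t else t) = ppos p t.
Proof.
rewrite (sum_on_seq (fcell_uniq p)) => [|v /fweight_out->]; last by rewrite scale0r.
case: p => [n j e xo xb xc|g e wb wc rb rc]; rewrite /fcell !big_cons big_nil addr0.
  rewrite (pos_O _ _ j (opp_spoke n j e)) (pos_Pb _ _ _ (opp_spoke n j e)) (pos_Pc _ _ _ j).
  rewrite /fweight !eqxx !mulr1n !pair_scale !pair_add !pt_scale !pt_add /=.
  by apply: pt_pair; ring.
rewrite (pos_Pb _ _ _ (kap g)) (pos_Pc _ _ _ (col g)).
rewrite (pos_Rb _ _ (lev (nd g e))) (pos_Rc _ _ (lev (nd g e))).
rewrite /fweight !eqxx !mulr1n !pair_scale !pair_add !pt_scale !pt_add /=.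
by apply: pt_pair; ring.
Qed.

Definition twisted_edge (u v : fv) : bool :=
  match u, v with
  | Rb g, Pb n _ | Rb g, Pc n _ | Rc g, Pb n _ | Rc g, Pc n _
  | Pb n _, Rb g | Pc n _, Rb g | Pb n _, Rc g | Pc n _, Rc g => tw g && (n == low g)
  | _, _ => false
  end.

(** On a cell the transition signs are the coboundary of [rim_flip]. This yields the cocycle
    condition, and a compatible lift over a cell is determined by one sign. *)
Lemma twisted_edge_cell p u v : u \in fcell p -> v \in fcell p ->
  twisted_edge u v = rim_flip p u (+) rim_flip p v.
Proof.
have L g e : (nd g e == low g) = ~~ e.
  by case: e => /=; rewrite ?eqxx // -[low g]/(nd g false) -[upp g]/(nd g true) (negPf (nd_neq g)).
case: p => [n j e a b c|g e a b c d]; rewrite /fcell !inE.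
  by do 2!case/or3P=> /eqP->.
by do 2!case/or4P=> /eqP->; rewrite /= ?L ?addbb ?addbF.
Qed.

Lemma ftriangle_fcell (t : Nd * Zm * bool + Gt * bool * bool) :
  exists p, {subset ftriangle t <= fcell p}.
Proof.
case: t => [[[n j] e]|[[g e] y]].
  exists (Disc n j e 0 0 0) => v; rewrite !inE -orbA => /or3P[]/eqP->;
  by rewrite eqxx ?orbT.
exists (Arm g e 0 0 0 0) => v /mem_arm[->|[_ ->]|[_ ->]|->]; rewrite !inE.
- by case: (e); rewrite eqxx ?orbT.
- by case: (e); rewrite eqxx ?orbT.
- by rewrite /att /rim; case: ifP; rewrite eqxx ?orbT.
- by rewrite /att /rim; case: ifP; rewrite eqxx ?orbT.
Qed.

Lemma twisted_edge_cocycle u v w : [set u; v; w] \in fcomplex D ->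
  twisted_edge u v (+) twisted_edge v w = twisted_edge u w.
Proof.
move=> /generated_tripleP[t [ut vt wt]]; have [p sub] := ftriangle_fcell t.
rewrite !(@twisted_edge_cell p) ?sub //.
by do 3!case: (rim_flip p _).
Qed.

Lemma compatible_sign p (x : fv -> R) (b : fv -> bool) :
  \sum_v x v = 1 -> x =1 fweight p -> compatible twisted_edge (Defs.support x) b ->
  exists s, forall v, fweight p v != 0 -> b v = s (+) rim_flip p v.
Proof.
move=> x1 xp cb.
have [u ux] : exists u, x u != 0.
  apply: contrapT => none; have : \sum_v x v = 0.
    by apply: big1 => v _; apply/eqP/negPn/negP => nz; apply: none; exists v.
  by rewrite x1 => /eqP; rewrite oner_eq0.
have cell v : fweight p v != 0 -> v \in fcell p.
  by apply: contraR => /fweight_out->.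
exists (b u (+) rim_flip p u) => v vx.
have us : u \in Defs.support x by rewrite inE.
have vs : v \in Defs.support x by rewrite inE xp.
rewrite (cb u v us vs) (@twisted_edge_cell p) ?addbA //; apply: cell => //.
by rewrite -xp.
Qed.

Lemma bundle_ppos p (x : fv -> R) (b : fv -> bool) s t : 0 <= t ->
  x =1 fweight p -> (forall v, fweight p v != 0 -> b v = s (+) rim_flip p v) ->
  interp (linear_extension (fposition Y) x,
          linear_extension (fun v => tposition Y (v, b v)) x) t = ppos p (sg R s * t).
Proof.
move=> t0 xp bs; rewrite /interp /linear_extension /= !scaler_sumr -big_split /= -ppos_sum.
apply: eq_bigr => v _; rewrite xp; have [->|nz] := eqVneq (fweight p v) 0.
  by rewrite !scale0r !scaler0 addr0.
rewrite !scalerA ![_ * fweight p v]mulrC -!scalerA -scalerDr; congr (_ *: _).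
have := pos_interp Y v (b v) t0; rewrite /interp /= => ->.
rewrite (bs v nz); congr (pos Y v _).
by case: (s); case: (rim_flip p v); rewrite /= ?mulN1r ?mul1r ?opprK.
Qed.

Lemma extension_ppos p (x : fv -> R) : x =1 fweight p ->
  linear_extension (fposition Y) x = ppos p 0.
Proof.
move=> xp; rewrite -ppos_sum; apply: eq_bigr => v _; rewrite xp /fposition.
by rewrite oppr0 if_same.
Qed.
End FacePoints.

(** * Embeddedness *)

Section Injectivity.
Variables (R : realType) (m : nat) (D : diagram m) (Y : layout R D).
Notation Zm := 'I_m.+2.
Notation Nd := (node D).
Notation Gt := (gate D).
Notation fv := (fvertex m Nd Gt).
Notation Sg := (tripartite_surface m).
Notation E := (eps Y).
Implicit Types (n : Nd) (g : Gt) (j k : Zm) (e : bool) (t x : R) (v : fv) (p : fpoint R D).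

Lemma raisedP n j : raised n j -> exists g : Gt, [/\ tw g, low g = n & col g = j].
Proof. by rewrite /raised; case: cell_gateP => // g En Ec tg; exists g. Qed.

Lemma raised_gate g : raised (low g) (col g) = tw g.
Proof. by rewrite /raised (cell_gateE g false). Qed.

Lemma raised_unique n n' j : raised n j -> lev n' = lev n -> n' = n.
Proof. by move=> /raisedP[g [tg <- _]]; apply: tw_base Y _ _ tg. Qed.

Lemma untwisted_not_raised n g e : lev n = lev (nd g e) -> twisted g e = false ->
  raised n (col g) = false.
Proof.
move=> El ut; apply/negP => /raisedP[g1 [t1 Eg1 Ec1]]; rewrite -Eg1 in El.
case: e El ut => /= El ut.
  by have := tw_bottom Y g t1; rewrite El eqxx.
by move: ut; rewrite /twisted -(port_inj El Ec1) t1.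
Qed.

Let E0 : 0 < E := eps_gt0 Y.
Let E1 : E <= 1 / 1000 := eps_small Y.

Lemma radius_bd t : -1 <= t <= 1 -> 49 / 100 <= radius Y t <= 1 / 2.
Proof. exact: radius_bounds E0 E1. Qed.

Lemma radius_b_bd n j t : -1 <= t <= 1 -> 17 / 40 <= radius_b Y n j t <= 23 / 40.
Proof.
move=> t1; rewrite /radius_b; case: ifP => _; first by lra.
by have := radius_bd t1; lra.
Qed.

Lemma beta_bd g t : -1 <= t <= 1 -> 6 / 10 <= beta g t <= 3 / 4.
Proof. by move=> t1; rewrite /beta; case: ifP => _; lra. Qed.

Lemma height_dist n g : `|hG Y g - hN Y n| <= 1.
Proof. by rewrite ler_norml; have := hN_range Y n; have := hG_range Y g; have := E0; lra. Qed.

Lemma disc_height n j xo xb xc t : xo + xb + xc = 1 ->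
  xo * (hN Y n + E * t) + xb * height_b Y n j t + xc * (hN Y n + E * t) =
  hN Y n + E * t + (if raised n j then 40 * E * (radius_b Y n j t * xb) else 0).
Proof.
move=> x1; rewrite /height_b /radius_b; case: ifP => _.
  have -> : xo = 1 - xb - xc by lra.
  by field.
have -> : xo = 1 - xb - xc by lra.
by ring.
Qed.

Lemma disc_weight_eq n j e (xo xb xc : R) j' e' : (xb != 0 -> j = j') ->
  (xc != 0 -> opp_spoke n j e = opp_spoke n j' e') ->
  fweight (Disc n j e xo xb xc) =1 fweight (Disc n j' e' xo xb xc).
Proof.
move=> Ej Ek [n'|l l'|l l'|g|g] //=.
  by have [->|/Ej->] := eqVneq xb 0; rewrite ?mul0rn.
by have [->|/Ek->] := eqVneq xc 0; rewrite ?mul0rn.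
Qed.

(** The coordinate at a is positive and gives the level. Heights separate different discs of a
    level, none of which is raised. On one disc, the heights for different t form parallel
    planes. *)
Lemma disc_disc n j e xo xb xc t n' j' e' xo' xb' xc' t' :
  let p := Disc n j e xo xb xc in let p' := Disc n' j' e' xo' xb' xc' in
  fvalid p -> fvalid p' -> -1 <= t <= 1 -> -1 <= t' <= 1 ->
  ppos Y p t = ppos Y p' t' -> fweight p =1 fweight p' /\ t = t'.
Proof.
move=> /= [xo0 xb0 xc0 x1] [xo0' xb0' xc0' x1'] t1 t1'.
rewrite !disc_height //.
have r1 := radius_bd t1; have r1' := radius_bd t1'.
have q1 := radius_b_bd n j t1; have q1' := radius_b_bd n' j' t1'.
move=> [/pt_inj[[EA EB EC] [EI EJ EK]] Ez].
have El : lev n = lev n'.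
  apply: EI; apply: lt0r_neq0.
  have : 0 <= (1 - radius_b Y n j t - 1 / 4) * xb by apply: mulr_ge0; lra.
  have : 0 <= (1 - radius Y t - 1 / 4) * xc by apply: mulr_ge0; lra.
  by lra.
have En : n = n'.
  apply: contrapT => /eqP nn.
  have nr : raised n j = false.
    by apply: contraNF nn => rz; rewrite (raised_unique rz (esym El)).
  have nr' : raised n' j' = false.
    by apply: contraNF nn => rz; rewrite (raised_unique rz El).
  rewrite nr nr' !addr0 in Ez.
  have sep := hN_sep Y El nn.
  have : hN Y n - hN Y n' = E * (t' - t) by lra.
  move=> Ed; rewrite Ed normrM (gtr0_norm E0) in sep.
  have : `|t' - t| <= 2 by rewrite ler_norml; lra.
  move=> d2; have le2 : E * `|t' - t| <= E * 2 by rewrite ler_pM2l.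
  by have := E0; lra.
subst n'.
have Et : t = t'.
  apply: (mulfI (lt0r_neq0 E0)).
  have [B0|/EJ Ej] := eqVneq (radius_b Y n j t * xb) 0.
    by move: Ez; rewrite -EB B0 !mulr0; case: (raised n j); case: (raised n j'); lra.
  by move: Ez; rewrite -EB Ej; lra.
subst t'; split=> //.
have nzc : radius Y t != 0 by apply: lt0r_neq0; lra.
have nzb : radius_b Y n j t != 0 by apply: lt0r_neq0; lra.
have Ec : xc = xc' by apply: (mulfI nzc).
have Exb : xb = xb'.
  have [Bz|/EJ Ej] := eqVneq (radius_b Y n j t * xb) 0; last first.
    by apply: (mulfI nzb); rewrite [in RHS]Ej.
  have nzb' : radius_b Y n j' t != 0 by apply: lt0r_neq0; lra.
  have /eqP : radius_b Y n j' t * xb' = 0 by rewrite -EB.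
  move/eqP: Bz; rewrite !mulf_eq0 (negPf nzb) (negPf nzb') /=.
  by move=> /eqP-> /eqP->.
have Exo : xo = xo' by lra.
rewrite -Exo -Exb -Ec; apply: disc_weight_eq => nz.
  by apply: EJ; rewrite mulf_neq0.
by apply: EK; rewrite mulf_neq0.
Qed.

Lemma arm_inside g e wb wc rb rc t : fvalid (Arm g e wb wc rb rc) -> -1 <= t <= 1 ->
  let s := if twisted g e then - t else t in
  [/\ 0 < radius_b Y (nd g e) (col g) s * wb + beta g t * rb + 1 / 3 * rc,
      0 < radius Y s * wc + (1 - beta g t) * rb + 2 / 3 * rc
    & 0 < wb + wc -> 0 < (1 - radius_b Y (nd g e) (col g) s) * wb + (1 - radius Y s) * wc].
Proof.
move=> [[wb0 wc0 rb0 rc0] x1 r0 _] t1 s.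
have s1 : -1 <= s <= 1 by rewrite /s; case: ifP => _; lra.
have r1 := radius_bd s1; have q1 := radius_b_bd (nd g e) (col g) s1.
have b1 := beta_bd g t1.
have h1 : 0 <= radius_b Y (nd g e) (col g) s * wb by apply: mulr_ge0; lra.
have h2 : 0 <= radius Y s * wc by apply: mulr_ge0; lra.
have h3 : 0 <= (beta g t - 1 / 3) * rb by apply: mulr_ge0; lra.
have h4 : 0 <= (1 - beta g t - 1 / 4) * rb by apply: mulr_ge0; lra.
split; [by lra|by lra|move=> w0].
have h5 : 0 <= (1 - radius_b Y (nd g e) (col g) s - 1 / 3) * wb by apply: mulr_ge0; lra.
have h6 : 0 <= (1 - radius Y s - 1 / 3) * wc by apply: mulr_ge0; lra.
by lra.
Qed.

Lemma flat_arm g e n t : lev n = lev (nd g e) -> twisted g e = false ->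
  radius_b Y n (col g) t = radius Y t /\ height_b Y n (col g) t = hN Y n + E * t.
Proof.
by move=> El ut; rewrite /radius_b /height_b (untwisted_not_raised El ut).
Qed.

Lemma disc_arm n j e xo xb xc t g e' wb wc rb rc t' :
  let p := Disc n j e xo xb xc in let p' := Arm g e' wb wc rb rc in
  fvalid p -> fvalid p' -> -1 <= t <= 1 -> -1 <= t' <= 1 ->
  ppos Y p t = ppos Y p' t' -> False.
Proof.
move=> p p' vp vp' t1 t1'; rewrite /p /p'.
have [B0 C0 _] := arm_inside vp' t1'.
move: vp vp' => /= [xo0 xb0 xc0 x1] [[wb0 wc0 rb0 rc0] x1' r0 cc].
rewrite disc_height // => -[/pt_inj[[EA EB EC] [EI EJ EK]] Ez].
have r1 := radius_bd t1; have q1 := radius_b_bd n j t1.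
have El : lev n = lev (nd g e').
  apply: EI; apply: lt0r_neq0.
  have : 0 <= (1 - radius_b Y n j t - 1 / 4) * xb by apply: mulr_ge0; lra.
  have : 0 <= (1 - radius Y t - 1 / 4) * xc by apply: mulr_ge0; lra.
  by lra.
have Ej : j = col g by apply: EJ; rewrite EB lt0r_neq0.
have Ek : opp_spoke n j e = kap g by apply: EK; rewrite EC lt0r_neq0.
subst j; clear EI EJ EK.
case tge : (twisted g e') EA EB EC Ez B0 C0 => EA EB EC Ez B0 C0.
  have [tg e0] : tw g /\ e' = false by case: (e') tge; rewrite /twisted ?andbF ?andbT.
  subst e'; rewrite /= tg in EA EB EC Ez B0 C0 cc El.
  have En : n = low g := tw_base Y tg El; subst n.
  have rz := raised_gate g; rewrite tg in rz.
  rewrite /radius_b /height_b rz /beta tg (tw_height Y tg) in EA EB EC Ez B0 C0 q1.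
  have rho := radius_bd (_ : -1 <= - t' <= 1).
  have {}rho := rho ltac:(lra).
  have [I1 I2] := twisted_identity E (hN Y (low g)) t' (radius Y (- t')) x1'.
  move: I1 I2; rewrite -EB -EC -Ez => I1 I2.
  (* If [rc] is 0, both points lie in parallel planes, hence in the same one, and [fold_triangle]
     separates them. Otherwise [I1] gives t + t' > 0, the fold being above the plane of the disc,
     while [I2] gives t + t' <= 0. *)
  have [rc00|rcn] := eqVneq rc 0.
    have Et : t = - t' by apply: (mulfI (lt0r_neq0 E0)); rewrite rc00 in I1; clear -I1; lra.
    subst t.
    have := @fold_triangle R (1 / 2 - 3 / 40 * - t') (radius Y (- t')) (2 / 3 + t' / 20)
      wb wc rb xb xc 0.
    rewrite rc00 in EB EC *; clear I1 I2 EA Ez q1 cc wb0 wc0 rb0 rc0 r1 xb0 xc0 B0 C0 E0 E1.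
    move=> /(_ ltac:(lra) ltac:(lra) ltac:(lra)) F.
    by have := F ltac:(lra) ltac:(lra) ltac:(lra); lra.
  have wc00 : wc = 0 by move/eqP: cc; rewrite mulf_eq0 (negPf rcn) orbF => /eqP.
  have rcp : 0 < rc by rewrite lt_neqAle eq_sym rcn.
  have hrc : 0 < E * ((40 / 3 + 2 * t') * rc).
    by rewrite pmulr_rgt0 //; apply: mulr_gt0 => //; lra.
  have hxo : 0 <= E * ((40 / 3 - 2 * t) * xo).
    by rewrite pmulr_rge0 //; apply: mulr_ge0 => //; lra.
  have hxc : 0 <= E * ((40 / 3 * (1 + radius Y t) - 2 * t) * xc).
    by rewrite pmulr_rge0 //; apply: mulr_ge0 => //; lra.
  rewrite wc00 in I2; have Exb : xb = 1 - xo - xc by lra.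
  by rewrite Exb in I1 I2; clear -I1 I2 hrc hxo hxc; lra.
have [Fr Fh] := flat_arm t El tge.
have [Fr' Fh'] := @flat_arm g e' (nd g e') t' erefl tge.
rewrite Fr Fr' Fh' (untwisted_not_raised El tge) addr0 in EA EB EC Ez.
apply: (@disc_below_arm R E (hN Y n) (hN Y (nd g e')) (hG Y g) t t' (xb + xc) (rb + rc)) => //.
- exact: height_dist.
- by lra.
- by lra.
- have rx : radius Y t' * (wb + wc + rb + rc) = radius Y t' by rewrite x1' mulr1.
  by rewrite -[1 / 2 - _]/(radius Y t) -[X in _ = _ * X + _]/(radius Y t'); lra.
- have Ewb : wb = 1 - wc - (rb + rc) by lra.
  by rewrite Ez Ewb; ring.
have [->|nn] := eqVneq n (nd g e'); first by left.
by right; apply: hN_sep.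
Qed.

Lemma gate_gate g e wb wc rb rc t e' wb' wc' rb' rc' t' :
  fvalid (Arm g e wb wc rb rc) -> fvalid (Arm g e' wb' wc' rb' rc') ->
  -1 <= t <= 1 -> -1 <= t' <= 1 -> wb + wc = 0 -> wb' + wc' = 0 ->
  ppos Y (Arm g e wb wc rb rc) t = ppos Y (Arm g e' wb' wc' rb' rc') t' ->
  [/\ t = t', wb = wb', wc = wc', rb = rb' & rc = rc'].
Proof.
move=> [[wb0 wc0 rb0 rc0] x1 r0 _] [[wb0' wc0' rb0' rc0'] x1' r0' _] t1 t1' Ew Ew'.
have Eb : wb = 0 by lra.
have Ec : wc = 0 by lra.
have Eb' : wb' = 0 by lra.
have Ec' : wc' = 0 by lra.
subst wb wc wb' wc'; rewrite /= !mulr0 !add0r => -[/pt_inj[[_ EB _] _]].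
have -> : rb + rc = 1 by lra.
have -> : rb' + rc' = 1 by lra.
rewrite !mul0r !mul1r !add0r => Ez.
have Et : t = t' by apply: (mulfI (lt0r_neq0 E0)); lra.
subst t'; have b1 := beta_bd g t1.
have nz : beta g t - 1 / 3 != 0 by apply: lt0r_neq0; lra.
have Erb : rb = rb' by apply: (mulfI nz); lra.
by split=> //; lra.
Qed.

Lemma arm_arm_flat g e wb wc rb rc t wb' wc' rb' rc' t' :
  twisted g e = false ->
  fvalid (Arm g e wb wc rb rc) -> fvalid (Arm g e wb' wc' rb' rc') ->
  -1 <= t <= 1 -> -1 <= t' <= 1 ->
  ppos Y (Arm g e wb wc rb rc) t = ppos Y (Arm g e wb' wc' rb' rc') t' ->
  [/\ t = t', wb = wb', wc = wc', rb = rb' & rc = rc'].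
Proof.
move=> tge [[wb0 wc0 rb0 rc0] x1 r0 cc] [[wb0' wc0' rb0' rc0'] x1' r0' cc'] t1 t1'.
have [Fr Fh] := @flat_arm g e (nd g e) t erefl tge.
have [Fr' Fh'] := @flat_arm g e (nd g e) t' erefl tge.
rewrite /= tge Fr Fr' Fh Fh' => -[/pt_inj[[EA EB EC] _] Ez].
have rx : radius Y t * (wb + wc + rb + rc) = radius Y t by rewrite x1 mulr1.
have rx' : radius Y t' * (wb' + wc' + rb' + rc') = radius Y t' by rewrite x1' mulr1.
have [] := @arm_monotone R E (hN Y (nd g e)) (hG Y g) t t' (rb + rc) (rb' + rc') => //.
- exact: height_dist.
- by lra.
- by lra.
- by rewrite -[X in _ * X + _ = _]/(radius Y t) -[X in _ = _ * X + _]/(radius Y t'); lra.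
- have Ew : wb = 1 - wc - (rb + rc) by lra.
  have Ew' : wb' = 1 - wc' - (rb' + rc') by lra.
  by move: Ez; rewrite Ew Ew'; lra.
move=> Et EX; subst t'; have r1 := radius_bd t1; have b1 := beta_bd g t1.
have cz (y y' z z' : R) : (if e then y' * z else (if tw g then y' else y) * z') = 0 ->
    (if e then y' else y) * (z + z' - (if e then z' else z)) = 0.
  move: tge; rewrite /twisted; case: (e) => /=; first by rewrite addrK.
  by rewrite andbT => -> <-; rewrite addrAC subrr add0r.
have [] := @two_triangles R (radius Y t) (beta g t - 1 / 3)
  (if e then wc else wb) (if e then rc else rb) (if e then wc' else wb')
  (if e then rc' else rb') (rb + rc).
- by lra.
- by lra.
- by case: (e).
- by case: (e).
- by case: (e); lra.
- by case: (e); lra.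
- exact: cz.
- by rewrite EX; apply: cz.
- have bX : beta g t * (rb + rc) = beta g t * (rb' + rc') by rewrite EX.
  by case: (e); lra.
move=> pe qe; have [Ep Eq] : wb = wb' /\ rb = rb'.
  by split; case: (e) pe qe; lra.
by split=> //; lra.
Qed.

Lemma arm_arm_twisted g wb wc rb rc t wb' wc' rb' rc' t' : tw g ->
  fvalid (Arm g false wb wc rb rc) -> fvalid (Arm g false wb' wc' rb' rc') ->
  -1 <= t <= 1 -> -1 <= t' <= 1 ->
  ppos Y (Arm g false wb wc rb rc) t = ppos Y (Arm g false wb' wc' rb' rc') t' ->
  [/\ t = t', wb = wb', wc = wc', rb = rb' & rc = rc'].
Proof.
move=> tg [[wb0 wc0 rb0 rc0] x1 r0 cc] [[wb0' wc0' rb0' rc0'] x1' r0' cc'] t1 t1'.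
have rz := raised_gate g; rewrite tg in rz.
rewrite /= /twisted /= tg /radius_b /height_b rz /beta tg (tw_height Y tg).
move=> -[/pt_inj[[EA EB EC] _] Ez]; rewrite /= tg in cc cc'.
have rho := radius_bd (_ : -1 <= - t <= 1); have {}rho := rho ltac:(lra).
have rho' := radius_bd (_ : -1 <= - t' <= 1); have {}rho' := rho' ltac:(lra).
have [I1 I2] := twisted_identity E (hN Y (low g)) t (radius Y (- t)) x1.
have [I1' I2'] := twisted_identity E (hN Y (low g)) t' (radius Y (- t')) x1'.
move: I1 I2 I1' I2'; rewrite -EB -EC -Ez => -> -> {Ez} I1 I2.
have hc (s w : R) : -1 <= s <= 1 -> 0 <= w -> 0 <= E * ((40 / 3 * (1 + radius Y (- s)) + 2 * s) * w).
  move=> s1 w0; have rs := radius_bd (_ : -1 <= - s <= 1); have {}rs := rs ltac:(lra).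
  by rewrite pmulr_rge0 //; apply: mulr_ge0 => //; lra.
have pos_rc (s r : R) : -1 <= s <= 1 -> 0 <= r -> E * ((40 / 3 + 2 * s) * r) <= 0 -> r = 0.
  move=> s1 r0'' le; apply/eqP; rewrite eq_le r0'' andbT.
  by move: le; rewrite pmulr_rle0 // pmulr_rle0 //; lra.
have nzE := lt0r_neq0 E0.
(* Points on different faces are impossible: the two planes would give t' - t opposite signs. On a
   common face the planes are parallel, so that t = t'. *)
have [rc00|rcn] := eqVneq rc 0.
  have rc00' : rc' = 0.
    have [//|rcn'] := eqVneq rc' 0.
    have wc00' : wc' = 0 by move/eqP: cc'; rewrite mulf_eq0 (negPf rcn') orbF => /eqP.
    apply: (pos_rc t') => //.
    by have := hc t wc t1 wc0; rewrite rc00 wc00' in I1 I2; clear -I1 I2; lra.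
  have Et : t = t'.
    apply: (mulfI nzE).
    by rewrite rc00 rc00' in I1; clear -I1; lra.
  subst t' rc rc'.
  clear I1 I2 hc pos_rc cc cc' EA r0 r0'.
  have F1 := @fold_triangle R (1 / 2 - 3 / 40 * - t) (radius Y (- t)) (2 / 3 + t / 20)
      wb wc rb wb' wc' rb' ltac:(lra) ltac:(lra) ltac:(lra)
      ltac:(lra) ltac:(lra) ltac:(lra).
  have F2 := @fold_triangle R (1 / 2 - 3 / 40 * - t) (radius Y (- t)) (2 / 3 + t / 20)
      wb' wc' rb' wb wc rb ltac:(lra) ltac:(lra) ltac:(lra)
      ltac:(lra) ltac:(lra) ltac:(lra).
  have Erb : rb = rb' by lra.
  have nzc : radius Y (- t) != 0 by apply: lt0r_neq0; lra.
  have Ewc : wc = wc' by apply: (mulfI nzc); rewrite Erb in EC; lra.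
  by split=> //; lra.
have wc00 : wc = 0 by move/eqP: cc; rewrite mulf_eq0 (negPf rcn) orbF => /eqP.
have rcn' : rc' != 0.
  apply: contra_neq rcn => rc00'.
  apply: (pos_rc t) => //.
  by have := hc t' wc' t1' wc0'; rewrite rc00' wc00 in I1 I2; clear -I1 I2; lra.
have wc00' : wc' = 0 by move/eqP: cc'; rewrite mulf_eq0 (negPf rcn') orbF => /eqP.
have Et : t = t'.
  apply: (mulfI nzE).
  by rewrite wc00 wc00' in I2; clear -I2; lra.
subst t' wc wc'.
have nzb : 1 - (1 / 2 - 3 / 40 * - t) != 0 by apply: lt0r_neq0; lra.
have Ewb : wb = wb' by apply: (mulfI nzb); clear -EA; lra.
have nzB : 2 / 3 + t / 20 - 1 / 3 != 0 by apply: lt0r_neq0; lra.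
have Erb : rb = rb' by apply: (mulfI nzB); rewrite Ewb in EB; clear -EB x1 x1' Ewb; lra.
by split=> //; lra.
Qed.


(** The coordinates at b and c are positive on a strip and determine it. The coordinate at a
    vanishes only on the middle segment, and elsewhere determines the half strip. *)
Lemma arm_arm g e wb wc rb rc t g' e' wb' wc' rb' rc' t' :
  let p := Arm g e wb wc rb rc in let p' := Arm g' e' wb' wc' rb' rc' in
  fvalid p -> fvalid p' -> -1 <= t <= 1 -> -1 <= t' <= 1 ->
  ppos Y p t = ppos Y p' t' ->
  [/\ fweight p =1 fweight p', t = t' &
    forall v, fweight p v != 0 -> rim_flip p v = rim_flip p' v].
Proof.
move=> p p' vp vp' t1 t1' Epp.
have [B0 C0 A0] := arm_inside vp t1; have [B0' C0' A0'] := arm_inside vp' t1'.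
have [] := pt_inj (congr1 (fun P : tpoint R Sg => P.1) Epp).
rewrite -/(twisted g e) -/(twisted g' e') => -[EA EB EC] [EI EJ EK].
have Eg : g = g' by apply: kap_inj; [apply: EJ|apply: EK]; apply: lt0r_neq0.
subst g'; case: (vp) => -[wb0 wc0 _ _] _ _ _; case: (vp') => -[wb0' wc0' _ _] _ _ _.
have [w0|wn] := eqVneq (wb + wc) 0.
  have w0' : wb' + wc' = 0.
    apply/eqP/negPn/negP => wn'; have wp' : 0 < wb' + wc' by rewrite lt_neqAle eq_sym wn' addr_ge0.
    have := A0' wp'; rewrite -EA; move/eqP: w0; rewrite paddr_eq0 // => /andP[/eqP-> /eqP->].
    by rewrite !mulr0 addr0 ltxx.
  have [Et Ewb Ewc Erb Erc] := gate_gate vp vp' t1 t1' w0 w0' Epp.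
  move: w0 => /eqP; rewrite paddr_eq0 // => /andP[/eqP wbz /eqP wcz].
  rewrite /p /p' -Ewb -Ewc -Erb -Erc wbz wcz; split=> //.
    by case=> //= *; rewrite !mul0rn.
  by case=> [n|n j|n k|g'|g'] //=; rewrite ?mul0rn ?eqxx.
have wp : 0 < wb + wc by rewrite lt_neqAle eq_sym wn addr_ge0.
have El : lev (nd g e) = lev (nd g e') by apply: EI; apply: lt0r_neq0; apply: A0.
have Ee : e = e'.
  have : kap g = opp_spoke (nd g e) (col g) e' by rewrite (kapE _ e') /opp_spoke El.
  by rewrite (kapE _ e) => /opp_spoke_inj.
subst e'; have [Et Ewb Ewc Erb Erc] :
    [/\ t = t', wb = wb', wc = wc', rb = rb' & rc = rc'].
  case tge : (twisted g e); last exact: arm_arm_flat tge vp vp' t1 t1' Epp.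
  have [tg e0] : tw g /\ e = false by case: (e) tge; rewrite /twisted ?andbF ?andbT.
  by subst e; apply: arm_arm_twisted tg vp vp' t1 t1' Epp.
by rewrite /p /p' -Ewb -Ewc -Erb -Erc.
Qed.

Lemma ppos_inj p p' t t' : fvalid p -> fvalid p' -> -1 <= t <= 1 -> -1 <= t' <= 1 ->
  ppos Y p t = ppos Y p' t' ->
  [/\ fweight p =1 fweight p', t = t' &
    forall v, fweight p v != 0 -> rim_flip p v = rim_flip p' v].
Proof.
case: p => [n j e xo xb xc|g e wb wc rb rc] vp; case: p' => [n' j' e' xo' xb' xc'|g' e' wb' wc' rb' rc'] vp' t1 t1' Epp.
- by have [] := disc_disc vp vp' t1 t1' Epp.
- by have := disc_arm vp vp' t1 t1' Epp.
- by have := disc_arm vp' vp t1' t1 (esym Epp).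
- exact: arm_arm vp vp' t1 t1' Epp.
Qed.
End Injectivity.

(** * The spanning surface, its tubular neighbourhood and its boundary knot *)

Section DiagramSurface.
Variables (R : realType) (m : nat) (D : diagram m) (Y : layout R D).
Notation Zm := 'I_m.+2.
Notation Nd := (node D).
Notation Gt := (gate D).
Notation fv := (fvertex m Nd Gt).
Notation Sg := (tripartite_surface m).
Notation E := (eps Y).
Implicit Types (n : Nd) (g : Gt) (j k : Zm) (e : bool) (t : R) (u v : fv) (p : fpoint R D).

Lemma pos_thickened v t : -1 <= t <= 1 -> in_thickened (pos Y v t).
Proof.
move=> t1; have E0 := eps_gt0 Y; have E1 := eps_small Y.
have Et : - E <= E * t <= E.
  have h1 : 0 <= E * (1 - t) by apply: mulr_ge0; lra.
  have h2 : 0 <= E * (1 + t) by apply: mulr_ge0; lra.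
  by lra.
have r1 := radius_bd Y t1.
case: v => [n|n j|n k|g|g].
- rewrite (pos_O _ _ _ 0 (opp_spoke n 0 false)); split; last by have := hN_range Y n; rewrite /=; lra.
  by apply: (in_surface_pt (e := false)) => //; lra.
- rewrite (pos_Pb _ _ _ _ (opp_spoke n j false)); have q1 := radius_b_bd Y n j t1.
  split; first by apply: (in_surface_pt (e := false)) => //; lra.
  by have := hN_range Y n; rewrite /= /height_b; case: ifP => _; lra.
- rewrite (pos_Pc _ _ _ _ (opp_spoke n k false)).
  split; last by have := hN_range Y n; rewrite /=; lra.
  apply: (in_surface_pt (e := false)); first by rewrite -/(opp_spoke _ _ _) (opp_spokeK n false).
  1-4: lra.
- rewrite (pos_Rb _ _ _ (lev (low g))); have b1 := beta_bd g t1.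
  split; last by have := hG_range Y g; rewrite /=; lra.
  apply: (in_surface_pt (e := false)); first by rewrite (kapE _ false).
  1-4: lra.
- rewrite (pos_Rc _ _ _ (lev (low g))).
  split; last by have := hG_range Y g; rewrite /=; lra.
  apply: (in_surface_pt (e := false)); first by rewrite (kapE _ false).
  1-4: lra.
Qed.

Definition cell_triangle p : Zm * Zm * bool :=
  match p with
  | Disc n j e _ _ _ => (lev n, j, e)
  | Arm g e _ _ _ _ => (lev (nd g e), col g, e)
  end.

Lemma pos_in_cell p v t : v \in fcell p ->
  in_simplex (S := Sg) (striangle (cell_triangle p)) (pos Y v t).1.
Proof.
case: p => [n j e a b c|g e a b c d]; rewrite /fcell !inE.
  case/or3P=> /eqP->.
  - by rewrite (pos_O _ _ _ j (opp_spoke n j e)); apply: in_simplex_pt.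
  - by rewrite (pos_Pb _ _ _ _ (opp_spoke n j e)); apply: in_simplex_pt.
  - by rewrite (pos_Pc _ _ _ _ j); apply: in_simplex_pt.
case/or4P=> /eqP->.
- by rewrite (pos_Pb _ _ _ _ (kap g)); apply: in_simplex_pt; rewrite (kapE _ e).
- by rewrite (pos_Pc _ _ _ _ (col g)); apply: in_simplex_pt; rewrite (kapE _ e).
- by rewrite (pos_Rb _ _ _ (lev (nd g e))); apply: in_simplex_pt; rewrite (kapE _ e).
- by rewrite (pos_Rc _ _ _ (lev (nd g e))); apply: in_simplex_pt; rewrite (kapE _ e).
Qed.

Lemma face_in_prism (s : {set fv}) : s \in fcomplex D ->
  exists2 r, r \in scplx Sg & forall v t, v \in s -> in_simplex r (pos Y v t).1.
Proof.
move=> /generatedP[_ [t /subsetP st]]; have [p sub] := ftriangle_fcell R t.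
exists (striangle (cell_triangle p)); first exact: striangle_complex.
by move=> v t' vs; apply: pos_in_cell; apply: sub; apply: st.
Qed.

Lemma fposition_inj (x y : fv -> R) : realization (fcomplex D) x -> realization (fcomplex D) y ->
  linear_extension (fposition Y) x = linear_extension (fposition Y) y -> x =1 y.
Proof.
move=> /fpoint_exists[p [vp xp]] /fpoint_exists[q [vq yq]].
rewrite (extension_ppos Y xp) (extension_ppos Y yq) => Epq v.
have [|| E _ _] := ppos_inj vp vq _ _ Epq; [by lra|by lra|].
by rewrite xp E yq.
Qed.

Lemma fposition_thickened v : in_thickened (fposition Y v).
Proof. by apply: pos_thickened; lra. Qed.

Lemma fposition_prism s : s \in fcomplex D -> exists2 r, r \in scplx Sg &
  forall v, v \in s -> in_simplex r (fposition Y v).1.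
Proof. by move=> /face_in_prism[r rS H]; exists r => // v; apply: H. Qed.

Definition diagram_surface : embedded_surface R Sg :=
  EmbeddedSurface (fcomplex_compact D) fposition_thickened fposition_prism fposition_inj.

Lemma tposition_thickened q : in_thickened (tposition Y q).
Proof. by apply: pos_thickened; rewrite /sg; case: q.2; lra. Qed.

Lemma tposition_prism (s : {set fv}) (b : fv -> bool) : s \in fcomplex D ->
  compatible (@twisted_edge m D) s b -> exists2 r, r \in scplx Sg &
  forall v, v \in s -> in_simplex r (fposition Y v).1 /\ in_simplex r (tposition Y (v, b v)).1.
Proof.
by move=> /face_in_prism[r rS H] _; exists r => // v vs; split; apply: H.
Qed.

Lemma tposition_inj (x x' : fv -> R) (b b' : fv -> bool) t t' :
  realization (fcomplex D) x -> realization (fcomplex D) x' ->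
  compatible (@twisted_edge m D) (Defs.support x) b ->
  compatible (@twisted_edge m D) (Defs.support x') b' ->
  unit_interval t -> unit_interval t' ->
  @bundle_point R Sg diagram_surface (tposition Y) b x t =
  @bundle_point R Sg diagram_surface (tposition Y) b' x' t' ->
  [/\ x =1 x', t = t' & t = 0 \/ {in Defs.support x, b =1 b'}].
Proof.
move=> Rx Rx' cb cb' /andP[t0 t1] /andP[t0' t1'].
have [p [vp xp]] := fpoint_exists Rx; have [p' [vp' xp']] := fpoint_exists Rx'.
have [_ sx _] := Rx; have [_ sx' _] := Rx'.
have [s bs] := compatible_sign sx xp cb; have [s' bs'] := compatible_sign sx' xp' cb'.
rewrite /bundle_point (bundle_ppos Y t0 xp bs) (bundle_ppos Y t0' xp' bs') => Epp.
have [|| Ew Et Ef] := ppos_inj vp vp' _ _ Epp.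
- by rewrite /sg; case: (s); lra.
- by rewrite /sg; case: (s'); lra.
have {}Et : t = t' /\ (t = 0 \/ s = s').
  by move: Et; rewrite /sg; case: (s); case: (s') => Et; split; try (by right); try (left); lra.
split; [by move=> v; rewrite xp Ew xp'|by case: Et|].
case: Et => _ [t00|Es]; [by left|right=> v; rewrite inE xp => nz].
by rewrite (bs v nz) (bs' v _) -?Ew // Es (Ef v nz).
Qed.

Definition diagram_tube : tubular_neighborhood diagram_surface :=
  @TubularNeighborhood R Sg diagram_surface (@twisted_edge m D) (tposition Y)
    (@twisted_edge_cocycle R m D) tposition_thickened tposition_prism tposition_inj.

Definition edge_weight (u v : fv) t (w : fv) : R := (1 - t) *+ (w == u) + t *+ (w == v).

Lemma edge_weight_extension u v t :
  linear_extension (fposition Y) (edge_weight u v t) = interp (fposition Y u, fposition Y v) t.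
Proof.
rewrite /linear_extension /interp /=.
under eq_bigr do rewrite scalerDl.
rewrite big_split /=; congr (_ + _).
  rewrite (bigD1 u) //= eqxx big1 ?addr0 // => w /negPf->.
  by rewrite mulr0n scale0r.
rewrite (bigD1 v) //= eqxx big1 ?addr0 // => w /negPf->.
by rewrite mulr0n scale0r.
Qed.

Lemma edge_weight_realization u v t : 0 <= t <= 1 -> [set u; v] \in fcomplex D ->
  realization (fcomplex D) (edge_weight u v t).
Proof.
move=> /andP[t0 t1] uv; split.
- by move=> w; rewrite addr_ge0 // mulrn_wge0 // subr_ge0.
- rewrite big_split /= (bigD1 u) //= eqxx big1 ?addr0 => [|w /negPf-> //].
  by rewrite (bigD1 v) //= eqxx big1 ?addr0 ?subrK // => w /negPf->.
have [_ _ sub] := generated_simplicial (@ftriangle_cover m D).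
apply: (sub _ _ uv).
  apply/subsetP => w; rewrite !inE /edge_weight; apply: contraR.
  by rewrite negb_or => /andP[/negPf-> /negPf->]; rewrite !mulr0n addr0.
apply/set0Pn; have [tn|/eqP t1'] := eqVneq t 1.
  by exists v; rewrite inE /edge_weight tn subrr mul0rn add0r eqxx oner_eq0.
exists u; rewrite inE /edge_weight eqxx mulr1n.
apply: lt0r_neq0; have : 0 <= t *+ (u == v) by rewrite mulrn_wge0.
have : t < 1 by rewrite lt_neqAle t1 andbT; apply/eqP.
by lra.
Qed.

Lemma edge_weight_inj u v u' v' t t' : 0 <= t < 1 -> 0 <= t' < 1 -> u != v -> u' != v' ->
  edge_weight u v t =1 edge_weight u' v' t' -> (u = u' /\ t = t') \/ (v = u' /\ v' = u).
Proof.
move=> t1 t1' uv uv' Ew.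
have [Eu|nu] := eqVneq u u'.
  left; split=> //; have := Ew u; rewrite /edge_weight -Eu eqxx (negPf uv).
  by rewrite -Eu in uv'; rewrite (negPf uv') !mulr0n !mulr1n; lra.
right; have := Ew u; have := Ew u'; rewrite /edge_weight !eqxx (negPf uv) (negPf uv') (negPf nu).
rewrite (eq_sym u' u) (negPf nu) !mulr0n !mulr1n !addr0 !add0r.
case: (eqVneq u' v) => [<-|_]; last by rewrite mulr0n => H; exfalso; lra.
by case: (eqVneq u v') => [<-|_] // _; rewrite mulr0n => H; exfalso; lra.
Qed.

(** The knot is the Hamiltonian cycle of the boundary graph. Points of its edges have barycentric
    coordinates in the complex, so that it is embedded because the surface is. *)
Lemma spanning_knot v0 : on_boundary v0 ->
  (forall u v, on_boundary u -> on_boundary v -> connect (boundary_edge (fcomplex D)) u v) ->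
  exists (l : nat) (K : 'I_l -> tpoint R Sg), knot K /\ spanning_surface diagram_surface K.
Proof.
move=> b0 conn; have [s [Us Cs sz nx]] := boundary_cycle b0 conn.
exists (size s), (fun i => fposition Y (nth v0 s i)).
have nthS (i : 'I_(size s)) : nth v0 s (ordS i) = next s (nth v0 s i).
  rewrite next_nth mem_nth // index_uniq //=.
  case: s i {Us Cs sz nx} => [[]//|a s] [i /= il].
  have [E|lt] := eqVneq i (size s).
    by rewrite E modnn /= nth_default.
  rewrite modn_small ?ltnS //=; last by rewrite ltn_neqAle lt -ltnS.
  by apply: set_nth_default; rewrite ltn_neqAle lt -ltnS.
have bdS (i : 'I_(size s)) : boundary_edge (fcomplex D) (nth v0 s i) (nth v0 s (ordS i)).
  by rewrite nthS; apply: next_cycle => //; apply: mem_nth.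
split.
  split; first by apply: leq_trans sz.
  - by move=> i; apply: fposition_thickened.
  - move=> i; have /andP[/andP[_ ad] _] := bdS i.
    have [r rS H] := fposition_prism ad; exists r => //.
    by split; apply: H; rewrite !inE eqxx ?orbT.
  move=> i j t t' t1 t1'.
  have /andP[/andP[ni adi] _] := bdS i; have /andP[/andP[nj adj] _] := bdS j.
  rewrite /polygon_edge -!edge_weight_extension => /fposition_inj Ew.
  have tt : 0 <= t <= 1 by case/andP: t1 => -> /ltW.
  have tt' : 0 <= t' <= 1 by case/andP: t1' => -> /ltW.
  have {}Ew := Ew (edge_weight_realization tt adi) (edge_weight_realization tt' adj).
  case: (edge_weight_inj t1 t1' ni nj Ew) => [[E Et]|[E1 E2]].
    split=> //; apply/val_inj/eqP.
    by have := nth_uniq v0 (ltn_ord i) (ltn_ord j) Us; rewrite E eqxx => <-.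
  (* One edge run in both directions would mean a cycle of length two. *)
  have := next_next_neq Us sz (mem_nth v0 (ltn_ord i)).
  by rewrite -nthS E1 -nthS E2 eqxx.
split; first exact: fcomplex_no_closed.
have idx u : u \in s -> exists i : 'I_(size s), nth v0 s i = u.
  move=> us; have ui : (index u s < size s)%N by rewrite index_mem.
  by exists (Ordinal ui); rewrite /= nth_index.
move=> P; split=> [[u [v [t [uv t1 ->]]]]|[i [t [t1 ->]]]].
  case: (nx _ _ uv) => -[E us]; have [i Ei] := idx _ us; exists i.
    by exists t; split=> //; rewrite /polygon_edge nthS Ei -E.
  exists (1 - t); split; first by move: t1; rewrite /unit_interval; lra.
  by rewrite /polygon_edge nthS Ei -E /interp /= addrC subKr.
by exists (nth v0 s i), (nth v0 s (ordS i)), t.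
Qed.
End DiagramSurface.

(** * First homology *)

Section TriangleChains.
Variable V : finType.

Definition triangle_chain (a b c u v w : V) : int :=
  ((a == u) && (b == v) && (c == w))%:Z + ((b == u) && (c == v) && (a == w))%:Z
  + ((c == u) && (a == v) && (b == w))%:Z - ((b == u) && (a == v) && (c == w))%:Z
  - ((a == u) && (c == v) && (b == w))%:Z - ((c == u) && (b == v) && (a == w))%:Z.

Lemma boundary_triangle_chain a b c u v :
  boundary2 (triangle_chain a b c) u v =
  edge_chain a b u v + edge_chain b c u v + edge_chain c a u v.
Proof.
have S (x y z : V) : \sum_w ((x == u) && (y == v) && (z == w))%:Z = ((x == u) && (y == v))%:Z.
  rewrite -[RHS](sum_indicator z (fun=> ((x == u) && (y == v))%:Z)); apply: eq_bigr => w _.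
  by rewrite -mulnb PoszM; case: (z == w).
rewrite /boundary2 /triangle_chain !(sumrB, big_split) /= !S /edge_chain.
by rewrite [(a == v) && (b == u)]andbC [(b == v) && (c == u)]andbC [(c == v) && (a == u)]andbC; ring.
Qed.

Lemma triangle_chain_alt a b c u v w :
  triangle_chain a b c v u w = - triangle_chain a b c u v w /\
  triangle_chain a b c u w v = - triangle_chain a b c u v w.
Proof.
rewrite /triangle_chain; case: (a == u); case: (b == u); case: (c == u);
case: (a == v); case: (b == v); case: (c == v);
by case: (a == w); case: (b == w); case: (c == w).
Qed.

Lemma triangle_chain_support a b c u v w : triangle_chain a b c u v w != 0 ->
  [set u; v; w] = [set a; b; c].
Proof.
have P (x y z : V) : (x == u) && (y == v) && (z == w) ->
    [/\ x = u, y = v & z = w] by case/andP=> /andP[/eqP-> /eqP->] /eqP->.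
rewrite /triangle_chain.
case: (boolP ((a == u) && (b == v) && (c == w))) => [/P[-> -> ->] //|_].
case: (boolP ((b == u) && (c == v) && (a == w))) => [/P[-> -> ->] _|_].
  by apply/setP => x; rewrite !inE; do 3!case: (x == _).
case: (boolP ((c == u) && (a == v) && (b == w))) => [/P[-> -> ->] _|_].
  by apply/setP => x; rewrite !inE; do 3!case: (x == _).
case: (boolP ((b == u) && (a == v) && (c == w))) => [/P[-> -> ->] _|_].
  by apply/setP => x; rewrite !inE; do 3!case: (x == _).
case: (boolP ((a == u) && (c == v) && (b == w))) => [/P[-> -> ->] _|_].
  by apply/setP => x; rewrite !inE; do 3!case: (x == _).
case: (boolP ((c == u) && (b == v) && (a == w))) => [/P[-> -> ->] _|_].
  by apply/setP => x; rewrite !inE; do 3!case: (x == _).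
by [].
Qed.

Lemma chain2_sum (K : {set {set V}}) (I : finType) (k : I -> int) (a b c : I -> V) :
  (forall i, [set a i; b i; c i] \in K) ->
  chain2 K (fun u v w => \sum_i k i * triangle_chain (a i) (b i) (c i) u v w).
Proof.
move=> inK; split=> [u v w|u v w|u v w nz].
- rewrite -sumrN; apply: eq_bigr => i _.
  by have [-> _] := triangle_chain_alt (a i) (b i) (c i) u v w; rewrite mulrN.
- rewrite -sumrN; apply: eq_bigr => i _.
  by have [_ ->] := triangle_chain_alt (a i) (b i) (c i) u v w; rewrite mulrN.
have [i nzi] : exists i, triangle_chain (a i) (b i) (c i) u v w != 0.
  apply: contrapT => none; case/negP: nz; rewrite big1 // => i _.
  apply/eqP; rewrite mulf_eq0; apply/orP; right; apply/negPn/negP => nz.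
  by apply: none; exists i.
by rewrite (triangle_chain_support nzi).
Qed.

Lemma boundary2_sum (I : finType) (k : I -> int) (a b c : I -> V) u v :
  boundary2 (fun u v w => \sum_i k i * triangle_chain (a i) (b i) (c i) u v w) u v =
  \sum_i k i * (edge_chain (a i) (b i) u v + edge_chain (b i) (c i) u v
                + edge_chain (c i) (a i) u v).
Proof.
rewrite /boundary2 exchange_big /=; apply: eq_bigr => i _.
by rewrite -mulr_sumr -boundary_triangle_chain.
Qed.

Variable K : {set {set V}}.

Lemma homologous_trans (c1 c2 c3 : V -> V -> int) : homologous K c1 c2 -> homologous K c2 c3 ->
  homologous K c1 c3.
Proof.
move=> [w [a1 a2 a3] Ew] [w' [b1 b2 b3] Ew'].
exists (fun u v x => w u v x + w' u v x).
  split=> [u v x|u v x|u v x nz].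
  - by rewrite (a1 u v x) (b1 u v x) opprD.
  - by rewrite (a2 u v x) (b2 u v x) opprD.
  have [w0|/a3 //] := eqVneq (w u v x) 0.
  by apply: b3; rewrite w0 add0r in nz.
move=> u v; rewrite /boundary2 big_split /= -/(boundary2 w u v) -/(boundary2 w' u v) -Ew -Ew'.
by ring.
Qed.

Lemma homologous_sub (c1 c2 : V -> V -> int) :
  homologous K (fun u v => c1 u v - c2 u v) (fun _ _ => 0) -> homologous K c1 c2.
Proof. by case=> w cw Ew; exists w => // u v; rewrite -Ew subr0. Qed.

Lemma cycle1_sub (c1 c2 : V -> V -> int) : cycle1 K c1 -> cycle1 K c2 ->
  cycle1 K (fun u v => c1 u v - c2 u v).
Proof.
move=> [[a1 s1] z1] [[a2 s2] z2]; split; last by move=> u; rewrite sumrB z1 z2 subrr.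
split=> [u v|u v nz]; first by rewrite (a1 u v) (a2 u v); ring.
have [c0|/s1 //] := eqVneq (c1 u v) 0.
by apply: s2; rewrite c0 sub0r oppr_eq0 in nz.
Qed.

Lemma boundary_cycle1 w : (forall s t : {set V}, s \in K -> t \subset s -> t != set0 -> t \in K) ->
  chain2 K w -> cycle1 K (boundary2 w).
Proof.
move=> sub [h1 h2 h3]; split; last first.
  move=> u; rewrite /boundary2.
  have : \sum_v \sum_x w u v x = - \sum_v \sum_x w u v x.
    rewrite {1}exchange_big /= -sumrN; apply: eq_bigr => v _.
    by rewrite -sumrN; apply: eq_bigr => x _; rewrite (h2 u v x).
  by move: (\sum_v _) => X; lia.
split=> [u v|u v nz]; first by rewrite /boundary2 -sumrN; apply: eq_bigr => x _; rewrite (h1 u v x).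
have [x nzx] : exists x, w u v x != 0.
  apply: contrapT => none; case/negP: nz; rewrite /boundary2 big1 // => x _.
  by apply/eqP/negPn/negP => nz; apply: none; exists x.
apply: sub (h3 _ _ _ nzx) _ _; first exact: subsetUl.
by apply/set0Pn; exists u; rewrite !inE eqxx.
Qed.
End TriangleChains.

(** * Flow of a cycle through the strips *)

Section Flows.
Variables (m : nat) (D : diagram m).
Notation Zm := 'I_m.+2.
Notation Nd := (node D).
Notation Gt := (gate D).
Notation fv := (fvertex m Nd Gt).
Implicit Types (n : Nd) (g : Gt) (j k : Zm) (e s : bool) (u v : fv) (w : Gt -> int)
  (c : fv -> fv -> int).

Lemma edge_case (P : fv -> fv -> Prop) :
  (forall u v, P u v -> P v u) -> (forall u, P u u) ->
  (forall n j, P (O n) (Pb n j)) -> (forall n k, P (O n) (Pc n k)) ->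
  (forall n j e, P (Pb n j) (Pc n (opp_spoke n j e))) -> (forall g, P (Rb g) (Rc g)) ->
  (forall s g e, P (gv s g) (att s g e)) -> (forall g e, P (gv e g) (att (~~ e) g e)) ->
  forall u v, [set u; v] \in fcomplex D -> P u v.
Proof.
move=> sym P0 OB OC BC RR rail diag u v /generated_pairP[t [ut vt]].
have disc n j e u' v' : u' \in ftriangle (inl (n, j, e)) ->
    v' \in ftriangle (inl (n, j, e)) -> P u' v'.
  have BC' : P (Pb n j) (Pc n (e%:R - lev n - j)) by apply: BC.
  by move=> /mem_disc[->|->|->] /mem_disc[->|->|->]; auto; apply: sym; auto.
have gg s s' g : P (gv s g) (gv s' g).
  by case: s; case: s' => /=; auto.
case: t ut vt => [[[n j] e]|[[g e] x]]; first exact: disc.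
have aa s s' : P (att s g e) (att s' g e) by apply: disc; apply: arm_cell.
move=> /mem_arm[->|[xu ->]|[xu ->]|->] /mem_arm[->|[xv ->]|[xv ->]|->]; auto.
all: by [rewrite xu in xv|rewrite xv in xu|apply: sym; auto].
Qed.

Lemma chain2_diag (K : {set {set fv}}) f u v : chain2 K f ->
  [/\ f u u v = 0, f u v v = 0 & f u v u = 0].
Proof.
move=> [h1 h2 _]; have := h1 u u v; have := h2 u v v; have := h1 u v u; have := h2 v u u.
by split; lia.
Qed.

Lemma boundary2_rail f s g e : chain2 (fcomplex D) f ->
  boundary2 f (att s g e) (gv s g) = f (att s g e) (gv s g) (third s g e).
Proof.
move=> cf; have [n1 n2] := third_neq s g e.
rewrite /boundary2 (bigD1 (third s g e)) //= big1 ?addr0 // => x xt.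
have [d1 d2 d3] := chain2_diag (att s g e) (gv s g) cf.
have [->//|xa] := eqVneq x (att s g e); have [->//|xg] := eqVneq x (gv s g).
apply/eqP/negPn/negP; case: cf => _ _ h3 /h3/generated_tripleP[t [t1 t2 t3]].
by rewrite (rail_third t2 t1 t3 xg xa) eqxx in xt.
Qed.

Lemma diag_third g e t z : gv e g \in ftriangle (D := D) t -> att (~~ e) g e \in ftriangle t ->
  z \in ftriangle t -> z != gv e g -> z != att (~~ e) g e -> z = gv (~~ e) g \/ z = att e g e.
Proof.
move=> ut vt zt zu zv; have [e' [x Et]] := gv_mem ut; rewrite Et in ut vt zt.
have [Ee' vx] := arm_att vt; rewrite -Ee' in zt.
case: (mem_arm zt) => [E|[_ E]|[_ E]|E]; [|by left|by right|];
  by [rewrite E eqxx in zu|rewrite E eqxx in zv].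
Qed.

Lemma boundary2_diag f g e : chain2 (fcomplex D) f ->
  boundary2 f (att (~~ e) g e) (gv e g) =
  f (att (~~ e) g e) (gv e g) (gv (~~ e) g) + f (att (~~ e) g e) (gv e g) (att e g e).
Proof.
move=> cf; rewrite /boundary2 (bigD1 (gv (~~ e) g)) //= (bigD1 (att e g e)) /=; last first.
  by rewrite eq_sym gv_att.
rewrite big1 ?addr0 // => x /andP[x1 x2].
have [d1 d2 d3] := chain2_diag (att (~~ e) g e) (gv e g) cf.
have [->//|xa] := eqVneq x (att (~~ e) g e); have [->//|xg] := eqVneq x (gv e g).
apply/eqP/negPn/negP; case: cf => _ _ h3 /h3/generated_tripleP[t [t1 t2 t3]].
by case: (diag_third t2 t1 t3 xg xa) => E; [move: x1|move: x2]; rewrite E eqxx.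
Qed.

(** Intersection number of [c] with a cross section of the half strip, which cuts the two rails and
    the diagonal. It is a cocycle, as [arm_flow_boundary] confirms. *)
Definition arm_flow c g e : int :=
  c (att true g e) (gv true g) + c (att false g e) (gv false g) + c (att (~~ e) g e) (gv e g).

Lemma arm_flow_boundary f g e : chain2 (fcomplex D) f -> arm_flow (boundary2 f) g e = 0.
Proof.
move=> cf; rewrite /arm_flow !boundary2_rail // boundary2_diag //; case: cf => h1 h2 _.
have h13 x y z : f z y x = - f x y z by rewrite (h1 y z) (h2 y x) (h1 x y) !opprK.
rewrite /third; case: e => /=.
  by rewrite (h13 (att true g true)) (h2 (att false g true) (gv true g)); ring.
by rewrite (h13 (att false g false)) (h2 (att true g false) (gv false g)); ring.
Qed.

Lemma sum_at_gate c s g (f : fv -> int) : chain1 (fcomplex D) c ->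
  \sum_v f v * c v (gv s g) = f (gv (~~ s) g) * c (gv (~~ s) g) (gv s g)
   + f (att s g true) * c (att s g true) (gv s g)
   + f (att s g false) * c (att s g false) (gv s g)
   + f (att (~~ s) g s) * c (att (~~ s) g s) (gv s g).
Proof.
move=> [alt supp].
rewrite (@sum_on_seq _ _ [:: gv (~~ s) g; att s g true; att s g false; att (~~ s) g s]).
- by rewrite !big_cons big_nil addr0 !addrA.
- rewrite /= !inE !negb_or !gv_att /= andbT; apply/andP; split; first apply/andP; first split.
  + by apply/eqP => /arm_att_inj[].
  + by apply/eqP => /arm_att_inj[]; case: s.
  + by apply/eqP => /arm_att_inj[]; case: s.
move=> v; rewrite !inE !negb_or => /and4P[v1 v2 v3 v4].
have [->|vg] := eqVneq v (gv s g); first by have := alt (gv s g) (gv s g); nia.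
suff -> : c v (gv s g) = 0 by rewrite mulr0.
apply/eqP/negPn/negP => /supp/generated_pairP[t [vt gt]].
have [e [x Et]] := gv_mem gt; rewrite Et in vt gt; have := arm_gv gt.
case: (mem_arm vt) => [E|[xF E]|[xT E]|E]; rewrite E in v1 v2 v3 v4 vg.
- by move: v1 vg; case: (s) (e) => -[]; rewrite ?eqxx.
- by move: v1 vg; case: (s) (e) => -[]; rewrite ?eqxx.
- by move: v2 v3; rewrite xT; case: (s) (e) => -[]; rewrite ?eqxx //= => _ _ [].
- by move: v2 v3 v4; case: (s) (e) => -[]; rewrite ?eqxx.
Qed.

Lemma arm_flow_conserved c g : cycle1 (fcomplex D) c ->
  arm_flow c g true = - arm_flow c g false.
Proof.
move=> [cc cyc]; have [alt _] := cc.
have S s : \sum_v 1 * c v (gv s g) = 0.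
  apply: oppr_inj; rewrite oppr0 -sumrN -[RHS](cyc (gv s g)).
  by apply: eq_bigr => v _; rewrite (alt v) mul1r.
have := S true; have := S false; rewrite !sum_at_gate // (alt (gv true g) (gv false g)) /arm_flow /=.
lia.
Qed.

(* The flow from the disc [nd g e] into the strip [g]. *)
Definition out w g e : int := if e then - w g else w g.
(** Kirchhoff's law at each disc. Flows are the first homology of the graph with the discs as
    vertices and the strips as edges, onto which the surface retracts. *)
Definition flow w := forall n, \sum_g (out w g true *+ (nd g true == n)
  + out w g false *+ (nd g false == n)) = 0.

Definition of_node n v := match v with
  O n' | Pb n' _ | Pc n' _ => n' == n | _ => false end.

Lemma of_node_gv n s g : of_node n (gv s g) = false. Proof. by case: s. Qed.
Lemma of_node_att n s g e : of_node n (att s g e) = (nd g e == n).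
Proof. by rewrite /att /rim; case: ifP. Qed.

(** Sum the cycle condition over the vertices of a disc: the edges inside it cancel in pairs, and
    the others end at middle corners, which [G] selects. *)
Lemma arm_flow_is_flow c : cycle1 (fcomplex D) c -> flow (fun g => arm_flow c g false).
Proof.
move=> cyc n; have [cc cs] := cyc; have [alt supp] := cc.
pose f v := (of_node n v)%:Z; pose G v := \sum_g ((gv true g == v)%:Z + (gv false g == v)%:Z).
have G0 v : (if v is (Rb _ | Rc _) then false else true) -> G v = 0.
  by move=> nv; rewrite /G big1 // => g _; case: v nv.
have G1 s g : G (gv s g) = 1.
  rewrite /G (bigD1 g) //= big1 ?addr0 => [|g' /negPf gg]; first by case: s; rewrite !fvertex_eqE eqxx.
  by case: s; rewrite /= !fvertex_eqE gg.
have in_node u v : f u * c u v * (1 - G v) = f u * f v * c u v.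
  have [c0|/supp] := eqVneq (c u v) 0; first by rewrite c0 !(mulr0, mul0r).
  move=> uv; suff: [/\ f u * (1 - G v) = f u * f v & f v * (1 - G u) = f v * f u] by case=> E _; rewrite mulrAC E.
  have fg s g : f (gv s g) = 0 by rewrite /f of_node_gv.
  move: u v uv; apply: edge_case => [u v [-> ->] //|u|n' j|n' k|n' j e|g|s g e|g e].
  - have [[s [g ->]]|nu] := pselect (exists s g, u = gv s g); first by rewrite fg !mul0r.
    rewrite G0; first by rewrite /f; case: of_node.
    by case: u nu => // g ng; case: ng; [exists false, g|exists true, g].
  - by rewrite !G0 // /f /=; case: eqP.
  - by rewrite !G0 // /f /=; case: eqP.
  - by rewrite !G0 // /f /=; case: eqP.
  - by rewrite (fg false) (fg true) !mul0r.
  - by rewrite fg G1 subrr mulr0 !mul0r.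
  - by rewrite fg G1 subrr mulr0 !mul0r.
have sumG (F : fv -> int) : \sum_v F v * G v = \sum_g (F (gv true g) + F (gv false g)).
  under eq_bigr do rewrite mulr_sumr; rewrite exchange_big /=; apply: eq_bigr => g _.
  under eq_bigr do rewrite mulrDr; rewrite big_split /=.
  have S s : \sum_v F v * (gv s g == v)%:Z = F (gv s g).
    by rewrite -[RHS](sum_indicator (gv s g)); apply: eq_bigr => v _; rewrite natz.
  by congr (_ + _); [exact: (S true)|exact: (S false)].
have anti : \sum_u \sum_v f u * f v * c u v = 0.
  have : \sum_u \sum_v f u * f v * c u v = - (\sum_u \sum_v f u * f v * c u v).
    rewrite {1}exchange_big /= -sumrN; apply: eq_bigr => u _; rewrite -sumrN.
    by apply: eq_bigr => v _; rewrite (alt u v); ring.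
  by move: (\sum_u _) => X; lia.
have tot : \sum_v (\sum_u f u * c u v) * G v = 0.
  rewrite -[RHS]anti; transitivity (\sum_v \sum_u (f u * c u v - f u * f v * c u v)).
    apply: eq_bigr => v _; rewrite mulr_suml; apply: eq_bigr => u _.
    by rewrite -in_node; ring.
  under eq_bigr do rewrite sumrB; rewrite sumrB.
  rewrite [X in X - _]exchange_big [X in _ - X]exchange_big /= anti subr0 big1 // => u _.
  by rewrite -mulr_sumr cs mulr0.
rewrite -[RHS]tot sumG; apply: eq_bigr => g _; rewrite !sum_at_gate //.
have -> : out (fun g => arm_flow c g false) g true = arm_flow c g true.
  by rewrite arm_flow_conserved.
rewrite /out /f !of_node_gv !of_node_att /arm_flow /=.
by case: (nd g true == n); case: (nd g false == n); rewrite /= ?mulr0n ?mulr1n ?mul0r ?mul1r; ring.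
Qed.
End Flows.

Lemma chain1_sum (V : finType) (K : {set {set V}}) (I : finType) (k : I -> int) (a b : I -> V) :
  (forall i, [set a i; b i] \in K) -> chain1 K (fun u v => \sum_i k i * edge_chain (a i) (b i) u v).
Proof.
move=> inK; split=> [u v|u v nz].
  by rewrite -sumrN; apply: eq_bigr => i _; rewrite edge_chainC mulrN.
have [i nzi] : exists i, edge_chain (a i) (b i) u v != 0.
  apply: contrapT => none; case/negP: nz; rewrite big1 // => i _.
  apply/eqP; rewrite mulf_eq0; apply/orP; right; apply/negPn/negP => nz.
  by apply: none; exists i.
move: nzi; rewrite /edge_chain.
have [/andP[/eqP<- /eqP<-] //|_] := boolP ((a i == u) && (b i == v)).
by have [/andP[/eqP<- /eqP<-]|//] := boolP ((a i == v) && (b i == u)); rewrite setUC.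
Qed.

Lemma sum_delta (I : finType) (i : I) (F : I -> int) : \sum_j F j * (i == j)%:Z = F i.
Proof. by rewrite -[RHS](sum_indicator i); apply: eq_bigr => j _; rewrite natz. Qed.

(** A zero total lets prefix sums be indexed by the cyclic group: the recursion also holds when the
    last index is followed by 0. *)
Lemma prefix_sum_cyclic m (G : 'I_m.+2 -> int) (j : 'I_m.+2) : \sum_i G i = 0 ->
  \sum_(i < m.+2 | (i < (j + 1)%R)%N) G i = \sum_(i < m.+2 | (i < j)%N) G i + G j.
Proof.
move=> tot; have split_at : \sum_(i < m.+2 | (i < j.+1)%N) G i = \sum_(i < m.+2 | (i < j)%N) G i + G j.
  rewrite (bigD1 j) //= addrC; congr (_ + _); apply: eq_bigl => i.
  by rewrite ltnS [(i < j)%N]ltn_neqAle andbC.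
have Ej : (j + 1)%R = (j.+1 %% m.+2)%N :> nat by rewrite /= modnDmr addn1.
rewrite -split_at Ej; case: (ltnP j.+1 m.+2) => lt; first by rewrite modn_small.
have -> : j.+1 = m.+2 by apply/eqP; rewrite eqn_leq lt ltn_ord.
rewrite modnn [LHS]big1 // -[LHS]tot; apply: eq_bigl => i.
by rewrite ltn_ord.
Qed.

(** * A cycle without flow is a boundary *)

Section NullHomology.
Variables (m : nat) (D : diagram m).
Notation Zm := 'I_m.+2.
Notation Nd := (node D).
Notation Gt := (gate D).
Notation fv := (fvertex m Nd Gt).
Implicit Types (n : Nd) (g : Gt) (j k : Zm) (e s : bool) (u v : fv) (w : Gt -> int)
  (c : fv -> fv -> int).

Lemma fcomplex_sub (s t : {set fv}) : s \in fcomplex D -> t \subset s -> t != set0 ->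
  t \in fcomplex D.
Proof. by have [_ _] := generated_simplicial (@ftriangle_cover m D); apply. Qed.

Lemma edge_chain_rail s g e s' g' e' :
  edge_chain (att s g e) (gv s g) (att s' g' e') (gv s' g') = ((s', g', e') == (s, g, e))%:Z.
Proof.
rewrite /edge_chain [att s g e == gv _ _]eq_sym (negPf (gv_att _ _ _ _ _)) subr0.
congr (nat_of_bool _)%:Z; apply/andP/eqP => [[/eqP E1 /eqP E2]|[-> -> ->]]; last by rewrite !eqxx.
have [Es Eg] := gv_eq E2; rewrite Es Eg in E1 *.
by have [_ ->] := arm_att_inj E1.
Qed.

(** Rails and strip triangles correspond bijectively by inclusion, so subtracting each triangle with
    the coefficient of its rail clears all rails at once. Zero flow then clears the diagonals, and
    the cycle condition at a middle corner clears the middle edge. *)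
Lemma kill_rails c : cycle1 (fcomplex D) c -> (forall g e, arm_flow c g e = 0) ->
  exists c', [/\ cycle1 (fcomplex D) c', homologous (fcomplex D) c c',
    forall g, c' (Rb g) (Rc g) = 0, forall s g e, c' (gv s g) (att s g e) = 0
    & forall g e, c' (gv e g) (att (~~ e) g e) = 0].
Proof.
move=> cyc af0.
pose a (i : bool * Gt * bool) : fv := att i.1.1 i.1.2 i.2.
pose b (i : bool * Gt * bool) : fv := gv i.1.1 i.1.2.
pose d (i : bool * Gt * bool) : fv := third i.1.1 i.1.2 i.2.
pose k i := c (a i) (b i).
pose f u v x := \sum_i k i * triangle_chain (a i) (b i) (d i) u v x.
have cf : chain2 (fcomplex D) f.
  apply: chain2_sum => -[[s g] e]; have [h1 h2 h3] := third_mem s g e.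
  exact: (generated_triple h2 h1 h3).
pose c' u v := c u v - boundary2 f u v.
have cyc' : cycle1 (fcomplex D) c' by apply: cycle1_sub => //; apply: boundary_cycle1 fcomplex_sub cf.
have [[alt' _] cyc0'] := cyc'.
have rail s g e : c' (gv s g) (att s g e) = 0.
  rewrite (alt' (att s g e)) /c' boundary2_sum (eq_bigr (fun i => k i * (i == (s, g, e))%:Z)).
    by under eq_bigr do rewrite eq_sym; rewrite sum_delta /k /a /b /= subrr oppr0.
  move=> [[s1 g1] e1] _; congr (_ * _); rewrite /a /b /d /= edge_chain_rail eq_sym.
  rewrite -[RHS]addr0 -[RHS]addr0; congr (_ + _ + _).
    rewrite /edge_chain (negPf (gv_att _ _ _ _ _)) /= sub0r; apply/eqP.
    rewrite oppr_eq0 eqz_nat eqb0; apply/andP => -[/eqP/gv_eq[Es Eg] /eqP].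
    rewrite Es Eg /third; case: eqVneq => [Ee /arm_att_inj[]|_ E]; first by rewrite -Ee; case: (s).
    by have := gv_att e1 g s g e; rewrite E eqxx.
  rewrite /edge_chain [att s1 g1 e1 == gv _ _]eq_sym (negPf (gv_att _ _ _ _ _)) andbF sub0r.
  apply/eqP; rewrite oppr_eq0 eqz_nat eqb0; apply/andP => -[/eqP + /eqP].
  rewrite /third; case: eqVneq => [_ E|Ns /gv_eq[Es ->] /arm_att_inj[Es' _]].
    by have := gv_att s g (~~ e1) g1 e1; rewrite E eqxx.
  by rewrite Es' Es eqxx in Ns.
have af' g e : arm_flow c' g e = 0.
  transitivity (arm_flow c g e - arm_flow (boundary2 f) g e); first by rewrite /arm_flow /c'; move: (boundary2 f) => h; ring.
  by rewrite arm_flow_boundary // af0 subr0.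
have rail' s g e : c' (att s g e) (gv s g) = 0 by rewrite alt' rail oppr0.
have diag' g e : c' (att (~~ e) g e) (gv e g) = 0.
  by have := af' g e; rewrite /arm_flow !rail' !add0r.
exists c'; split=> //; first by exists f => // u v; rewrite /c' subKr.
- move=> g; rewrite alt'; apply/eqP; rewrite oppr_eq0; apply/eqP.
  have := @sum_at_gate _ _ c' false g (fun=> 1) (proj1 cyc').
  rewrite !(diag' g false) (rail' false g) mul1r mulr0 addr0.
  have -> : \sum_v 1 * c' v (gv false g) = 0.
    apply: oppr_inj; rewrite oppr0 -sumrN -[RHS](cyc0' (gv false g)).
    by apply: eq_bigr => v _; rewrite (alt' v) mul1r.
  have := rail' false g true; have := rail' false g false; rewrite /=; lia.
- by move=> g e; rewrite alt' diag' oppr0.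
Qed.

Lemma spoke_node n v : [set O n; v] \in fcomplex D -> of_node n v.
Proof.
move=> /generated_pairP[t [/O_mem[j [e ->]] /mem_disc[->|->|->]]]; exact: eqxx.
Qed.

(** Once the strips are clear, each rim edge is removed by the only disc triangle containing it. A
    rim vertex is then left with a single edge, its spoke, whose coefficient must be 0. *)
Lemma null_homologous c : cycle1 (fcomplex D) c -> (forall g e, arm_flow c g e = 0) ->
  homologous (fcomplex D) c (fun _ _ => 0).
Proof.
move=> cyc af0; have [c1 [cyc1 hom gate0 rail0 diag0]] := kill_rails cyc af0.
apply: homologous_trans hom _.
pose a (i : Nd * Zm * bool) : fv := O i.1.1.
pose b (i : Nd * Zm * bool) : fv := Pb i.1.1 i.1.2.
pose d (i : Nd * Zm * bool) : fv := Pc i.1.1 (opp_spoke i.1.1 i.1.2 i.2).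
pose k i := c1 (b i) (d i).
pose f u v x := \sum_i k i * triangle_chain (a i) (b i) (d i) u v x.
have cf : chain2 (fcomplex D) f.
  apply: chain2_sum => -[[n j] e]; have [h1 h2 h3] := disc_mem n j e.
  exact: (generated_triple h1 h2 h3).
pose c' u v := c1 u v - boundary2 f u v.
have cyc' : cycle1 (fcomplex D) c' by apply: cycle1_sub => //; apply: boundary_cycle1 fcomplex_sub cf.
have [[alt' supp'] cyc0'] := cyc'.
have rim0 n j e : c' (Pb n j) (Pc n (opp_spoke n j e)) = 0.
  rewrite /c' boundary2_sum (eq_bigr (fun i => k i * ((n, j, e) == i)%:Z)).
    by rewrite sum_delta subrr.
  move=> [[n1 j1] e1] _; congr (_ * _); rewrite /a /b /d /edge_chain /= !fvertex_eqE /=.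
  rewrite ?andbF /= !(add0r, addr0, subr0); congr (nat_of_bool _)%:Z.
  apply/andP/eqP => [[/andP[/eqP-> /eqP->] /andP[_ /eqP/opp_spoke_inj ->]] //|[-> -> ->]].
  by rewrite !eqxx.
have gv0 s g v : boundary2 f (gv s g) v = 0.
  rewrite boundary2_sum big1 // => -[[n1 j1] e1] _.
  rewrite (_ : _ + _ + _ = 0) ?mulr0 //.
  by case: s; rewrite /a /b /d /edge_chain /= !fvertex_eqE /= ?andbF.
have int0 u v : [set u; v] \in fcomplex D -> on_boundary u -> on_boundary v -> c' u v = 0.
  move: u v; apply: edge_case => //.
  - by move=> u v uv bv bu; rewrite alt' uv // oppr0.
  - by move=> u _ _; have := alt' u u; lia.
  - by move=> g _ _; rewrite /c' (gv0 false) gate0 subr0.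
  - by move=> s g e _ _; rewrite /c' gv0 rail0 subr0.
  - by move=> g e _ _; rewrite /c' gv0 diag0 subr0.
have spoke0 n v : on_boundary v -> of_node n v -> c' v (O n) = 0.
  move=> bv nv; rewrite -[RHS](cyc0' v) (bigD1 (O n)) //= big1 ?addr0 // => x xn.
  apply/eqP/negPn/negP => nz; have := supp' _ _ nz.
  case: (boolP (on_boundary x)) => [bx /int0 E|]; first by rewrite E // eqxx in nz.
  case: x xn {nz} => // n' nn _; rewrite setUC => /spoke_node nv'.
  case/negP: nn; move: nv nv'; case: v bv => //= ? ? _ => /eqP-> /eqP->; exact: eqxx.
exists f => // u v; rewrite subr0; apply/eqP; rewrite -subr_eq0 -/(c' u v); apply/eqP.
have [//|/supp' uv] := eqVneq (c' u v) 0.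
move: u v uv; apply: edge_case => //.
- by move=> u v E; rewrite alt' E oppr0.
- by move=> u; have := alt' u u; lia.
- by move=> n j; rewrite alt' spoke0 ?oppr0 //= eqxx.
- by move=> n j; rewrite alt' spoke0 ?oppr0 //= eqxx.
- by move=> g; rewrite /c' (gv0 false) gate0 subr0.
- by move=> s g e; rewrite /c' gv0 rail0 subr0.
- by move=> g e; rewrite /c' gv0 diag0 subr0.
Qed.

End NullHomology.

(** * Cycles representing flows *)

Section FlowChains.
Variables (m : nat) (D : diagram m).
Notation Zm := 'I_m.+2.
Notation Nd := (node D).
Notation Gt := (gate D).
Notation fv := (fvertex m Nd Gt).
Implicit Types (n : Nd) (g : Gt) (j k : Zm) (e s : bool) (u v : fv) (w : Gt -> int)
  (c : fv -> fv -> int).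

Definition inflow s w v : int :=
  \sum_g (out w g true *+ (att s g true == v) + out w g false *+ (att s g false == v)).

(** In the cyclic order of the rim, slot j consists of [Pb n j] and of the vertex after it, its
    opposite for [e] = false. *)
Definition rim_inflow s w n j : int :=
  inflow s w (Pb n j) + inflow s w (Pc n (opp_spoke n j false)).

(** Flow in the cyclic direction: minus what has left the disc so far, normalized to 0 on the edge
    just before [Pb n 0]. The edge with [e] = true precedes [Pb n j], the other one follows it. *)
Definition rim_flow s w n j e : int :=
  - (\sum_(i < m.+2 | (i < j)%N) rim_inflow s w n i) - (if e then 0 else inflow s w (Pb n j)).

Definition fedge : finType := (Nd * Zm * bool + Gt * bool)%type.
Definition fsource s (x : fedge) : fv :=
  match x with inl (n, j, e) => Pb n j | inr (g, e) => att s g e end.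
Definition ftarget s (x : fedge) : fv :=
  match x with inl (n, j, e) => Pc n (opp_spoke n j e) | inr (g, e) => gv s g end.
(** Rim edges are oriented from [Pb] to [Pc], which for [e] = true is against the cyclic order,
    whence the sign. *)
Definition fcoef s w (x : fedge) : int :=
  match x with
  | inl (n, j, e) => if e then - rim_flow s w n j e else rim_flow s w n j e
  | inr (g, e) => out w g e end.

(* A representative of the flow [w] which passes the strips along the edges on
   the side [s], and closes up along the rims of the discs. *)
Definition flow_chain s w u v : int :=
  \sum_x fcoef s w x * edge_chain (fsource s x) (ftarget s x) u v.

Lemma fedge_mem s (x : fedge) : [set fsource s x; ftarget s x] \in fcomplex D.
Proof.
case: x => [[[n j] e]|[g e]] /=.
  by have [_ h2 h3] := disc_mem n j e; apply: generated_pair h2 h3.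
by have [h1 h2 _] := third_mem s g e; apply: generated_pair h2 h1.
Qed.

Lemma sum_pair_bool (I : finType) (F : I * bool -> int) :
  \sum_x F x = \sum_i (F (i, true) + F (i, false)).
Proof.
transitivity (\sum_i \sum_e F (i, e)); last by apply: eq_bigr => i _; rewrite big_bool.
by rewrite pair_big /=; apply: eq_bigr => -[].
Qed.

Lemma sum_fedge (F : fedge -> int) : \sum_x F x =
  \sum_n \sum_j (F (inl (n, j, true)) + F (inl (n, j, false)))
  + \sum_g (F (inr (g, true)) + F (inr (g, false))).
Proof.
rewrite big_sumType /= !sum_pair_bool; congr (_ + _).
by rewrite pair_big /=; apply: eq_bigr => -[].
Qed.

Lemma opp_spoke_next n k : opp_spoke n k true = opp_spoke n k false + 1.
Proof. by rewrite /opp_spoke mulr0n mulr1n; ring. Qed.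

Lemma att_rim s g e : exists y, att s g e = rim y (nd g e) (col g) (kap g).
Proof. by exists (s (+) (tw g && ~~ e)). Qed.

Lemma inflow_total s w n : flow w -> \sum_j rim_inflow s w n j = 0.
Proof.
move=> fw; rewrite -[RHS](fw n) big_split /=.
rewrite [X in _ + X](reindex_inj (inv_inj (opp_spokeK n false))) /=.
under [X in _ + X]eq_bigr do rewrite (opp_spokeK n false).
have S g e (x : int) : \sum_j x *+ (att s g e == Pb n j) + \sum_j x *+ (att s g e == Pc n j)
    = x *+ (nd g e == n).
  have [[|] ->] := att_rim s g e; rewrite /rim.
    rewrite big1 ?add0r => [|j _]; last by rewrite ?fvertex_eqE ?mulr0n.
    rewrite (bigD1 (kap g)) //= fvertex_eqE eqxx andbT big1 ?addr0 // => j /negPf jk.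
    by rewrite fvertex_eqE [kap g == j]eq_sym jk andbF mulr0n.
  rewrite addrC big1 ?add0r => [|j _]; last by rewrite ?fvertex_eqE ?mulr0n.
  rewrite (bigD1 (col g)) //= fvertex_eqE eqxx andbT big1 ?addr0 // => j /negPf jk.
  by rewrite fvertex_eqE [col g == j]eq_sym jk andbF mulr0n.
rewrite /inflow; rewrite exchange_big [X in _ + X]exchange_big -big_split /=.
apply: eq_bigr => g _; rewrite !big_split /= -(S g true) -(S g false).
by rewrite -!addrA; congr (_ + _); rewrite addrCA.
Qed.

Lemma rim_flow_next s w n k : flow w ->
  rim_flow s w n (opp_spoke n k true) true =
  rim_flow s w n (opp_spoke n k false) false - inflow s w (Pc n k).
Proof.
move=> fw; rewrite /rim_flow opp_spoke_next prefix_sum_cyclic ?inflow_total //.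
rewrite /rim_inflow (opp_spokeK n false k); ring.
Qed.

Lemma sum_Pb (X : Nd -> Zm -> int) u :
  \sum_n \sum_j X n j * (Pb n j == u)%:Z = if u is Pb n j then X n j else 0.
Proof.
rewrite pair_big /=; case: u => [n|n j|n k|g|g]; last 2 first.
- by rewrite big1 // => -[n1 j1] _; rewrite fvertex_eqE mulr0.
- by rewrite big1 // => -[n1 j1] _; rewrite fvertex_eqE mulr0.
- by rewrite big1 // => -[n1 j1] _; rewrite fvertex_eqE mulr0.
- rewrite -[RHS](sum_delta (n, j) (fun p => X p.1 p.2)); apply: eq_bigr => -[n1 j1] _.
  by rewrite fvertex_eqE -xpair_eqE eq_sym.
- by rewrite big1 // => -[n1 j1] _; rewrite fvertex_eqE mulr0.
Qed.

Lemma sum_Pc (X : Nd -> Zm -> int) e u :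
  \sum_n \sum_j X n j * (Pc n (opp_spoke n j e) == u)%:Z =
  if u is Pc n k then X n (opp_spoke n k e) else 0.
Proof.
rewrite pair_big /=; case: u => [n|n j|n k|g|g]; last 2 first.
- by rewrite big1 // => -[n1 j1] _; rewrite fvertex_eqE mulr0.
- by rewrite big1 // => -[n1 j1] _; rewrite fvertex_eqE mulr0.
- by rewrite big1 // => -[n1 j1] _; rewrite fvertex_eqE mulr0.
- by rewrite big1 // => -[n1 j1] _; rewrite fvertex_eqE mulr0.
rewrite -[RHS](sum_delta (n, opp_spoke n k e) (fun p => X p.1 p.2)); apply: eq_bigr => -[n1 j1] _.
rewrite fvertex_eqE xpair_eqE eq_sym; have [<-|//] := eqVneq n n1.
by rewrite /= -(inj_eq (inv_inj (opp_spokeK n e))) (opp_spokeK n e j1) eq_sym.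
Qed.

Lemma flow_chain_cycle s w : flow w -> cycle1 (fcomplex D) (flow_chain s w).
Proof.
move=> fw; split=> [|u]; first by apply: chain1_sum; apply: fedge_mem.
rewrite /flow_chain exchange_big /=.
under eq_bigr do rewrite -mulr_sumr sum_edge_chain.
rewrite sum_fedge /=.
have -> : \sum_g (out w g true * ((att s g true == u)%:Z - (gv s g == u)%:Z)
    + out w g false * ((att s g false == u)%:Z - (gv s g == u)%:Z)) = inflow s w u.
  apply: eq_bigr => g _; rewrite /out; move: ((gv s g == u)%:Z) => x.
  by case: (att s g true == u); case: (att s g false == u); rewrite /= ?mulr0n ?mulr1n; ring.
pose P1 := \sum_n \sum_j (- rim_flow s w n j true + rim_flow s w n j false) * (Pb n j == u)%:Z.
pose P2 e := \sum_n \sum_j rim_flow s w n j e * (Pc n (opp_spoke n j e) == u)%:Z.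
transitivity (P1 + P2 true - P2 false + inflow s w u).
  congr (_ + _); rewrite /P1 /P2.
  have split3 (A B C : Nd -> Zm -> int) : \sum_n \sum_j (A n j + B n j - C n j) =
      \sum_n \sum_j A n j + \sum_n \sum_j B n j - \sum_n \sum_j C n j.
    by under eq_bigr do rewrite sumrB big_split; rewrite sumrB big_split.
  rewrite -split3; apply: eq_bigr => n _; apply: eq_bigr => j _.
  move: (rim_flow s w n j true) (rim_flow s w n j false) (Pb n j == u) => x y b1.
  by move: (Pc n (opp_spoke n j true) == u) (Pc n (opp_spoke n j false) == u) => b2 b3; ring.
have nogate s' g : inflow s w (gv s' g) = 0.
  by rewrite /inflow big1 // => g' _; rewrite ![att _ _ _ == _]eq_sym !(negPf (gv_att _ _ _ _ _)) !mulr0n addr0.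
have noO n : inflow s w (O n) = 0.
  have O0 g e : (att s g e == O n) = false.
    by apply/eqP => E; have := att_on_boundary s g e; rewrite E.
  by rewrite /inflow big1 // => g' _; rewrite !O0 !mulr0n addr0.
have -> : P1 = _ := sum_Pb (fun n j => - rim_flow s w n j true + rim_flow s w n j false) u.
have P2E e : P2 e = _ := sum_Pc (fun n j => rim_flow s w n j e) e u.
rewrite !P2E {P1 P2 P2E}; case: u => [n|n j|n k|g|g].
- by rewrite noO; ring.
- by rewrite /rim_flow; ring.
- by rewrite rim_flow_next //; ring.
- by rewrite (nogate false); ring.
- by rewrite (nogate true); ring.
Qed.

Lemma disc_gv : ((forall n s g, (O n == gv s g) = false) *
  ((forall n j s g, (Pb n j == gv s g) = false) * (forall n k s g, (Pc n k == gv s g) = false)))%type.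
Proof. by split; [|split]; [move=> ? s g|move=> ? ? s g..]; apply/eqP; case: s. Qed.

Lemma flow_chain_rail s w s' g e :
  flow_chain s w (att s' g e) (gv s' g) = out w g e *+ (s' == s).
Proof.
rewrite /flow_chain sum_fedge big1 ?add0r => [|n _]; last first.
  rewrite big1 // => j _; rewrite /= /edge_chain.
  by rewrite !disc_gv !andbF subrr !mulr0.
under eq_bigr do rewrite /= !edge_chain_rail.
transitivity (\sum_g' (out w g' e *+ (s' == s)) * (g == g')%:Z).
  apply: eq_bigr => g' _; rewrite !xpair_eqE.
  by case: (s' == s); case: (g == g'); case: e; rewrite /= ?mulr0n ?mulr1n; ring.
exact: (sum_delta g (fun g' => out w g' e *+ (s' == s))).
Qed.

Lemma flow_chain_diag s w g e : flow_chain s w (att (~~ e) g e) (gv e g) = 0.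
Proof.
rewrite /flow_chain sum_fedge big1 ?add0r => [|n _]; last first.
  rewrite big1 // => j _; rewrite /= /edge_chain.
  by rewrite !disc_gv !andbF subrr !mulr0.
rewrite big1 // => g' _ /=; suff E e' : edge_chain (att s g' e') (gv s g') (att (~~ e) g e) (gv e g) = 0.
  by rewrite !E !mulr0 addr0.
rewrite /edge_chain [att s g' e' == gv _ _]eq_sym (negPf (gv_att _ _ _ _ _)) subr0.
apply/eqP; rewrite eqz_nat eqb0; apply/andP => -[/eqP E1 /eqP E2].
have [Es Eg] := gv_eq E2; rewrite Es Eg in E1; have [E3 _] := arm_att_inj E1.
by case: (e) E3.
Qed.

Lemma arm_flow_chain s w g e : arm_flow (flow_chain s w) g e = out w g e.
Proof. by rewrite /arm_flow !flow_chain_rail flow_chain_diag; case: s; rewrite /= mulr0n mulr1n; ring. Qed.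

Lemma arm_flow_sub c c' g e :
  arm_flow (fun u v => c u v - c' u v) g e = arm_flow c g e - arm_flow c' g e.
Proof. by rewrite /arm_flow; ring. Qed.

Lemma cycle_flow_chain s c : cycle1 (fcomplex D) c ->
  homologous (fcomplex D) c (flow_chain s (fun g => arm_flow c g false)).
Proof.
move=> cyc; have fw := arm_flow_is_flow cyc; apply: homologous_sub.
apply: null_homologous => [|g e]; first by apply: cycle1_sub => //; apply: flow_chain_cycle.
rewrite arm_flow_sub arm_flow_chain; case: e; rewrite /= ?subrr //.
by rewrite arm_flow_conserved // opprK addNr.
Qed.

Lemma eq_flow_chain s w w' : w =1 w' -> forall u v, flow_chain s w u v = flow_chain s w' u v.
Proof.
by move=> ww; have -> : w = w' by apply: funext.
Qed.

(** The pairing is computed with the first cycle on the side false and the second one on the side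
    true; this lemma moves a class from one side to the other. *)
Lemma flow_chain_sides s s' w : flow w ->
  homologous (fcomplex D) (flow_chain s w) (flow_chain s' w).
Proof.
move=> fw; apply: homologous_trans (cycle_flow_chain s' (flow_chain_cycle s fw)) _.
by apply/homologous_refl/eq_flow_chain => g; rewrite arm_flow_chain.
Qed.

Lemma arm_flow_sum (I : finType) (k : I -> int) (z : I -> fv -> fv -> int) g e :
  arm_flow (fun u v => \sum_i k i * z i u v) g e = \sum_i k i * arm_flow (z i) g e.
Proof. by rewrite /arm_flow -!big_split; apply: eq_bigr => i _; rewrite /=; ring. Qed.

Lemma cycle1_comb (K : {set {set fv}}) (I : finType) (k : I -> int) (z : I -> fv -> fv -> int) :
  (forall i, cycle1 K (z i)) -> cycle1 K (fun u v => \sum_i k i * z i u v).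
Proof.
move=> cz; split; last first.
  move=> u; rewrite exchange_big big1 //= => i _; have [_ ci] := cz i.
  by rewrite -mulr_sumr ci mulr0.
split=> [u v|u v nz].
  by rewrite -sumrN; apply: eq_bigr => i _; have [[-> _] _] := cz i; rewrite mulrN.
have [i nzi] : exists i, z i u v != 0.
  apply: contrapT => none; case/negP: nz; rewrite big1 // => i _.
  apply/eqP; rewrite mulf_eq0; apply/orP; right; apply/negPn/negP => nz.
  by apply: none; exists i.
by have [[_ si] _] := cz i; apply: si.
Qed.

Lemma flow_basis (N : nat) (b : 'I_N -> Gt -> int) :
  (forall i, flow (b i)) -> (forall w, flow w -> exists k : 'I_N -> int, forall g, w g = \sum_i k i * b i g) ->
  (forall k : 'I_N -> int, (forall g, \sum_i k i * b i g = 0) -> forall i, k i = 0) ->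
  basis_H1 (fcomplex D) (fun i => flow_chain false (b i)).
Proof.
move=> fb gen free; have af (k : 'I_N -> int) g : arm_flow (fun u v => \sum_i k i * flow_chain false (b i) u v) g false
    = \sum_i k i * b i g.
  by rewrite arm_flow_sum; apply: eq_bigr => i _; rewrite arm_flow_chain.
split=> [i|c cyc|k [f cf Ef]].
- exact: flow_chain_cycle.
- have [k Ek] := gen _ (arm_flow_is_flow cyc); exists k; apply: homologous_sub.
  have cyck : cycle1 (fcomplex D) (fun u v => \sum_i k i * flow_chain false (b i) u v).
    by apply: cycle1_comb => i; apply: flow_chain_cycle.
  apply: null_homologous => [|g e]; first exact: cycle1_sub.
  rewrite arm_flow_sub.
  have -> : arm_flow c g e = out (fun g => arm_flow c g false) g e.
    by case: e => //=; rewrite arm_flow_conserved.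
  have -> : arm_flow (fun u v => \sum_i k i * flow_chain false (b i) u v) g e =
      out (fun g => arm_flow (fun u v => \sum_i k i * flow_chain false (b i) u v) g false) g e.
    by case: e => //=; rewrite arm_flow_conserved.
  by rewrite /out af -Ek subrr.
apply: free => g; rewrite -af.
have -> : (fun u v => \sum_i k i * flow_chain false (b i) u v) = boundary2 f.
  by apply/funext => u; apply/funext => v; rewrite -Ef subr0.
exact: arm_flow_boundary.
Qed.

End FlowChains.

(** * Chains and crossings in the thickened surface *)

Section Approximation.
Variables (R : realType) (S : oriented_surface) (v0 : svert S).
Implicit Types (x y : spoint R S).

(* Depending only on supports, it does not see small displacements of the vertices. *)
Definition nearest x : svert S := odflt v0 [pick v in Defs.support x].

Lemma nearest_mem x v : v \in Defs.support x -> nearest x \in Defs.support x.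
Proof. by rewrite /nearest; case: pickP => [//|/(_ v) /= ->]. Qed.

Lemma in_surface_support x : in_surface x -> exists v, v \in Defs.support x.
Proof.
case=> _ x1 _; apply: contrapT => none; have /eqP := x1.
rewrite big1 ?(eq_sym 0) ?oner_eq0 // => v _.
by apply/eqP/negPn/negP => nz; apply: none; exists v; rewrite inE.
Qed.

Lemma nearest_approximation : simplicial_approximation nearest.
Proof. by move=> x /in_surface_support[v]; apply: nearest_mem. Qed.

Lemma eq_nearest x y : Defs.support x = Defs.support y -> nearest x = nearest y.
Proof. by rewrite /nearest => ->. Qed.

Variables (V : finType) (K : {set {set V}}).
Implicit Types (f : V -> tpoint R S) (c : V -> V -> int).

Lemma approximate_realize f c u v : (forall u v, c v u = - c u v) ->
  approximate nearest (project (realize f c)) u v =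
  \sum_x \sum_y c x y * ((nearest (f x).1 == u) && (nearest (f y).1 == v))%:Z.
Proof.
move=> alt; rewrite /approximate /project big_map /=.
pose A (P Q : tpoint R S) : int := ((nearest P.1 == u) && (nearest Q.1 == v))%:Z.
rewrite -(sum_realize_sym f A alt); apply: eq_bigr => a _.
rewrite /A [X in _ = _ * (_ - Posz (nat_of_bool X))]andbC /= mulrBr.
by do 2!case: (_ && _); rewrite /= ?mulr0n ?mulr1n ?mulr0 ?mulr1.
Qed.

Lemma homologous_same_support f f' c :  (forall u v, c v u = - c u v) ->
  (forall v, Defs.support (f v).1 = Defs.support (f' v).1) ->
  homologous_in_surface (project (realize f c)) (project (realize f' c)).
Proof.
move=> alt ff; exists nearest; first exact: nearest_approximation.
apply: homologous_refl => u v; rewrite !approximate_realize //.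
by under eq_bigr do under eq_bigr do rewrite !(eq_nearest (ff _)).
Qed.

Hypothesis complexS : forall s t : {set svert S}, s \in scplx S -> t \subset s -> t != set0 -> t \in scplx S.

(** The map [nearest] after [f] is simplicial: a simplex lands in a single prism, so the images of
    its vertices span a simplex of Sigma. The bounding 2-chain is pushed forward along it. *)
Lemma homologous_pushforward f c c' : 
  (forall u v, c v u = - c u v) -> (forall u v, c' v u = - c' u v) ->
  (forall v, in_surface (f v).1) ->
  (forall s, s \in K -> exists2 r, r \in scplx S & forall v, v \in s -> in_simplex r (f v).1) ->
  homologous K c c' -> homologous_in_surface (project (realize f c)) (project (realize f c')).
Proof.
move=> alt alt' fin prism [w [w1 w2 w3] Ew]; exists nearest; first exact: nearest_approximation.
pose psi v := nearest (f v).1.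
exists (fun x y z : svert S => \sum_u \sum_v \sum_t w u v t * ((psi u == x) && (psi v == y) && (psi t == z))%:Z).
  split=> [x y z|x y z|x y z nz].
  - rewrite exchange_big -sumrN; apply: eq_bigr => u _; rewrite -sumrN; apply: eq_bigr => v _.
    rewrite -sumrN; apply: eq_bigr => t _; rewrite w1 mulNr.
    by rewrite [(psi v == y) && _]andbC.
  - rewrite -sumrN; apply: eq_bigr => u _; rewrite exchange_big -sumrN; apply: eq_bigr => v _.
    by rewrite -sumrN; apply: eq_bigr => t _; rewrite w2 mulNr andbAC.
  have [u [v [t [nzw /andP[/andP[/eqP<- /eqP<-] /eqP<-]]]]] : exists u v t, w u v t != 0 /\
      (psi u == x) && (psi v == y) && (psi t == z).
    apply: contrapT => none; case/negP: nz; rewrite big1 // => u _; rewrite big1 // => v _.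
    rewrite big1 // => t _; have [->|nzw] := eqVneq (w u v t) 0; first by rewrite mul0r.
    by case E: (_ && _); [case: none; exists u, v, t|rewrite mulr0].
  have [r rS sub] := prism _ (w3 _ _ _ nzw); apply: complexS rS _ _; last first.
    by apply/set0Pn; exists (psi u); rewrite !inE eqxx.
  have inr q : q \in [set u; v; t] -> psi q \in r.
    by move=> /sub/subsetP; apply; apply: nearest_approximation.
  by apply/subsetP => q; rewrite !inE -orbA => /or3P[]/eqP->; apply: inr; rewrite !inE eqxx ?orbT.
move=> x y; rewrite !approximate_realize // -sumrB /boundary2 exchange_big; apply: eq_bigr => u _.
rewrite exchange_big -sumrB; apply: eq_bigr => v _; rewrite -mulrBl Ew /boundary2 mulr_suml exchange_big.
apply: eq_bigr => t _; rewrite -/(psi u) -/(psi v) -mulr_sumr; congr (_ * _).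
rewrite -(sum_delta (psi t) (fun=> ((psi u == x) && (psi v == y))%:Z)).
by apply: eq_bigr => z _; case: (_ && _); rewrite /= ?mul1r ?mul0r.
Qed.

Lemma polygonal_realize f c : cycle1 K c -> (forall v, in_surface (f v).1) ->
  (forall s, s \in K -> exists2 r, r \in scplx S & forall v, v \in s -> in_simplex r (f v).1) ->
  polygonal_cycle (project (realize f c)).
Proof.
move=> [[alt supp] cyc] fin prism; split.
  move=> a /mapP[a' /mapP[[u v] _ ->] ->] /= /supp uv; split=> //=.
  have [r rS sub] := prism _ uv; exists r => //.
  by split; apply: sub; rewrite !inE eqxx ?orbT.
move=> x; rewrite big_map /=.
pose A (P Q : tpoint R S) : int := (Q.1 == x)%:Z.
transitivity (\sum_(a <- realize f c) a.1 * (A a.2.1 a.2.2 - A a.2.2 a.2.1)).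
  apply: eq_bigr => a _; rewrite /A mulrBr.
  by do 2!case: (_ == x); rewrite /= ?mulr0n ?mulr1n ?mulr0 ?mulr1.
rewrite sum_realize_sym // exchange_big big1 //= => v _; rewrite -mulr_suml.
suff -> : \sum_u c u v = 0 by rewrite mul0r.
apply: oppr_inj; rewrite oppr0 -sumrN -[RHS](cyc v); apply: eq_bigr => u _.
exact/esym/alt.
Qed.
End Approximation.

(** * Crossing signs as alternating functions of segments *)

Section FrameForm.
Variables (R : realType) (S : oriented_surface).
Implicit Types (x u w : spoint R S) (e : spoint R S * spoint R S) (E : tpoint R S * tpoint R S).

Lemma frame_formDx x x' u w : frame_form (x + x') u w = frame_form x u w + frame_form x' u w.
Proof.
rewrite /frame_form -big_split; apply: eq_bigr => a _; rewrite -big_split; apply: eq_bigr => b _.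
by rewrite -big_split; apply: eq_bigr => c _; rewrite /= ffunE; ring.
Qed.

Lemma frame_formNu x u w : frame_form x (- u) w = - frame_form x u w.
Proof.
rewrite /frame_form -sumrN; apply: eq_bigr => a _; rewrite -sumrN; apply: eq_bigr => b _.
by rewrite -sumrN; apply: eq_bigr => c _; rewrite ffunE; ring.
Qed.

Lemma frame_formNw x u w : frame_form x u (- w) = - frame_form x u w.
Proof.
rewrite /frame_form -sumrN; apply: eq_bigr => a _; rewrite -sumrN; apply: eq_bigr => b _.
by rewrite -sumrN; apply: eq_bigr => c _; rewrite ffunE; ring.
Qed.

Lemma frame_form_diag u w : frame_form u u w = 0.
Proof.
have [_ [[o1 _ _] _ _]] : closed_connected_surface (scplx S) /\
    fundamental_cycle (scplx S) (sorient S) by case: S.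
have E : frame_form u u w = - frame_form u u w.
  rewrite {1}/frame_form exchange_big -sumrN; apply: eq_bigr => a _; rewrite -sumrN.
  by apply: eq_bigr => b _; rewrite -sumrN; apply: eq_bigr => c _; rewrite o1 rmorphN /=; ring.
by move: E; lra.
Qed.

Definition reverse (T : Type) (e : T * T) : T * T := (e.2, e.1).

Lemma interp_reverse (T : lmodType R) (e : T * T) t : interp (reverse e) t = interp e (1 - t).
Proof. by rewrite /interp subKr addrC. Qed.

Lemma unit_reverse (t : R) : unit_interval t -> unit_interval (1 - t).
Proof. by rewrite /unit_interval; lra. Qed.

Lemma segment_form_reversel e e' : segment_form (reverse e) e' = - segment_form e e'.
Proof.
rewrite /segment_form /= -[e.1 - e.2]opprB frame_formNu; congr (- _).
by rewrite -{1}[e.2](subrK e.1) frame_formDx frame_form_diag add0r.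
Qed.

Lemma segment_form_reverser e e' : segment_form e (reverse e') = - segment_form e e'.
Proof. by rewrite /segment_form /= -[e'.1 - e'.2]opprB frame_formNw. Qed.

Lemma meet_reverse e e' : meet e e' -> meet (reverse e) e' /\ meet e (reverse e').
Proof.
move=> [t [t' [ht ht' E]]]; split.
  by exists (1 - t), t'; rewrite interp_reverse subKr; split=> //; apply: unit_reverse.
by exists t, (1 - t'); rewrite interp_reverse subKr; split=> //; apply: unit_reverse.
Qed.

Lemma passes_reverse E E' : passes_over E E' ->
  passes_over (reverse E) E' /\ passes_over E (reverse E').
Proof.
move=> [t [t' [ht ht' M H]]]; split.
  exists (1 - t), t'; rewrite -/(reverse _) ; split=> //; first exact: unit_reverse.
    by rewrite -[project_segment _]/(reverse (project_segment E)) interp_reverse subKr.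
  by rewrite interp_reverse subKr.
exists t, (1 - t'); split=> //; first exact: unit_reverse.
  by rewrite -[project_segment (reverse _)]/(reverse (project_segment E')) interp_reverse subKr.
by rewrite interp_reverse subKr.
Qed.

Lemma transverse_reverse e e' : transverse_segments e e' ->
  transverse_segments (reverse e) e' /\ transverse_segments e (reverse e').
Proof.
move=> H; split=> t t' ht ht'; rewrite interp_reverse => M.
  have [h1 h2 h3] := H _ _ (unit_reverse ht) ht' M.
  by rewrite segment_form_reversel oppr_eq0; split=> //; lra.
have [h1 h2 h3] := H _ _ ht (unit_reverse ht') M.
by rewrite segment_form_reverser oppr_eq0; split=> //; lra.
Qed.

Definition crossing_sign e e' : int := if `[< meet e e' >] then sgz (segment_form e e') else 0.
Definition over_sign E E' : int := if `[< passes_over E E' >]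
  then sgz (segment_form (project_segment E) (project_segment E')) else 0.

Lemma crossing_sign_reverse e e' : crossing_sign (reverse e) e' = - crossing_sign e e' /\
  crossing_sign e (reverse e') = - crossing_sign e e'.
Proof.
rewrite /crossing_sign segment_form_reversel segment_form_reverser !sgzN.
have -> : `[< meet (reverse e) e' >] = `[< meet e e' >].
  by apply: asbool_equiv_eq; split=> /meet_reverse[]; case: e.
have -> : `[< meet e (reverse e') >] = `[< meet e e' >].
  by apply: asbool_equiv_eq; split=> /meet_reverse[]; case: e'.
by case: ifP; rewrite ?oppr0.
Qed.

Lemma over_sign_reverse E E' : over_sign (reverse E) E' = - over_sign E E' /\
  over_sign E (reverse E') = - over_sign E E'.
Proof.
rewrite /over_sign -[project_segment (reverse E)]/(reverse (project_segment E)).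
rewrite -[project_segment (reverse E')]/(reverse (project_segment E')).
rewrite segment_form_reversel segment_form_reverser !sgzN.
have -> : `[< passes_over (reverse E) E' >] = `[< passes_over E E' >].
  by apply: asbool_equiv_eq; split=> /passes_reverse[]; case: E.
have -> : `[< passes_over E (reverse E') >] = `[< passes_over E E' >].
  by apply: asbool_equiv_eq; split=> /passes_reverse[]; case: E'.
by case: ifP; rewrite ?oppr0.
Qed.

Section Edges.
Variables (V V' I I' : finType) (f : V -> tpoint R S) (f' : V' -> tpoint R S)
  (k : I -> int) (k' : I' -> int) (s t : I -> V) (s' t' : I' -> V')
  (c : V -> V -> int) (c' : V' -> V' -> int).
Hypothesis cE : forall u v : V, c u v = \sum_i k i * edge_chain (s i) (t i) u v.
Hypothesis c'E : forall u v : V', c' u v = \sum_i k' i * edge_chain (s' i) (t' i) u v.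
Let seg i := (f (s i), f (t i)).
Let seg' i := (f' (s' i), f' (t' i)).

(** A sign that alternates in both segments allows [sum_realize_edges] in each variable; linking and
    intersection counts are the two instances. *)
Lemma sum_realize_pairs (X : tpoint R S * tpoint R S -> tpoint R S * tpoint R S -> int) :
  (forall E E', X (reverse E) E' = - X E E' /\ X E (reverse E') = - X E E') ->
  \sum_(a <- realize f c) \sum_(b <- realize f' c') a.1 * b.1 * X a.2 b.2 =
  \sum_i \sum_i' k i * k' i' * X (seg i) (seg' i').
Proof.
move=> Xr; transitivity (\sum_(a <- realize f c) a.1 * \sum_i' k' i' * X (a.2.1, a.2.2) (seg' i')).
  apply: eq_bigr => -[x [P Q]] _ /=; under eq_bigr do rewrite -mulrA.
  rewrite -mulr_sumr; congr (_ * _).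
  rewrite -(sum_realize_edges f' (G := fun P' Q' => X (P, Q) (P', Q')) _ c'E) => [|P' Q'].
    by apply: eq_bigr => -[y [P' Q']] _.
  by have [_ <-] := Xr (P, Q) (P', Q').
rewrite (sum_realize_edges f (G := fun P Q => \sum_i' k' i' * X (P, Q) (seg' i')) _ cE) => [|P Q].
  by apply: eq_bigr => i _; rewrite mulr_sumr; apply: eq_bigr => i' _; rewrite mulrA.
rewrite -sumrN; apply: eq_bigr => i' _; rewrite -mulrN; congr (_ * _).
by have [<- _] := Xr (P, Q) (seg' i').
Qed.

Lemma linking_edges : linking_count (realize f c) (realize f' c') =
  \sum_i \sum_i' k i * k' i' * over_sign (seg i) (seg' i').
Proof. exact: (sum_realize_pairs over_sign_reverse). Qed.

Lemma intersection_edges : intersection_count (project (realize f c)) (project (realize f' c')) =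
  \sum_i \sum_i' k i * k' i' * crossing_sign (project_segment (seg i)) (project_segment (seg' i')).
Proof.
rewrite -(@sum_realize_pairs (fun E E' => crossing_sign (project_segment E) (project_segment E'))).
  rewrite /intersection_count big_map; apply: eq_bigr => a _.
  by rewrite big_map; apply: eq_bigr.
move=> E E'; exact: crossing_sign_reverse (project_segment E) (project_segment E').
Qed.

Lemma transverse_edges :
  (forall i i', k i != 0 -> k' i' != 0 ->
    transverse_segments (project_segment (seg i)) (project_segment (seg' i'))) ->
  transverse (project (realize f c)) (project (realize f' c')).
Proof.
move=> H a b /mapP[[x [P Q]] + ->] /mapP[[y [P' Q']] + ->] /=.
have pickE (W J : finType) (g : W -> tpoint R S) (q : J -> int) (p r : J -> W) (d : W -> W -> int) (u v : W) :
   (forall u v : W, d u v = \sum_i q i * edge_chain (p i) (r i) u v) -> d u v != 0 ->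
   exists2 i, q i != 0 & (g u, g v) = (g (p i), g (r i)) \/ (g u, g v) = reverse (g (p i), g (r i)).
  move=> -> nz; have [i nzi] : exists i, q i * edge_chain (p i) (r i) u v != 0.
    apply: contrapT => none; case/negP: nz; rewrite big1 // => i _.
    by apply/eqP/negPn/negP => nz; apply: none; exists i.
  move: nzi; rewrite mulf_eq0 negb_or => /andP[qi nzi]; exists i => //; move: nzi; rewrite /edge_chain.
  have [/andP[/eqP<- /eqP<-] _|_] := boolP ((p i == u) && (r i == v)); first by left.
  by have [/andP[/eqP<- /eqP<-] _|//] := boolP ((p i == v) && (r i == u)); right.
move=> /mapP[[u v] _ [-> -> ->]] /mapP[[u' v'] _ [-> -> ->]] /=.
move=> /(pickE _ _ f _ _ _ _ _ _ cE)[i ki Ei] /(pickE _ _ f' _ _ _ _ _ _ c'E)[i' ki' Ei'].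
have T := H i i' ki ki'.
have PS (E E' : tpoint R S * tpoint R S) : E = E' -> project_segment E = project_segment E' by move=> ->.
by case: Ei => /PS ->; case: Ei' => /PS -> //;
  [have [_] := transverse_reverse T|have [] := transverse_reverse T|
   have [/transverse_reverse[]] := transverse_reverse T].
Qed.
End Edges.
End FrameForm.

(** * Crossings of strips and discs *)

Section FramePoints.
Variables (R : realType) (m : nat).
Notation Zm := 'I_m.+2.
Notation Sg := (tripartite_surface m).
Implicit Types (i j k : Zm) (A B C : R).

Lemma sum_pt i j k A B C (G : svertex m -> R) :
  \sum_u (pt (R := R) i j k A B C u : R) * G u = A * G (SA i) + B * G (SB j) + C * G (SC k).
Proof.
have S (l : Zm) (X : R) (H : Zm -> R) : \sum_l' X *+ (l' == l) * H l' = X * H l.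
  rewrite (bigD1 l) //= eqxx mulr1n big1 ?addr0 // => l' /negPf ->.
  by rewrite mulr0n mul0r.
rewrite (sum_svertex (fun u => (pt i j k A B C u : R) * G u)) /=.
under eq_bigr do rewrite ffunE; rewrite S.
under eq_bigr do rewrite ffunE; rewrite S.
by under eq_bigr do rewrite ffunE; rewrite S addrA.
Qed.

(** Only the six orderings of a_i, b_j, c_k contribute, which leaves a determinant times the sign of
    the triangle. *)
Lemma frame_pt i j k A B C A' B' C' A'' B'' C'' :
  frame_form (S := Sg) (pt i j k A B C) (pt i j k A' B' C') (pt i j k A'' B'' C'') =
  (port_sign (i + j + k))%:~R * (A * (B' * C'' - C' * B'') - B * (A' * C'' - C' * A'')
     + C * (A' * B'' - B' * A'')).
Proof.
pose o (a b c : svertex m) : R := (surface_orientation a b c)%:~R.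
have inner a b : \sum_c o a b c * (pt i j k A B C a * pt i j k A' B' C' b * pt i j k A'' B'' C'' c)
    = pt i j k A B C a * (pt i j k A' B' C' b * (A'' * o a b (SA i) + B'' * o a b (SB j) + C'' * o a b (SC k))).
  rewrite -sum_pt !mulr_sumr; apply: eq_bigr => c _.
  by move: (pt i j k A B C a) (pt i j k A' B' C' b) (pt i j k A'' B'' C'' c) => x y z; rewrite /GRing.regular; ring.
rewrite /frame_form; under eq_bigr => a _.
  under eq_bigr => b _ do rewrite -/(o a b _) inner.
  rewrite -mulr_sumr sum_pt; over.
rewrite sum_pt /o /= !rmorphN /= !mulr0z.
by move: ((port_sign _)%:~R) => s; ring.
Qed.

Lemma pt_sub i j k A B C A' B' C' :
  pt i j k A B C - pt i j k A' B' C' = pt (R := R) i j k (A - A') (B - B') (C - C').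
Proof. by rewrite -scaleN1r pt_scale pt_add !mulN1r. Qed.

Lemma interp_pt i j k A B C A' B' C' t : interp (pt i j k A B C, pt i j k A' B' C') t =
  pt (R := R) i j k ((1 - t) * A + t * A') ((1 - t) * B + t * B') ((1 - t) * C + t * C').
Proof. by rewrite /interp !pt_scale pt_add. Qed.

Lemma port_sign_cell i j k (e : bool) : k = e%:R - i - j -> port_sign (i + j + k) = if e then - 1 else 1.
Proof.
move=> ->; rewrite (_ : i + j + _ = e%:R); last by ring.
by case: e; rewrite /port_sign /= ?mulr0n ?mulr1n ?eqxx ?oner_eq0 // eq_sym oner_eq0.
Qed.
End FramePoints.

Section Crossings.
Variables (R : realType) (m : nat) (D : diagram m) (Y : layout R D).
Notation Zm := 'I_m.+2.
Notation Nd := (node D).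
Notation Gt := (gate D).
Notation fv := (fvertex m Nd Gt).
Notation Sg := (tripartite_surface m).
Notation E := (eps Y).
Implicit Types (n : Nd) (g : Gt) (j k : Zm) (e b c : bool) (t : R) (v : fv).

Definition over_edge s (x : fedge D) b c : tpoint R Sg * tpoint R Sg :=
  (tposition Y (fsource s x, b), tposition Y (ftarget s x, c)).
Definition under_edge s (x : fedge D) : tpoint R Sg * tpoint R Sg :=
  (fposition Y (fsource s x), fposition Y (ftarget s x)).

(** Parameter at which a lifted strip edge, whose coordinate at a starts from 1/2 + eps/4, reaches
    the value 1/2 of the rims. *)
Definition rim_depth : R := E / (2 + E).
Let t0 := rim_depth.

Lemma rim_depth_bounds : [/\ 0 < t0, t0 <= E / 2 & (1 - t0) * (1 / 2 + E / 4) = 1 / 2].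
Proof.
have E0 := eps_gt0 Y; have E1 := eps_small Y.
have E2 : 0 < 2 + E by lra.
split; first by apply: divr_gt0.
  by rewrite /t0 /rim_depth ler_pdivrMr //; have := mulr_gt0 E0 E0; lra.
by rewrite /t0 /rim_depth; field; lra.
Qed.

Lemma radius_sg b : radius Y (sg R b) = 1 / 2 - E / 4.
Proof. by rewrite /radius /sg; case: b; rewrite ?normrN normr1; ring. Qed.

Lemma twisted_att s g e : twisted_edge (att s g e) (gv s g) = twisted g e.
Proof.
have L : (nd g e == low g) = ~~ e.
  by case: e => /=; rewrite ?eqxx // -[low g]/(nd g false) -[upp g]/(nd g true) (negPf (nd_neq g)).
by rewrite /twisted /att /rim; case: ifP; case: s => /=; rewrite L.
Qed.

Lemma over_arm_start g e b : tposition Y (att false g e, b) =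
  (pt (lev (nd g e)) (col g) (kap g) (1 / 2 + E / 4) (if twisted g e then 0 else 1 / 2 - E / 4)
      (if twisted g e then 1 / 2 - E / 4 else 0), hN Y (nd g e) + E * sg R b).
Proof.
rewrite /tposition /att /rim /= -/(twisted g e); case: ifP => tge.
  rewrite (pos_Pc _ _ _ _ (col g)) radius_sg; apply: pt_pair => //; lra.
have nr : raised (nd g e) (col g) = false by apply: untwisted_not_raised Y _ _ _ _ tge.
rewrite (pos_Pb _ _ _ _ (kap g)) /radius_b /height_b nr radius_sg.
by apply: pt_pair => //; lra.
Qed.

Lemma under_arm_start g e : fposition Y (att true g e) =
  (pt (lev (nd g e)) (col g) (kap g) (1 / 2) (if twisted g e then 1 / 2 else 0)
      (if twisted g e then 0 else 1 / 2), hN Y (nd g e) + if twisted g e then 20 * E else 0).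
Proof.
rewrite /fposition /att /rim -/(twisted g e); case: (boolP (twisted g e)) => tge.
  have [tg Ne] := andP tge; have Ee : e = false by case: (e) Ne.
  rewrite Ee [LHS](pos_Pb Y _ _ _ (kap g)) /radius_b /height_b.
  rewrite (raised_gate g : raised (nd g false) (col g) = _) tg.
  by apply: pt_pair => //; lra.
rewrite [LHS](pos_Pc Y _ _ _ (col g)) radius0; apply: pt_pair => //; lra.
Qed.

Lemma over_rim n j e b c : raised n j = false ->
  project_segment (over_edge false (inl (n, j, e)) b c) =
  (pt (lev n) j (opp_spoke n j e) (1 / 2 + E / 4) (1 / 2 - E / 4) 0,
   pt (lev n) j (opp_spoke n j e) (1 / 2 + E / 4) 0 (1 / 2 - E / 4)).
Proof.
move=> nr; rewrite /over_edge /project_segment /tposition /=.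
rewrite (pt_irrC _ _ 0 (opp_spoke n j e)) (pt_irrB _ 0 j) /radius_b nr !radius_sg.
by congr (pt _ _ _ _ _ _, pt _ _ _ _ _ _); lra.
Qed.

Lemma under_rim n j e : under_edge true (inl (n, j, e)) =
  ((pt (lev n) j (opp_spoke n j e) (1 / 2) (1 / 2) 0, hN Y n + if raised n j then 20 * E else 0),
   (pt (lev n) j (opp_spoke n j e) (1 / 2) 0 (1 / 2), hN Y n)).
Proof.
rewrite /under_edge /fposition /fsource /ftarget (pos_Pb _ _ _ _ (opp_spoke n j e)) (pos_Pc _ _ _ _ j).
rewrite /radius_b /height_b radius0; congr (_, _); apply: pt_pair => //; try (by case: ifP => _; lra).
all: lra.
Qed.

Lemma over_arm g e b c : over_edge false (inr (g, e)) b c =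
  ((pt (lev (nd g e)) (col g) (kap g) (1 / 2 + E / 4) (if twisted g e then 0 else 1 / 2 - E / 4)
      (if twisted g e then 1 / 2 - E / 4 else 0), hN Y (nd g e) + E * sg R b),
   (pt (lev (nd g e)) (col g) (kap g) 0 (beta g (sg R c))
      (1 - beta g (sg R c)), hG Y g + E * sg R (c))).
Proof.
rewrite /over_edge /fsource /ftarget over_arm_start; congr (_, _).
by rewrite /tposition [LHS](pos_Rb _ _ _ (lev (nd g e))).
Qed.

Lemma under_arm g e : under_edge true (inr (g, e)) =
  ((pt (lev (nd g e)) (col g) (kap g) (1 / 2) (if twisted g e then 1 / 2 else 0)
      (if twisted g e then 0 else 1 / 2), hN Y (nd g e) + if twisted g e then 20 * E else 0),
   (pt (lev (nd g e)) (col g) (kap g) 0 (1 / 3) (2 / 3), hG Y g)).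
Proof.
rewrite /under_edge /fsource /ftarget under_arm_start; congr (_, _).
by rewrite /fposition [LHS](pos_Rc _ _ _ (lev (nd g e))); apply: pt_pair => //; lra.
Qed.

Lemma sg_beta g b : 6 / 10 <= beta g (sg R b) <= 3 / 4.
Proof. by apply: beta_bd; rewrite /sg; case: b; lra. Qed.

(* The rims of the lifts have a smaller radius than those of the surface. *)
Lemma over_rim_disjoint n j e b c x t t' : raised n j = false ->
  unit_interval t -> unit_interval t' ->
  interp (project_segment (over_edge false (inl (n, j, e)) b c)) t <>
  interp (project_segment (under_edge true x)) t'.
Proof.
have E0 := eps_gt0 Y; have E1 := eps_small Y.
move=> nr /andP[t1 t2] /andP[t1' t2']; rewrite over_rim // interp_pt.
case: x => [[[n' j'] e']|[g e']].
  by rewrite under_rim /project_segment interp_pt => /pt_inj[[EA _ _] _]; lra.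
by rewrite under_arm /project_segment interp_pt => /pt_inj[[EA _ _] _]; lra.
Qed.

(** On a rim edge the coordinate at c is half the parameter; so this is twice the coordinate at c of
    the strip edge at [rim_depth]. *)
Definition rim_param g e c : R := 2 * ((1 - t0) * (if twisted g e then 1 / 2 - E / 4 else 0)
  + t0 * (1 - beta g (sg R c))).

Lemma rim_param_bounds g e c : 0 < rim_param g e c < 1.
Proof.
have E0 := eps_gt0 Y; have E1 := eps_small Y.
have [h0 h1 h2] := rim_depth_bounds; rewrite /rim_param; have := sg_beta g (c).
move: (beta _ _) => B HB; have p1 : 0 < t0 * (1 - B) by apply: mulr_gt0; lra.
have p2 : t0 * (1 - B) < t0 * 1 by rewrite ltr_pM2l //; lra.
case: ifP => _; last by lra.
have -> : (1 - t0) * (1 / 2 - E / 4) = (1 - t0) * 1 - 1 / 2 by lra.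
have p3 : t0 * (1 - B) <= t0 * (4 / 10) by rewrite ler_pM2l //; lra.
by lra.
Qed.

Lemma arm_rim_meet g e b c n j e' t t' : unit_interval t -> unit_interval t' ->
  interp (project_segment (over_edge false (inr (g, e)) b c)) t =
  interp (project_segment (under_edge true (inl (n, j, e')))) t' ->
  [/\ lev n = lev (nd g e), j = col g, e' = e, t = t0 & t' = rim_param g e c].
Proof.
have E0 := eps_gt0 Y; have E1 := eps_small Y.
move=> /andP[h1 h2] /andP[h1' h2']; rewrite over_arm under_rim /project_segment !interp_pt.
have [r0 r1 r2] := rim_depth_bounds; have := sg_beta g (c).
rewrite /rim_param; move: (beta _ _) => B HB.
move=> /pt_inj[[EA EB EC] [Ei Ej Ek]].
have Et : t = t0.
  have : (t - t0) * (1 / 2 + E / 4) = 0 by lra.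
  by move/eqP; rewrite mulf_eq0 => /orP[/eqP|/eqP]; lra.
rewrite Et in EA EB EC Ei Ej Ek *.
have pB : 0 < t0 * B by apply: mulr_gt0; lra.
have pC : 0 < t0 * (1 - B) by apply: mulr_gt0; lra.
have pq : 0 <= (1 - t0) * (1 / 2 - E / 4) by apply: mulr_ge0; lra.
have {}Ei : lev (nd g e) = lev n by apply: Ei; lra.
have {}Ej : col g = j by apply: Ej; case: (twisted g e) EB => EB; lra.
have {}Ek : kap g = opp_spoke n j e' by apply: Ek; case: (twisted g e) EC => EC; lra.
split=> //; last by lra.
apply: (@opp_spoke_inj _ _ n j); rewrite -Ek (kapE _ e) Ej Ei.
by [].
Qed.

Lemma arm_rim_cross g e b c n : lev n = lev (nd g e) ->
  interp (project_segment (over_edge false (inr (g, e)) b c)) t0 =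
  interp (project_segment (under_edge true (inl (n, col g, e)))) (rim_param g e c).
Proof.
have E0 := eps_gt0 Y; have E1 := eps_small Y.
move=> El; rewrite over_arm under_rim /project_segment !interp_pt.
have [r0 r1 r2] := rim_depth_bounds; have := sg_beta g (c).
rewrite /opp_spoke El -(kapE _ e) /rim_param; move: (beta _ _) => B HB.
by congr (pt _ _ _ _ _ _); case: ifP => _; lra.
Qed.

Lemma arm_rim_form g e b c n : lev n = lev (nd g e) ->
  segment_form (project_segment (over_edge false (inr (g, e)) b c))
    (project_segment (under_edge true (inl (n, col g, e)))) =
  (if e then -1 else 1) * (1 / 4 + E / 8).
Proof.
move=> El; rewrite over_arm under_rim /project_segment /segment_form /= !pt_sub.
rewrite /opp_spoke El -(kapE _ e) frame_pt (port_sign_cell (kapE g e)).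
move: (beta _ _) (E) => B x.
by case: (twisted g e); case: (e); rewrite ?rmorphN rmorph1; lra.
Qed.

Lemma interp_height (s : tpoint R Sg * tpoint R Sg) (t : R) :
  (interp s t).2 = (1 - t) * s.1.2 + t * s.2.2.
Proof. by []. Qed.

(** At [rim_depth] the slope of the strip has changed its height by at most eps/2. Against another
    disc the gap of 4 eps decides, against its own disc the sheet [b]. *)
Lemma arm_rim_height g e b n : lev n = lev (nd g e) ->
  ((interp (under_edge true (inl (n, col g, e))) (rim_param g e (b (+) twisted g e))).2 <
   (interp (over_edge false (inr (g, e)) b (b (+) twisted g e)) t0).2) =
  if n == nd g e then b else hN Y n < hN Y (nd g e).
Proof.
have E0 := eps_gt0 Y; have E1 := eps_small Y.
move=> El; rewrite over_arm under_rim !interp_height /=.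
have [r0 r1 r2] := rim_depth_bounds; have hd := height_dist Y (nd g e) g.
have pd : `|t0 * (hG Y g - hN Y (nd g e))| <= E / 2.
  rewrite normrM gtr0_norm //; apply: le_trans r1.
  by rewrite -[leRHS]mulr1 ler_wpM2l // ltW.
have Esg c : `|E * sg R c| <= E by rewrite normrM gtr0_norm // /sg; case: c; rewrite ?normrN normr1 mulr1.
have tE c : `|t0 * (E * sg R c)| <= E / 2.
  rewrite normrM gtr0_norm //; apply: le_trans (_ : t0 * 1 <= _); last by rewrite mulr1.
  by apply: ler_wpM2l; [exact: ltW|apply: le_trans (Esg c) _; lra].
have p1 := Esg b; have p2 := tE b; have p3 := tE (b (+) twisted g e).
rewrite !ler_norml in pd p1 p2 p3.
have [r3 r4] := (rim_param_bounds g e (b (+) twisted g e), sg_beta g (b (+) twisted g e)).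
have nr : n != nd g e \/ twisted g e = false -> raised n (col g) = false.
  case: (boolP (twisted g e)) => [tge [nn|//]|/negbTE ut _]; last exact: untwisted_not_raised Y _ _ _ El ut.
  by apply/negP => /(raised_unique Y)/(_ (esym El)) En; rewrite En eqxx in nn.
case: (eqVneq n (nd g e)) => [En|nn].
  rewrite /rim_param; case: (boolP (twisted g e)) => [tge|/negbTE ut].
    have [tg Ne] := andP tge; have Ee : e = false by case: (e) Ne.
    have hT : hG Y g = hN Y (nd g e) + 80 / 3 * E by rewrite Ee; apply: tw_height.
    have -> : raised n (col g) by rewrite En Ee (raised_gate g : raised (nd g false) _ = _).
    rewrite En hT /beta tg addbT.
    have -> : (1 - t0) * (1 / 2 - E / 4) = (1 - t0) - 1 / 2 by lra.
    move: r0 r1 r2; move: t0 (hN Y (nd g e)) => t1 h r0 r1 r2; case: (b); rewrite /sg /=.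
      by apply/idP; lra.
    by apply/negbTE; rewrite -leNgt; lra.
  rewrite nr ?En; last by right.
  rewrite addbF; rewrite ut addbF in p3; case: (b) p1 p3 => p1 p3; rewrite /sg /= in p1 p3 *.
    by apply/idP; lra.
  by apply/negbTE; rewrite -leNgt; lra.
have := hN_sep Y El nn; rewrite nr; last by left.
case: (ltrP (hN Y n) (hN Y (nd g e))) => hh sep.
  by apply/idP; lra.
by apply/negbTE; rewrite -leNgt; lra.
Qed.
End Crossings.

(** * Signs of all crossings *)

Section Pairing.
Variables (R : realType) (m : nat) (D : diagram m) (Y : layout R D).
Notation Zm := 'I_m.+2.
Notation Nd := (node D).
Notation Gt := (gate D).
Notation fv := (fvertex m Nd Gt).
Notation Sg := (tripartite_surface m).
Notation E := (eps Y).
Implicit Types (n : Nd) (g : Gt) (j k : Zm) (e b c : bool) (t : R) (v : fv) (w : Gt -> int).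

(** Crossing of the two rails at a twisted end, the lifted one from [Pc] to [Rb] and the other from
    [Pb] to [Rc]: solution of the linear equations in barycentric coordinates. *)
Definition twist_param g c : R := (3 / 2 + E / 4) / (3 * beta g (sg R c) + (1 / 2 + E / 4)).
Definition twist_param' g c : R := 1 - 2 * (1 / 2 + E / 4) * (1 - twist_param g c).

Lemma twist_param_bounds g c : [/\ 1 / 2 <= twist_param g c <= 2 / 3, 0 < twist_param' g c < 1
  & twist_param g c * (3 * beta g (sg R c) + (1 / 2 + E / 4)) = 3 / 2 + E / 4].
Proof.
have E0 := eps_gt0 Y; have E1 := eps_small Y; have := sg_beta R g c.
rewrite /twist_param' /twist_param; move: (beta _ _) (E) E0 E1 => B x x0 x1 HB.
have d0 : 0 < 3 * B + (1 / 2 + x / 4) by lra.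
set T := (3 / 2 + x / 4) / _; have ET : T * (3 * B + (1 / 2 + x / 4)) = 3 / 2 + x / 4.
  by rewrite /T divfK // gt_eqF.
have T1 : 1 / 2 <= T by rewrite /T ler_pdivlMr //; lra.
have T2 : T <= 2 / 3 by rewrite /T ler_pdivrMr //; lra.
have xT : 0 <= x * T <= x * 1 by rewrite mulr_ge0 ?ler_pM2l //; lra.
by split=> //; lra.
Qed.

(** Without twists the lifted edge has its coordinate at b above that at c, and the other edge the
    reverse. A twisted and an untwisted end cannot share a triangle, by [untwisted_not_raised]. Only
    the self crossing of a twisted strip remains. *)
Lemma arm_arm_meet g e b c g' e' t t' : unit_interval t -> unit_interval t' ->
  interp (project_segment (over_edge Y false (inr (g, e)) b c)) t =
  interp (project_segment (under_edge Y true (inr (g', e')))) t' ->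
  [/\ g' = g, e' = e, twisted g e, t = twist_param g c & t' = twist_param' g c].
Proof.
have E0 := eps_gt0 Y; have E1 := eps_small Y.
move=> /andP[h1 h2] /andP[h1' h2']; rewrite over_arm under_arm /project_segment !interp_pt.
have [_ _ +] := twist_param_bounds g c; have := sg_beta R g c.
rewrite /twist_param'; move: (twist_param g c) (beta g _) => T B HB ET.
move=> /pt_inj[[EA EB EC] [Ei Ej Ek]].
have t1 : t < 1.
  rewrite lt_neqAle h2 andbT; apply/eqP => t1; rewrite t1 in EA EB.
  have E' : t' = 1 by lra.
  by rewrite E' in EB; lra.
have {}Ei : lev (nd g e) = lev (nd g' e').
  by apply: Ei; rewrite mulr0 addr0 gt_eqF // mulr_gt0 //; lra.
have p1 : 0 < (1 - t) * (1 / 2 - E / 4) by apply: mulr_gt0; lra.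
have p2 : 0 <= t * B by apply: mulr_ge0; lra.
have p3 : 0 <= t * (2 * B - 1) by apply: mulr_ge0; lra.
have [[tge ut]|[ut tge']|tge] : [\/ twisted g e = false /\ twisted g' e' = false,
    twisted g e = false /\ twisted g' e' | twisted g e].
- by case: (twisted g e); case: (twisted g' e'); [constructor 3|constructor 3|constructor 2|constructor 1].
- by rewrite tge ut in EB EC; lra.
- rewrite ut in EB; have {}Ej : col g = col g' by apply: Ej; rewrite ut; lra.
  have [tg' Ne] := andP tge'; have Ee : e' = false by case: (e') Ne.
  rewrite Ee in Ei; have := @untwisted_not_raised _ _ _ Y (nd g' false) g e (esym Ei) ut.
  by rewrite Ej (raised_gate g' : raised (nd g' false) _ = _) tg'.
have [tg Ne] := andP tge; have Ee : e = false by case: (e) Ne.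
have t0 : 0 < t.
  rewrite lt_neqAle h1 andbT; apply/eqP => t0; rewrite -t0 in EA.
  by lra.
have {}Ej : col g = col g' by apply: Ej; rewrite tge mulr0 add0r gt_eqF // mulr_gt0 //; lra.
case: (boolP (twisted g' e')) => [tge1|/negbTE ut]; last first.
  have := @untwisted_not_raised _ _ _ Y (nd g e) g' e' Ei ut.
  by rewrite -Ej Ee (raised_gate g : raised (nd g false) _ = _) tg.
have [tg' Ne'] := andP tge1; have Ee' : e' = false by case: (e') Ne'.
have Eg : g' = g by apply: port_inj => //; rewrite Ee Ee' in Ei.
rewrite Eg Ee Ee' in tge tge1 EB *; rewrite tge in EB.
have Et : t = T.
  have : (t - T) * (3 * B + (1 / 2 + E / 4)) = 0 by lra.
  by move/eqP; rewrite mulf_eq0 => /orP[/eqP|/eqP]; lra.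
by split=> //; rewrite -Et; lra.
Qed.

Lemma arm_arm_cross g e b c : twisted g e ->
  interp (project_segment (over_edge Y false (inr (g, e)) b c)) (twist_param g c) =
  interp (project_segment (under_edge Y true (inr (g, e)))) (twist_param' g c).
Proof.
move=> tge; rewrite over_arm under_arm /project_segment !interp_pt tge.
have [_ _ +] := twist_param_bounds g c; rewrite /twist_param'.
move: (twist_param g c) (beta g _) => T B ET.
by congr (pt _ _ _ _ _ _); lra.
Qed.

Lemma arm_arm_form g e b c : twisted g e ->
  0 < segment_form (project_segment (over_edge Y false (inr (g, e)) b c))
    (project_segment (under_edge Y true (inr (g, e)))).
Proof.
have E0 := eps_gt0 Y; have E1 := eps_small Y; have := sg_beta R g c.
move=> HB tge; have [tg Ne] := andP tge; have Ee : e = false by case: (e) Ne.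
rewrite over_arm under_arm /project_segment /segment_form /= !pt_sub.
rewrite frame_pt (port_sign_cell (kapE g e)) tge {1}Ee rmorph1 mul1r.
move: (beta g _) HB => B HB; have p : 0 <= E * B <= E * 1 by rewrite mulr_ge0 ?ler_pM2l //; lra.
by lra.
Qed.

(** Both lifts of the edge from [Pc] stay below the edge from the raised corner [Pb]. The self
    crossing therefore counts in the intersection number only, and a half twist contributes -1. *)
Lemma arm_arm_height g e b c : twisted g e -> c = b (+) twisted g e ->
  (interp (over_edge Y false (inr (g, e)) b c) (twist_param g c)).2 <=
  (interp (under_edge Y true (inr (g, e))) (twist_param' g c)).2.
Proof.
have E0 := eps_gt0 Y; have E1 := eps_small Y.
move=> tge Ec; have [tg Ne] := andP tge; have Ee : e = false by case: (e) Ne.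
have hT : hG Y g = hN Y (nd g e) + 80 / 3 * E by rewrite Ee; apply: tw_height.
have [T1 T2 _] := twist_param_bounds g c.
rewrite over_arm under_arm !interp_height /= tge hT; move: (twist_param g c) (twist_param' g c) T1 T2 => T T' T1 T2.
have p1 : E * (1 / 2) <= E * T <= E * (2 / 3) by rewrite !ler_pM2l //; lra.
have p2 : 0 < E * T' by apply: mulr_gt0; lra.
by rewrite Ec tge addbT; case: (b); rewrite /sg /=; lra.
Qed.

Lemma rim_unit g e c : unit_interval (rim_depth Y) /\ unit_interval (rim_param Y g e c).
Proof.
have E0 := eps_gt0 Y; have E1 := eps_small Y; have [r0 r1 r2] := rim_depth_bounds Y.
by have r3 := rim_param_bounds Y g e c; rewrite /unit_interval; lra.
Qed.

Lemma twist_unit g c : unit_interval (twist_param g c) /\ unit_interval (twist_param' g c).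
Proof. by have [r1 r2 _] := twist_param_bounds g c; rewrite /unit_interval; lra. Qed.

(* Both lifts of a strip pass on the same side of another disc of the same level,
   which gives 2 or 0, while one lift passes over its own disc; the intersection
   number takes 1 away. *)
Definition side n n' : int := if n == n' then 0 else if hN Y n < hN Y n' then 1 else -1.

Definition cell_sign e : int := if e then -1 else 1.

Definition same_cell n j e' g e := [&& lev n == lev (nd g e), j == col g & e' == e].

Lemma arm_rim_cross_sign g e b c n j e' :
  crossing_sign (project_segment (over_edge Y false (inr (g, e)) b c))
    (project_segment (under_edge Y true (inl (n, j, e')))) =
  cell_sign e *+ same_cell n j e' g e.
Proof.
have E0 := eps_gt0 Y; rewrite /crossing_sign /same_cell; case: asboolP => [[t [t' [ht ht' M]]]|no].
  have [El Ej Ee _ _] := arm_rim_meet ht ht' M; rewrite El Ej Ee !eqxx mulr1n arm_rim_form //.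
  case: (e); rewrite ?mulN1r ?sgzN ?mul1r gtr0_sgz //; lra.
case: and3P => // -[/eqP El /eqP Ej /eqP Ee]; case: no.
have [u0 u1] := rim_unit g e c.
exists (rim_depth Y), (rim_param Y g e c); rewrite Ej Ee; split=> //.
exact: arm_rim_cross.
Qed.

Lemma arm_rim_over_sign g e b n j e' :
  over_sign (over_edge Y false (inr (g, e)) b (b (+) twisted g e)) (under_edge Y true (inl (n, j, e'))) =
  (cell_sign e *+ (if n == nd g e then b else hN Y n < hN Y (nd g e))) *+ same_cell n j e' g e.
Proof.
have E0 := eps_gt0 Y; rewrite /over_sign /same_cell; set c := b (+) twisted g e.
case: asboolP => [[t [t' [ht ht' M H]]]|no].
  have [El Ej Ee Et Et'] := arm_rim_meet ht ht' M.
  rewrite Ej Ee Et Et' (arm_rim_height Y b El) in H *; rewrite El H !eqxx mulr1n arm_rim_form //.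
  case: (e); rewrite ?mulN1r ?sgzN ?mul1r gtr0_sgz //; lra.
case: and3P => [[/eqP El /eqP Ej /eqP Ee]|//]; case: ifP => [En|nn].
  rewrite mulr1n; case Eb: (b) => //; case: no.
  have [u0 u1] := rim_unit g e c.
  exists (rim_depth Y), (rim_param Y g e c); rewrite Ej Ee; split=> //.
    exact: arm_rim_cross.
  by rewrite (arm_rim_height Y b El) En Eb.
rewrite mulr1n; case hh: (_ < _) => //; case: no.
have [u0 u1] := rim_unit g e c.
exists (rim_depth Y), (rim_param Y g e c); rewrite Ej Ee; split=> //.
  exact: arm_rim_cross.
by rewrite (arm_rim_height Y b El) nn hh.
Qed.

Lemma arm_arm_cross_sign g e b c g' e' :
  crossing_sign (project_segment (over_edge Y false (inr (g, e)) b c))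
    (project_segment (under_edge Y true (inr (g', e')))) =
  [&& g' == g, e' == e & twisted g e]%:Z.
Proof.
rewrite /crossing_sign; case: asboolP => [[t [t' [ht ht' M]]]|no].
  have [Eg Ee tge _ _] := arm_arm_meet ht ht' M; rewrite Eg Ee !eqxx tge /=.
  by rewrite gtr0_sgz // arm_arm_form.
case: and3P => // -[/eqP Eg /eqP Ee tge]; case: no.
have [u0 u1] := twist_unit g c.
exists (twist_param g c), (twist_param' g c); rewrite Eg Ee; split=> //.
exact: arm_arm_cross.
Qed.

Lemma arm_arm_over_sign g e b g' e' :
  over_sign (over_edge Y false (inr (g, e)) b (b (+) twisted g e)) (under_edge Y true (inr (g', e'))) = 0.
Proof.
rewrite /over_sign; case: asboolP => // -[t [t' [ht ht' M H]]].
have [Eg Ee tge Et Et'] := arm_arm_meet ht ht' M.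
by move: H; rewrite Eg Ee Et Et' ltNge (@arm_arm_height g e b).
Qed.

Lemma rim_signs n j e b c x : raised n j = false ->
  crossing_sign (project_segment (over_edge Y false (inl (n, j, e)) b c))
    (project_segment (under_edge Y true x)) = 0 /\
  over_sign (over_edge Y false (inl (n, j, e)) b c) (under_edge Y true x) = 0.
Proof.
move=> nr; have no t t' := @over_rim_disjoint _ _ _ Y n j e b c x t t' nr.
rewrite /crossing_sign /over_sign; split; case: asboolP => //.
  by case=> t [t' [ht ht' M]]; case: (no t t').
by case=> t [t' [ht ht' M _]]; case: (no t t').
Qed.

Lemma over_under_transverse (x y : fedge D) b c :
  (if x is inl (n, j, _) then raised n j = false else True) ->
  transverse_segments (project_segment (over_edge Y false x b c)) (project_segment (under_edge Y true y)).
Proof.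
have E0 := eps_gt0 Y; have E1 := eps_small Y.
case: x => [[[n j] e]|[g e]] nr t t' ht ht' M.
  by case: (over_rim_disjoint nr ht ht' M).
case: y M => [[[n j] e']|[g' e']] M.
  have [El Ej Ee -> ->] := arm_rim_meet ht ht' M; rewrite Ej Ee.
  have [r0 r1 r2] := rim_depth_bounds Y; have r3 := rim_param_bounds Y g e c.
  split; [lra|lra|rewrite arm_rim_form // mulf_neq0 //]; first by case: (e); rewrite ?oppr_eq0 oner_eq0.
  by rewrite gt_eqF //; lra.
have [Eg Ee tge -> ->] := arm_arm_meet ht ht' M; rewrite Eg Ee.
have [r1 r2 _] := twist_param_bounds g c.
split; [lra|lra|by rewrite gt_eqF // arm_arm_form].
Qed.
End Pairing.

(** * The pairing of flows *)

(** An edge has two lifts, indexed by the sheet of its source. Symmetry of [tsign] on the listed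
    edges makes the lift of a reversed edge the reversed lift. *)
Lemma transfer_chain (R : realType) (S : oriented_surface) (F : embedded_surface R S)
    (N : tubular_neighborhood F) (I : finType) (k : I -> int) (s t : I -> fvert F)
    (c : fvert F -> fvert F -> int) :
  (forall u v, c u v = \sum_i k i * edge_chain (s i) (t i) u v) ->
  (forall i, tsign N (t i) (s i) = tsign N (s i) (t i)) ->
  forall p q, transfer N c p q = \sum_(x : I * bool) k x.1 *
    edge_chain (s x.1, x.2) (t x.1, x.2 (+) tsign N (s x.1) (t x.1)) p q.
Proof.
move=> cE sym [u b] [v b']; rewrite /transfer /= cE sum_pair_bool.
have E i : edge_chain (s i, true) (t i, true (+) tsign N (s i) (t i)) (u, b) (v, b') +
   edge_chain (s i, false) (t i, false (+) tsign N (s i) (t i)) (u, b) (v, b') =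
   if b' == b (+) tsign N u v then edge_chain (s i) (t i) u v else 0.
  rewrite /edge_chain !xpair_eqE.
  have : (s i == u) && (t i == v) -> tsign N u v = tsign N (s i) (t i).
    by case/andP=> /eqP-> /eqP->.
  have : (s i == v) && (t i == u) -> tsign N u v = tsign N (s i) (t i).
    by rewrite -sym => /andP[/eqP-> /eqP->].
  move: (tsign N u v) (tsign N (s i) (t i)) => x y.
  case: (s i == u); case: (t i == v); case: (s i == v); case: (t i == u);
  case: x; case: y; case: b; case: b' => //= H1 H2.
  all: try by [have := H1 isT|have := H2 isT].
transitivity (\sum_i k i * (if b' == b (+) tsign N u v then edge_chain (s i) (t i) u v else 0));
  last by apply: eq_bigr => i _; rewrite /= -mulrDr E.
by case: ifP => _ //; rewrite big1 // => i _; rewrite mulr0.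
Qed.

Section GordonLitherland.
Variables (R : realType) (m : nat) (D : diagram m) (Y : layout R D).
Notation Zm := 'I_m.+2.
Notation Nd := (node D).
Notation Gt := (gate D).
Notation fv := (fvertex m Nd Gt).
Notation Sg := (tripartite_surface m).
Notation E := (eps Y).
Implicit Types (n : Nd) (g : Gt) (j k : Zm) (e b c : bool) (t : R) (v : fv) (w : Gt -> int).

Definition arm_pairing w w' g e : int :=
  out w g e * \sum_(n | lev n == lev (nd g e)) side Y n (nd g e) * rim_flow true w' n (col g) e.

Definition pairing w w' : int :=
  \sum_g (arm_pairing w w' g true + arm_pairing w w' g false - w g * w' g *+ tw g).

(** Linking contribution of the two lifts of [x] over [y], minus the intersection contribution, read
    off the projection of the sheet true. *)
Definition signed_crossing (x y : fedge D) : int :=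
  let c b := b (+) twisted_edge (fsource false x) (ftarget false x) in
  over_sign (over_edge Y false x true (c true)) (under_edge Y true y)
  + over_sign (over_edge Y false x false (c false)) (under_edge Y true y)
  - crossing_sign (project_segment (over_edge Y false x true true)) (project_segment (under_edge Y true y)).

Lemma arm_signed_crossings w' g e :
  \sum_y fcoef true w' y * signed_crossing (inr (g, e)) y =
  \sum_(n | lev n == lev (nd g e)) side Y n (nd g e) * rim_flow true w' n (col g) e
  - out w' g e *+ twisted g e.
Proof.
have rimE n j e' : signed_crossing (inr (g, e)) (inl (n, j, e')) =
    (cell_sign e * side Y n (nd g e)) *+ same_cell n j e' g e.
  rewrite /signed_crossing /= twisted_att !arm_rim_over_sign arm_rim_cross_sign /side.
  by case: (same_cell _ _ _ _ _); rewrite ?mulr0n ?mulr1n //; case: ifP => _; [|case: ifP => _];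
    rewrite /= ?mulr0n ?mulr1n; ring.
have armE g' e' : signed_crossing (inr (g, e)) (inr (g', e')) =
    - [&& g' == g, e' == e & twisted g e]%:Z.
  by rewrite /signed_crossing /= twisted_att !arm_arm_over_sign arm_arm_cross_sign ?addr0 ?add0r ?sub0r.
rewrite sum_fedge; congr (_ + _).
  rewrite [RHS]big_mkcond; apply: eq_bigr => n _.
  rewrite (bigD1 (col g)) //= big1 ?addr0 => [|j /negPf jg]; last first.
    by rewrite !rimE /same_cell jg !andbF !mulr0n !mulr0 addr0.
  rewrite !rimE /same_cell eqxx; case: (lev n == _); last by rewrite /= !mulr0n !mulr0 addr0.
  move: (side _ _ _) => x; case: (e); rewrite /fcoef /cell_sign /= ?mulr0n ?mulr1n.
    by move: (rim_flow _ _ _ _ true) => y; ring.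
  by move: (rim_flow _ _ _ _ false) => y; ring.
rewrite (bigD1 g) //= big1 ?addr0 => [|g' /negPf gg]; last first.
  by rewrite !armE gg /= !oppr0 !mulr0 addr0.
by rewrite !armE eqxx; case: (e) => /=; case: (twisted _ _); rewrite /= ?mulr0n ?mulr1n; ring.
Qed.

Lemma support_pt_eq i j k (A B C A' B' C' : R) : (A == 0) = (A' == 0) -> (B == 0) = (B' == 0) ->
  (C == 0) = (C' == 0) -> Defs.support (pt i j k A B C) = Defs.support (pt i j k A' B' C').
Proof.
move=> EA EB EC; apply/setP => u; rewrite !inE !ffunE; congr (~~ _).
by case: u => l; case: (_ == _ :> 'I_m.+2); rewrite ?mulr1n ?mulr0n ?eqxx.
Qed.

Lemma position_support v t : -1 <= t <= 1 ->
  Defs.support (pos Y v t).1 = Defs.support (fposition Y v).1.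
Proof.
have E0 := eps_gt0 Y; have E1 := eps_small Y.
have I0 : -1 <= (0 : R) <= 1 by lra.
have nz (x : R) : 0 < x -> (x == 0) = false by move=> h; rewrite gt_eqF.
rewrite /fposition; case: v => [n|n j|n k|g|g] t1 //=.
- have h := radius_b_bd Y n j t1; have h0 := radius_b_bd Y n j I0.
  by apply: support_pt_eq => //; rewrite !nz //; lra.
- have h := radius_bd Y t1; have h0 := radius_bd Y I0.
  by apply: support_pt_eq => //; rewrite !nz //; lra.
- have h := beta_bd g t1; have h0 := beta_bd g I0.
  by apply: support_pt_eq => //; rewrite !nz //; lra.
Qed.

(** The hypothesis on raised vertices keeps the first cycle off the raised corners: there the lift
    at t = -1 has a larger radius than the rim, and would not be disjoint from it in projection. *)
Theorem gordon_litherland_flow w w' : flow w -> flow w' ->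
  (forall n j e, raised n j -> rim_flow false w n j e = 0) ->
  gordon_litherland (F := diagram_surface Y) (flow_chain false w) (flow_chain false w') (pairing w w').
Proof.
move=> fw fw' flat.
have cyc s : cycle1 (fcomplex D) (flow_chain s w) by apply: flow_chain_cycle.
have cyc' s : cycle1 (fcomplex D) (flow_chain s w') by apply: flow_chain_cycle.
have complexS : forall s t : {set svert Sg}, s \in scplx Sg -> t \subset s -> t != set0 -> t \in scplx Sg.
  by have [[[_ _ h] _ _ _] _ _ _] := surface_closed m.
(* Displacing the first cycle to the positive sheet makes it transverse to the second one without
   changing its supports, hence without changing its class in Sigma. *)
pose fp v : tpoint R Sg := tposition Y (v, true).
have fpin v : in_surface (fp v).1 by have [] := tposition_thickened Y (v, true).
have fin v : in_surface (fposition Y v).1 by have [] := fposition_thickened Y v.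
have fpprism s : s \in fcomplex D -> exists2 r, r \in scplx Sg & forall v, v \in s -> in_simplex r (fp v).1.
  by move=> /(face_in_prism Y)[r rS sub]; exists r => // v; apply: sub.
pose v0 : svert Sg := SA 0.
pose J' := project (realize fp (flow_chain false w)).
pose L' := project (realize (fposition Y) (flow_chain true w')).
have TS x : tsign (diagram_tube Y) (ftarget false x) (fsource false x) =
    tsign (diagram_tube Y) (fsource false x) (ftarget false x).
  case: x => [[[n j] e] //|[g e]]; rewrite /= /att /rim.
  by case: (_ (+) _).
have notraised x : fcoef false w x != 0 -> if x is inl (n, j, _) then raised n j = false else True.
  case: x => [[[n j] e]|//] nz; apply/negP => /(flat n j e) f0; case/negP: nz.
  by rewrite /= f0; case: (e).
have cE u v : flow_chain false w u v = \sum_x fcoef false w x * edge_chain (fsource false x) (ftarget false x) u v by [].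
have c'E u v : flow_chain true w' u v = \sum_x fcoef true w' x * edge_chain (fsource true x) (ftarget true x) u v by [].
have tE := @transfer_chain R Sg (diagram_surface Y) (diagram_tube Y) _ (fcoef false w)
   (fsource false) (ftarget false) (flow_chain false w) cE TS.
exists (diagram_tube Y), (flow_chain false w), (flow_chain true w'), (intersection_count J' L') => /=.
split.
- by split.
- by split; [apply: homologous_refl|apply: flow_chain_sides].
- apply: (transverse_edges tE c'E) => -[x b] y /= nx _.
  exact: (@over_under_transverse _ _ _ Y x y b _ (notraised x nx)).
- exists J', L'; split=> //.
  + split; [exact: (polygonal_realize (cyc false))|apply: (polygonal_realize (cyc' true)) => //].
    exact: fposition_prism.
  + split.
      apply: (homologous_same_support v0) => [u v|v]; first by have [[]] := cyc false.
      by apply: position_support; rewrite /sg /=; lra.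
    apply: (homologous_pushforward v0 complexS (K := fcomplex D)) => //.
    * by move=> u v; have [[]] := cyc' true.
    * by move=> u v; have [[]] := cyc' false.
    * exact: fposition_prism.
    exact: flow_chain_sides.
  apply: (transverse_edges cE c'E) => x y /= nx _.
  exact: (@over_under_transverse _ _ _ Y x y true true (notraised x nx)).
rewrite (linking_edges _ _ tE c'E) (intersection_edges _ _ cE c'E) sum_pair_bool -sumrB.
transitivity (\sum_x fcoef false w x * \sum_y fcoef true w' y * signed_crossing x y); last first.
  apply: eq_bigr => x _; rewrite -big_split -sumrB mulr_sumr; apply: eq_bigr => y _ /=.
  by rewrite /signed_crossing /over_edge /under_edge; ring.
rewrite sum_fedge big1 ?add0r => [|n _]; last first.
  rewrite big1 // => j _; suff Z e : fcoef false w (inl (n, j, e)) *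
      \sum_y fcoef true w' y * signed_crossing (inl (n, j, e)) y = 0 by rewrite !Z addr0.
  have [->|/notraised nr] := eqVneq (fcoef false w (inl (n, j, e))) 0; first by rewrite mul0r.
  rewrite big1 ?mulr0 // => y _; rewrite /signed_crossing.
  have [-> _] := rim_signs Y e true true y nr.
  have [_ ->] := rim_signs Y e true (true (+) twisted_edge (fsource false (inl (n, j, e))) (ftarget false (inl (n, j, e)))) y nr.
  have [_ ->] := rim_signs Y e false (false (+) twisted_edge (fsource false (inl (n, j, e))) (ftarget false (inl (n, j, e)))) y nr.
  by rewrite addr0 subr0 mulr0.
apply: eq_bigr => g _; rewrite !arm_signed_crossings /arm_pairing /fcoef.
move: (\sum_(n | _) _) (\sum_(n | _) _) => x y; rewrite /twisted /out andbF andbT.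
by case: (tw g); rewrite ?mulr0n ?mulr1n; ring.
Qed.
End GordonLitherland.

(** * Braids *)

Section PlainNodes.
Variables (m : nat) (D : diagram m).
Notation Zm := 'I_m.+2.
Implicit Types (n : node D) (g : gate D) (j k : Zm) (e : bool) (w : gate D -> int).

Lemma sum_prefix_delta (a j : Zm) (x : int) :
  \sum_(i < m.+2 | (i < j)%N) x *+ (a == i) = x *+ (a < j)%N.
Proof.
rewrite big_mkcond (bigD1 a) //= eqxx mulr1n big1 ?addr0; first by case: ifP.
by move=> i /negPf ia; rewrite eq_sym ia mulr0n if_same.
Qed.

(** Slot of the corner [Pc] of the strip in the cyclic order of the rim. A strip entering the disc
    covers the edge before [Pb n (col g)], whence the shift by one. *)
Definition arm_slot g e : Zm := if e then col g - 1 else col g.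

Lemma arm_slotE g e : kap g = opp_spoke (nd g e) (arm_slot g e) false.
Proof. by rewrite (kapE g e) /arm_slot /opp_spoke; case: e; rewrite /= ?mulr0n ?mulr1n; ring. Qed.

Lemma rim_flow_plain w n j e : (forall g e', nd g e' = n -> twisted g e' = false) ->
  rim_flow true w n j e = - \sum_g (out w g true *+ ((upp g == n) && (arm_slot g true < j)%N)
                                    + out w g false *+ ((low g == n) && (arm_slot g false < j)%N)).
Proof.
move=> plain.
have aPb g e' i : (att true g e' == Pb n i) = false.
  rewrite /att /rim -/(twisted g e'); case: (boolP (twisted g e')) => tge /=.
    rewrite fvertex_eqE; apply/negbTE; rewrite negb_and; apply/orP; left.
    by apply/eqP => En; rewrite (plain _ _ En) in tge.
  by rewrite fvertex_eqE.
have aPc g e' i : (att true g e' == Pc n (opp_spoke n i false)) =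
    (nd g e' == n) && (arm_slot g e' == i).
  have [En|nn] := eqVneq (nd g e') n; last first.
    by apply/eqP; rewrite /att /rim; case: ifP => _ // [En _]; rewrite En eqxx in nn.
  rewrite /att /rim -/(twisted g e') (plain _ _ En) /= fvertex_eqE En eqxx (arm_slotE g e') En.
  exact: (inj_eq (inv_inj (opp_spokeK n false))).
have iPb i : inflow true w (Pb n i) = 0.
  by rewrite /inflow big1 // => g _; rewrite !aPb !mulr0n addr0.
rewrite /rim_flow iPb if_same subr0; congr (- _).
under eq_bigr do rewrite /rim_inflow iPb add0r /inflow; rewrite exchange_big; apply: eq_bigr => g _ /=.
rewrite big_split /=; congr (_ + _); under eq_bigr do rewrite aPc.
  by rewrite /=; case: (upp g == n) => /=; [exact: sum_prefix_delta|rewrite big1].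
by rewrite /=; case: (low g == n) => /=; [exact: sum_prefix_delta|rewrite big1].
Qed.
End PlainNodes.

Lemma inord_next (m i : nat) : (i.+1 < m.+2)%N -> inord i.+1 = inord i + 1 :> 'I_m.+2.
Proof.
move=> iN; have h2 : (i < m.+2)%N by apply: ltn_trans iN.
by apply: val_inj; rewrite /= !inordK // modnDmr addn1 modn_small.
Qed.

Section Braid.
Variables (n : nat).
Definition strand : finType := ('I_n * bool)%type.
Implicit Types (x y : strand) (s : 'I_n).
Definition rank x : nat := x.1.*2 + x.2.
(** A loop runs up one of its strands and down the other. *)
Definition ssign x : int := if x.2 then -1 else 1.

Variables (ops : seq (strand * strand)) (place : strand -> nat) (twx : strand -> bool).
Hypothesis place_inj : injective place.
Hypothesis place_lt : forall x, (place x < n.*2)%N.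

Let N := (size ops).*2.
(** Columns are at most 4 n and levels at most N + 1, so neither wraps around modulo [braid_size] +
    2. *)
Definition braid_size : nat := n.*2.*2 + N.
Let m := braid_size.

Definition braid_node : finType := option ('I_N * strand + 'I_n).
Definition at_level (i : nat) x : braid_node :=
  if i is i'.+1 then
    if insub i' is Some k then Some (inl (k, x)) else Some (inr x.1)
  else None.
Definition level (v : braid_node) : nat :=
  match v with None => 0 | Some (inl (k, _)) => k.+1 | Some (inr _) => N.+1 end.

Lemma at_level_mid i y (k : 'I_N) x :
  (at_level i y == Some (inl (k, x))) = (i == k.+1) && (y == x).
Proof.
case: i => [|i] //=; rewrite eqSS; case: insubP => [k' _ <-|ni] /=.
  by apply/eqP/andP => [[-> ->]|[/eqP/val_inj-> /eqP->]] //; rewrite !eqxx.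
by apply/esym/negbTE; apply: contra ni => /andP[/eqP-> _].
Qed.

Lemma at_level_top i y s : (i <= N.+1)%N ->
  (at_level i y == Some (inr s)) = (i == N.+1) && (y.1 == s).
Proof.
case: i => [|i] //=; rewrite ltnS eqSS => iN; case: insubP => [k' kN ki|ni] /=.
  by apply/esym/negbTE; rewrite negb_and ltn_eqF.
have -> : i = N by apply/eqP; rewrite eqn_leq iN leqNgt.
by rewrite eqxx /=; apply/eqP/eqP => [[->]|->].
Qed.

Lemma at_level_base i y : (at_level i y == None) = (i == 0).
Proof. by case: i => [|i] //=; case: insubP. Qed.

Lemma level_at i x : (i <= N.+1)%N -> level (at_level i x) = i.
Proof.
case: i => [|i] //=; rewrite ltnS => iN; case: insubP => [k' _ <- //|ni] /=.
by congr _.+1; apply/eqP; rewrite eqn_leq iN leqNgt ni.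
Qed.

Lemma level_le (v : braid_node) : (level v <= N.+1)%N.
Proof. by case: v => [[[k x]|s]|] //=; rewrite ltnS ltnW. Qed.

(* Port [2 r + 1] realizes the operation (u, v) = [nth ops r]: u moves to its
   spare column, and v to the column of u. *)
Definition port_column (i : nat) x : nat :=
  if odd i then
    if ohead (drop i./2 ops) is Some (u, v) then
      if x == u then (place u).*2.+2 else if x == v then (place u).*2.+1 else (place x).*2.+1
    else (place x).*2.+1
  else (place x).*2.+1.

Lemma port_column_inj i : injective (port_column i).
Proof.
move=> x y; rewrite /port_column; case: ifP => _; last by move=> /eqP; rewrite eqSS => /eqP/double_inj/place_inj.
case: (ohead _) => [[u v]|]; last by move=> /eqP; rewrite eqSS => /eqP/double_inj/place_inj.
have pu z : z != u -> place z != place u by rewrite (inj_eq place_inj).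
case: (x =P u) => [Ex|/eqP xu]; case: (y =P u) => [Ey|/eqP yu]; first by rewrite Ex Ey.
- by case: ifP => _; lia.
- by case: ifP => _; lia.
case: (x =P v) => [Ex|/eqP xv]; case: (y =P v) => [Ey|/eqP yv]; first by rewrite Ex Ey.
- by have := pu _ yu; lia.
- by have := pu _ xu; lia.
by move=> E; apply: place_inj; lia.
Qed.

Lemma port_column_bounds i x : (0 < port_column i x <= n.*2.*2)%N.
Proof.
have h := place_lt; rewrite /port_column; case: ifP => _; last by have := h x; lia.
case: (ohead _) => [[u v]|]; last by have := h x; lia.
by case: ifP => _; [|case: ifP => _]; have := h x; have := h u; lia.
Qed.

(** Twists are confined to the first port, above the base disc, which is alone in level 0 as
    [layout] requires. *)
Definition braid_diagram : diagram m.
Proof.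
refine (@Diagram m braid_node ('I_N.+1 * strand)%type (fun v => inord (level v))
  (fun g => at_level g.1 g.2) (fun g => at_level g.1.+1 g.2)
  (fun g => inord (port_column g.1 g.2)) (fun g => (g.1 == 0) && twx g.2) _ _).
- move=> [i x] /=; have iN := ltn_ord i.
  by rewrite -/(at_level i.+1 x) !level_at ?inord_next //; rewrite /m /braid_size; lia.
- move=> [i x] [i' x'] /=; have iN := ltn_ord i; have iN' := ltn_ord i'.
  rewrite !level_at; try lia.
  move=> /(congr1 val); rewrite /= !inordK /m /braid_size; try lia.
  move=> /val_inj Ei; rewrite Ei => /(congr1 val); rewrite /= !inordK; try (have := port_column_bounds i' x; have := port_column_bounds i' x'; lia).
  by move=> /port_column_inj ->.
Defined.
End Braid.

(** * Flows on a braid *)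

Section BraidFlows.
Variables (n : nat) (ops : seq (strand n * strand n)) (place : strand n -> nat)
  (twx : strand n -> bool).
Hypothesis place_inj : injective place.
Hypothesis place_lt : forall x, (place x < n.*2)%N.
Notation N := (size ops).*2.
Notation D := (braid_diagram ops twx place_inj place_lt).
Notation m := (braid_size ops).
Notation Zm := 'I_m.+2.
Notation pc := (port_column ops place).
Notation gateD := ('I_N.+1 * strand n)%type.
Implicit Types (x y : strand n) (s : 'I_n) (k : 'I_N) (v : node D) (j : Zm) (e : bool)
  (om : 'I_n -> int) (g : gate D) (w : gate D -> int).

Definition mid_node k x : node D := Some (inl (k, x)).
Definition top_node s : node D := Some (inr s).
Definition base_node : node D := None.
Definition port_gate (i : nat) x : gate D := (inord i, x) : gateD.

Lemma lev_eq v v' : (lev v == lev v') = (level v == level v' :> nat).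
Proof.
apply/eqP/eqP => [/(congr1 val)|E]; last by rewrite /= E.
by have h := level_le v; have h' := level_le v'; rewrite /= !inordK /m /braid_size; lia.
Qed.

Lemma val_col i x : (col (port_gate i x) : nat) = pc (inord i : 'I_N.+1) x.
Proof.
have h := port_column_bounds ops place_lt (inord i : 'I_N.+1) x.
rewrite /= inordK //; have [_ h2] := andP h; apply: leq_ltn_trans h2 _.
by rewrite /braid_size; lia.
Qed.

(** Columns start at 1, so the shift in [arm_slot] does not wrap around, and c - 1 < j becomes c <=
    j. *)
Lemma slot_upp i x j : (arm_slot (port_gate i x) true < j)%N = (pc (inord i : 'I_N.+1) x <= j)%N.
Proof.
have h := port_column_bounds ops place_lt (inord i : 'I_N.+1) x; rewrite /arm_slot.
rewrite -(val_col i x) in h *; move: (col (port_gate i x)) h => c /andP[c0 c1].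
have -> : (c - 1 : Zm) = inord c.-1.
  apply/eqP; rewrite subr_eq -inord_next; last by rewrite prednK // ltn_ord.
  by rewrite prednK // inord_val.
have c2 : (c.-1 < m.+2)%N := leq_ltn_trans (leq_pred c) (ltn_ord c).
by rewrite inordK // prednK.
Qed.

Lemma mid_plain k x g e : nd g e = mid_node k x -> twisted g e = false.
Proof.
move=> E; apply/negbTE/negP => /andP[/andP[/eqP g0 _]]; case: e E => //= E _.
by move: E; rewrite g0.
Qed.

Lemma top_plain s g e : nd g e = top_node s -> twisted g e = false.
Proof.
move=> E; apply/negbTE/negP => /andP[/andP[/eqP g0 _]]; case: e E => //= E _.
by move: E; rewrite g0.
Qed.

Lemma sum_port (F : gate D -> int) (i : nat) x : (i <= N)%N ->
  \sum_g F g *+ ((g.1 == i :> nat) && (g.2 == x)) = F (port_gate i x).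
Proof.
move=> iN; rewrite (bigD1 (port_gate i x)) //= inordK // !eqxx mulr1n big1 ?addr0 // => -[i' y] /=.
case: (eqVneq (i' : nat) i) => [Ei|_ _]; last by rewrite mulr0n.
case: (eqVneq y x) => [->|_ _]; last by rewrite mulr0n.
by case/eqP; congr (_, _); apply: val_inj; rewrite /= inordK.
Qed.

Lemma upp_mid g k x : (upp g == mid_node k x) = (g.1 == k :> nat) && (g.2 == x).
Proof. by have := at_level_mid g.1.+1 g.2 k x; rewrite eqSS. Qed.
Lemma low_mid g k x : (low g == mid_node k x) = (g.1 == k.+1 :> nat) && (g.2 == x).
Proof. exact: (at_level_mid g.1 g.2 k x). Qed.
Lemma upp_top g s : (upp g == top_node s) = (g.1 == N :> nat) && (g.2.1 == s).
Proof. by have := @at_level_top n ops g.1.+1 g.2 s (ltn_ord g.1); rewrite eqSS. Qed.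
Lemma low_top g s : (low g == top_node s) = false.
Proof.
have := @at_level_top n ops g.1 g.2 s (ltnW (ltn_ord g.1)).
by rewrite ltn_eqF ?ltn_ord.
Qed.
Lemma low_base g : (low g == base_node) = (g.1 == 0 :> nat).
Proof. exact: at_level_base. Qed.
Lemma upp_base g : (upp g == base_node) = false.
Proof. exact: (at_level_base ops g.1.+1 g.2). Qed.

Lemma rim_flow_mid w k x j e : rim_flow true w (mid_node k x) j e =
  w (port_gate k x) *+ (pc k x <= j)%N - w (port_gate k.+1 x) *+ (pc k.+1 x < j)%N.
Proof.
rewrite rim_flow_plain => [|g e']; last exact: mid_plain.
have kN := ltn_ord k; have iN : (k <= N)%N by lia.
rewrite big_split /=; under eq_bigr do rewrite upp_mid -mulnb mulnC mulrnA.
rewrite (sum_port (fun g => - w g *+ (arm_slot g true < j)%N)) ?slot_upp ?inordK ?ltnS //.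
under eq_bigr do rewrite low_mid -mulnb mulnC mulrnA.
rewrite (sum_port (fun g => w g *+ (arm_slot g false < j)%N)) // /arm_slot val_col inordK //.
by rewrite mulNrn opprD opprK.
Qed.

Lemma sum_strand (F : strand n -> int) : \sum_x F x = \sum_s (F (s, true) + F (s, false)).
Proof. exact: (sum_pair_bool F). Qed.

Lemma sum_gates (F : gate D -> int) : \sum_g F g = \sum_(i < N.+1) \sum_x F (i, x).
Proof. by rewrite pair_big; apply: eq_bigr => -[]. Qed.

Lemma port_gateE (i : 'I_N.+1) x : (i, x) = port_gate i x.
Proof. by rewrite /port_gate; congr (_, _); apply: val_inj; rewrite /= inordK. Qed.

Lemma sum_top (F : gate D -> int) s : \sum_g F g *+ (upp g == top_node s) =
  F (port_gate N (s, true)) + F (port_gate N (s, false)).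
Proof.
transitivity (\sum_(b : bool) \sum_g F g *+ ((g.1 == N :> nat) && (g.2 == (s, b)))).
  rewrite exchange_big; apply: eq_bigr => -[i [s' b]] _; rewrite upp_top big_bool /=.
  by rewrite !xpair_eqE; case: (_ == N); case: (s' == s); case: b; rewrite /= ?mulr0n ?mulr1n ?addr0 ?add0r.
by rewrite big_bool !sum_port.
Qed.

Lemma rim_flow_top w s j e : rim_flow true w (top_node s) j e =
  w (port_gate N (s, true)) *+ (pc N (s, true) <= j)%N
  + w (port_gate N (s, false)) *+ (pc N (s, false) <= j)%N.
Proof.
rewrite rim_flow_plain => [|g e']; last exact: top_plain.
rewrite big_split /= [X in _ + X]big1 ?addr0 => [|g _]; last by rewrite low_top.
under eq_bigr do rewrite -mulnb mulnC mulrnA.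
rewrite (sum_top (fun g => - w g *+ (arm_slot g true < j)%N)) !slot_upp !inordK //.
by rewrite !mulNrn opprD !opprK.
Qed.

Definition strand_flow om (g : gate D) : int := ssign g.2 * om g.2.1.

Lemma flow_strand_flow om : flow (strand_flow om).
Proof.
move=> v; rewrite big_split /=; case: v => [[[k x]|s]|].
- have kN := ltn_ord k; have iN : (k <= N)%N by lia.
  under eq_bigr do rewrite upp_mid; rewrite (sum_port (fun g => - strand_flow om g)) //.
  under eq_bigr do rewrite low_mid; rewrite (sum_port (strand_flow om)) //.
  by rewrite /strand_flow /= addNr.
- rewrite [X in _ + X]big1 ?addr0 => [|g _]; last by rewrite low_top.
  by rewrite (sum_top (fun g => - strand_flow om g)) /strand_flow /ssign /=; ring.
rewrite big1 ?add0r => [|g _]; last by rewrite upp_base.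
rewrite sum_gates big1 // => i _; under eq_bigr do rewrite low_base.
rewrite sum_strand big1 // => s _; rewrite /strand_flow /ssign /=.
by case: (_ == 0); rewrite ?mulr0n ?mulr1n; ring.
Qed.

(** Kirchhoff's law at the middle discs makes a flow constant along each strand, and at a top disc
    it makes the values on the two strands of a loop opposite. *)
Lemma strand_flow_inv w : flow w -> exists om, forall g, w g = strand_flow om g.
Proof.
move=> fw; have step k x : w (port_gate k.+1 x) = w (port_gate k x).
  have kN := ltn_ord k; have iN : (k <= N)%N by lia.
  have := fw (mid_node k x); rewrite big_split /=.
  under eq_bigr do rewrite upp_mid; rewrite (sum_port (fun g => - w g)) //.
  under eq_bigr do rewrite low_mid; rewrite (sum_port w) // addrC.
  by move/eqP; rewrite subr_eq0 => /eqP.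
have const i x : (i <= N)%N -> w (port_gate i x) = w (port_gate 0 x).
  by elim: i => [//|i IH] iN; rewrite -IH 1?ltnW // -(step (Ordinal iN)).
have top s : w (port_gate 0 (s, true)) = - w (port_gate 0 (s, false)).
  have := fw (top_node s); rewrite big_split /= [X in _ + X]big1 ?addr0 => [|g _]; last by rewrite low_top.
  by rewrite (sum_top (fun g => - w g)) !const // -opprD => /eqP; rewrite oppr_eq0 addr_eq0 => /eqP.
exists (fun s => w (port_gate 0 (s, false))) => -[i [s b]]; rewrite port_gateE const; last by have := ltn_ord i; lia.
by rewrite /strand_flow /ssign /=; case: b; rewrite ?top; ring.
Qed.
End BraidFlows.

Lemma sum_injective (I J : finType) (h : J -> I) (P : pred I) (F : I -> int) :
  injective h -> (forall i, reflect (exists j, i = h j) (P i)) -> \sum_(i | P i) F i = \sum_j F (h j).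
Proof.
move=> h_inj PP; rewrite (eq_bigl (fun i => i \in h @: [set: J])) => [|i].
  by rewrite big_imset /=; [apply: eq_bigl => j; rewrite inE|move=> x y _ _ /h_inj].
by apply/PP/imsetP => [[j ->]|[j _ ->]]; exists j.
Qed.

(** * Heights of a braid, and its pairing as a sum over discs *)

Section BraidPairing.
Variables (R : realType) (n : nat) (ops : seq (strand n * strand n)) (place : strand n -> nat)
  (twx : strand n -> bool).
Hypothesis place_inj : injective place.
Hypothesis place_lt : forall x, (place x < n.*2)%N.
Notation N := (size ops).*2.
Notation D := (braid_diagram ops twx place_inj place_lt).
Notation m := (braid_size ops).
Notation Zm := 'I_m.+2.
Notation pc := (port_column ops place).
Implicit Types (x y : strand n) (s : 'I_n) (k : 'I_N) (v : node D) (g : gate D) (e : bool)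
  (om : 'I_n -> int) (o : strand n * strand n).

(** There are 2 n heights, 4 eps apart. The factor 1000 leaves room for the margins of [layout] and
    for the raised corners. *)
Definition braid_eps : R := (1000 * (n.*2.+1)%:R)^-1.
Definition strand_height x : R := (40 + 4 * (rank x)%:R) * braid_eps.

Lemma rank_inj : injective (@rank n).
Proof.
move=> [[s sn] b] [[s' sn'] b'] /=; rewrite /rank /= => E.
have [Es Eb] : s = s' /\ b = b' by case: b b' E => -[] /=; lia.
by rewrite Eb; congr (_, _); apply: val_inj.
Qed.

Lemma rank_lt x : (rank x < n.*2)%N.
Proof. by case: x => -[s sn] [] /=; rewrite /rank /=; lia. Qed.

Lemma braid_eps_bounds : 0 < braid_eps <= 1 / 1000.
Proof.
rewrite invr_gt0 mulr_gt0 ?ltr0n //= div1r lef_pV2 ?posrE ?mulr_gt0 ?ltr0n //.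
by rewrite ler_peMr ?ler1n ?ler0n.
Qed.

Lemma strand_height_bounds x : 40 * braid_eps <= strand_height x <= 1 - 60 * braid_eps.
Proof.
have /andP[e0 e1] := braid_eps_bounds.
have h1 : (n.*2.+1)%:R * braid_eps = 1 / 1000.
  by rewrite /braid_eps invfM mulrCA divff ?pnatr_eq0 // mulr1 div1r.
have h2 : 0 <= (rank x)%:R * braid_eps <= (n.*2.+1)%:R * braid_eps.
  apply/andP; split; first by apply: mulr_ge0; [exact: ler0n|exact: ltW].
  by rewrite ler_pM2r // ler_nat (leq_trans (ltnW (rank_lt x))) // leqnSn.
by rewrite /strand_height; lra.
Qed.

Lemma strand_height_lt x y : (rank x < rank y)%N -> strand_height x + 4 * braid_eps <= strand_height y.
Proof.
have /andP[e0 e1] := braid_eps_bounds.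
rewrite -(ler_nat R) -natr1 => h.
have : ((rank x)%:R + 1) * braid_eps <= (rank y)%:R * braid_eps by rewrite ler_pM2r.
by rewrite /strand_height; lra.
Qed.

Lemma strand_height_sep x y : x != y -> 4 * braid_eps <= `|strand_height x - strand_height y|.
Proof.
have /andP[e0 e1] := braid_eps_bounds.
rewrite -(inj_eq rank_inj) neq_ltn => /orP[]/strand_height_lt h.
  by rewrite ltr0_norm; lra.
by rewrite gtr0_norm; lra.
Qed.

Definition node_height v : R :=
  match (v : braid_node ops) with
  | None => 1 / 2 | Some (inl (_, x)) => strand_height x | Some (inr s) => strand_height (s, false) end.
Definition gate_height g : R :=
  if tw g then 1 / 2 + 80 / 3 * braid_eps else strand_height g.2.

Lemma low_tw g : tw g -> low g = base_node ops twx place_inj place_lt.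
Proof. by move=> /andP[/eqP g0 _]; rewrite /= g0. Qed.

Lemma level_base v : level v = 0%N -> v = base_node ops twx place_inj place_lt.
Proof. by case: v => [[[k x]|s]|]. Qed.

Lemma braid_eps_gt0 : 0 < braid_eps. Proof. by case/andP: braid_eps_bounds. Qed.
Lemma braid_eps_small : braid_eps <= 1 / 1000. Proof. by case/andP: braid_eps_bounds. Qed.

Definition braid_layout : layout R D.
Proof.
refine (@Layout R m D braid_eps node_height gate_height braid_eps_gt0 braid_eps_small _ _ _ _ _ _).
- have e0 := braid_eps_gt0; have e1 := braid_eps_small; case=> [[[k x]|s]|] /=; last by lra.
    by have := strand_height_bounds x; lra.
  by have := strand_height_bounds (s, false); lra.
- have e0 := braid_eps_gt0; have e1 := braid_eps_small.
  move=> g; rewrite /gate_height; case: ifP => _; first by lra.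
  by have := strand_height_bounds g.2; lra.
- move=> v v' /eqP; rewrite lev_eq => /eqP; case: v v' => [[[k x]|s]|] [[[k' x']|s']|] //=.
  + move=> [/val_inj->] nx; apply: strand_height_sep.
    by apply: contra nx => /eqP->.
  + by move=> [E]; have := ltn_ord k; rewrite E ltnn.
  + by move=> [E]; have := ltn_ord k'; rewrite -E ltnn.
  by move=> _ ns; apply: strand_height_sep; apply: contra ns => /eqP[->].
- move=> g v tg /eqP; rewrite lev_eq (low_tw tg) => /eqP /level_base.
  by [].
- move=> g g' tg; rewrite lev_eq (low_tw tg) /=.
  by rewrite [level _](level_at (ops := ops) _ (i := g'.1.+1)) // ltnS ltn_ord.
- by move=> g tg; rewrite /gate_height tg (low_tw tg).
Defined.

Notation Y := braid_layout.

Definition order_sign x y : int := if x == y then 0 else if (rank x < rank y)%N then 1 else -1.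

Lemma order_signC x y : order_sign y x = - order_sign x y.
Proof.
rewrite /order_sign eq_sym; case: eqVneq => [//|ne]; rewrite -(inj_eq rank_inj) in ne.
by case: ltngtP ne => //.
Qed.

Lemma height_order x y : x != y -> (strand_height x < strand_height y) = (rank x < rank y)%N.
Proof.
have /andP[e0 e1] := braid_eps_bounds.
rewrite -(inj_eq rank_inj) neq_ltn => /orP[h|h]; rewrite ?h.
  by have := strand_height_lt h => h'; apply/idP; lra.
have := strand_height_lt h => h'; rewrite [RHS]ltnNge (ltnW h).
by apply/negbTE; rewrite -leNgt; lra.
Qed.

Lemma side_mid k x y : side Y (mid_node twx place_inj place_lt k x) (mid_node twx place_inj place_lt k y) =
  order_sign x y.
Proof.
rewrite /side /order_sign /= /mid_node.
have -> : (Some (inl (k, x)) == Some (inl (k, y)) :> braid_node ops) = (x == y).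
  by apply/eqP/eqP => [[->]|->].
by case: (eqVneq x y) => // ne; rewrite height_order.
Qed.

Lemma side_top s s' : side Y (top_node ops twx place_inj place_lt s) (top_node ops twx place_inj place_lt s') =
  order_sign (s, false) (s', false).
Proof.
rewrite /side /order_sign /= /top_node.
have -> : (Some (inr s) == Some (inr s') :> braid_node ops) = ((s, false) == (s', false)).
  by apply/eqP/eqP => [[->]|[->]].
by case: (eqVneq (s, false) (s', false)) => // ne; rewrite height_order.
Qed.

Lemma sum_level_mid (F : node D -> int) k x :
  \sum_(v | lev v == lev (mid_node twx place_inj place_lt k x)) F v =
  \sum_y F (mid_node twx place_inj place_lt k y).
Proof.
apply: sum_injective => [y y' [->] //|v]; rewrite lev_eq; apply: (iffP eqP) => [|[y ->] //].
case: v => [[[k' x']|s]|] //= [E]; first by exists x'; rewrite (val_inj E).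
by have := ltn_ord k; rewrite -E ltnn.
Qed.

Lemma sum_level_top (F : node D -> int) s :
  \sum_(v | lev v == lev (top_node ops twx place_inj place_lt s)) F v =
  \sum_s' F (top_node ops twx place_inj place_lt s').
Proof.
apply: sum_injective => [y y' [->] //|v]; rewrite lev_eq; apply: (iffP eqP) => [|[y ->] //].
case: v => [[[k' x']|s']|] //=; last by exists s'.
by move=> [E]; have := ltn_ord k'; rewrite E ltnn.
Qed.

Notation W := (@strand_flow n ops place twx place_inj place_lt).
Notation pg := (port_gate ops twx place_inj place_lt).
Definition weight om x : int := ssign x * om x.1.

Lemma upp_pg k x : upp (pg k x) = mid_node twx place_inj place_lt k x.
Proof. by apply/eqP; rewrite upp_mid /= inordK ?eqxx // ltnW // ltnS ltn_ord. Qed.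
Lemma low_pg k x : low (pg k.+1 x) = mid_node twx place_inj place_lt k x.
Proof. by apply/eqP; rewrite low_mid /= inordK ?eqxx // ltnS ltn_ord. Qed.
Lemma upp_pgN x : upp (pg N x) = top_node ops twx place_inj place_lt x.1.
Proof. by apply/eqP; rewrite upp_top /= inordK ?eqxx. Qed.

Lemma val_pc i x : (i <= N)%N -> (col (pg i x) : nat) = pc i x.
Proof. by move=> iN; rewrite val_col inordK. Qed.

Lemma arm_pairing_upp om om' k x : arm_pairing Y (W om) (W om') (pg k x) true =
  - weight om x * \sum_y order_sign y x * (weight om' y *
     ((pc k y <= pc k x)%N%:Z - (pc k.+1 y < pc k x)%N%:Z)).
Proof.
rewrite /arm_pairing /out [nd _ _]upp_pg sum_level_mid; congr (_ * _); apply: eq_bigr => y _.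
rewrite side_mid rim_flow_mid val_pc; last exact: ltnW.
by congr (_ * _); rewrite /strand_flow /weight /=; do 2!case: (_ <= _)%N; rewrite /= ?mulr0n ?mulr1n; ring.
Qed.

Lemma arm_pairing_low om om' k x : arm_pairing Y (W om) (W om') (pg k.+1 x) false =
  weight om x * \sum_y order_sign y x * (weight om' y *
     ((pc k y <= pc k.+1 x)%N%:Z - (pc k.+1 y < pc k.+1 x)%N%:Z)).
Proof.
rewrite /arm_pairing /out [nd _ _]low_pg sum_level_mid; congr (_ * _); apply: eq_bigr => y _.
rewrite side_mid rim_flow_mid val_pc //.
by congr (_ * _); rewrite /strand_flow /weight /=; do 2!case: (_ <= _)%N; rewrite /= ?mulr0n ?mulr1n; ring.
Qed.

Lemma arm_pairing_top om om' x : arm_pairing Y (W om) (W om') (pg N x) true =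
  - weight om x * \sum_s order_sign (s, false) (x.1, false) *
     (weight om' (s, true) * (pc N (s, true) <= pc N x)%N%:Z
      + weight om' (s, false) * (pc N (s, false) <= pc N x)%N%:Z).
Proof.
rewrite /arm_pairing /out [nd _ _]upp_pgN sum_level_top; congr (_ * _); apply: eq_bigr => s _.
rewrite side_top rim_flow_top val_pc //.
by congr (_ * _); rewrite /strand_flow /weight /=; do 2!case: (_ <= _)%N; rewrite /= ?mulr0n ?mulr1n; ring.
Qed.

Lemma arm_pairing_base om om' x : arm_pairing Y (W om) (W om') (pg 0 x) false = 0.
Proof.
rewrite /arm_pairing big1 ?mulr0 // => v; rewrite lev_eq => /eqP E.
have Eb : low (pg 0 x) = base_node ops twx place_inj place_lt.
  by apply/eqP; rewrite low_base /= inordK.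
by rewrite [nd _ _]Eb /= in E *; rewrite (level_base E) /side eqxx mul0r.
Qed.

(** Rim flow of the disc of [y], for unit weight, at the column where [x] leaves the level, minus
    that at the column where [x] enters it. *)
Definition slip i y x : int := (pc i y <= pc i.+1 x)%N%:Z - (pc i.+1 y < pc i.+1 x)%N%:Z
  - (pc i y <= pc i x)%N%:Z + (pc i.+1 y < pc i x)%N%:Z.

Definition top_term om om' : int := \sum_x - weight om x * \sum_s order_sign (s, false) (x.1, false) *
     (weight om' (s, true) * (pc N (s, true) <= pc N x)%N%:Z
      + weight om' (s, false) * (pc N (s, false) <= pc N x)%N%:Z).

(** The sum over strips is regrouped by levels: a middle disc receives the upper end of one port and
    the lower end of the next. The base has no disc above or below it, and the top discs, where
    strips only enter, are kept apart. *)
Lemma pairing_slip om om' : pairing Y (W om) (W om') =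
  \sum_x \sum_y weight om x * weight om' y * order_sign y x * (\sum_(k < N) slip k y x)
  + top_term om om' - \sum_x (weight om x * weight om' x) *+ twx x.
Proof.
rewrite /pairing sumrB big_split /=; congr (_ - _); last first.
  rewrite sum_gates big_ord_recl [X in _ + X]big1 ?addr0 => [|i _]; last by rewrite big1.
  by apply: eq_bigr => x _.
have E0 x : (ord0, x) = pg 0 x := port_gateE twx place_inj place_lt ord0 x.
have EN x : (ord_max, x) = pg N x := port_gateE twx place_inj place_lt ord_max x.
have EL k x : (lift ord0 k, x) = pg k.+1 x := port_gateE twx place_inj place_lt (lift ord0 k) x.
have EW k x : (widen_ord (leqnSn N) k, x) = pg k x := port_gateE twx place_inj place_lt (widen_ord (leqnSn N) k) x.
have S1 : \sum_g arm_pairing Y (W om) (W om') g true =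
    \sum_(k < N) \sum_x arm_pairing Y (W om) (W om') (pg k x) true + top_term om om'.
  rewrite sum_gates big_ord_recr; congr (_ + _).
    by apply: eq_bigr => k _; apply: eq_bigr => x _; rewrite EW.
  by apply: eq_bigr => x _; rewrite -arm_pairing_top EN.
have S2 : \sum_g arm_pairing Y (W om) (W om') g false =
    \sum_(k < N) \sum_x arm_pairing Y (W om) (W om') (pg k.+1 x) false.
  have B0 : \sum_x arm_pairing Y (W om) (W om') (ord0, x) false = 0.
    apply: big1 => x _.
    rewrite E0.
    exact: arm_pairing_base.
  have skip0 (F : 'I_N.+1 -> int) : F ord0 = 0 -> \sum_i F i = \sum_(k < N) F (lift ord0 k).
    by move=> F0; rewrite big_ord_recl F0 add0r.
  rewrite sum_gates (skip0 _ B0).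
  by apply: eq_bigr => k _; apply: eq_bigr => x _; rewrite EL.
rewrite S1 S2 addrAC; congr (_ + _); rewrite -big_split.
transitivity (\sum_(k < N) \sum_x \sum_y weight om x * weight om' y * order_sign y x * slip k y x).
  apply: eq_bigr => k _; rewrite -big_split; apply: eq_bigr => x _.
  rewrite arm_pairing_upp arm_pairing_low !mulr_sumr -big_split; apply: eq_bigr => y _.
  rewrite /slip; move: (pc k y <= pc k.+1 x)%N (pc k.+1 y < pc k.+1 x)%N (pc k y <= pc k x)%N (pc k.+1 y < pc k x)%N => b1 b2 b3 b4.
  move: (weight om x) (weight om' y) (order_sign y x) => z1 z2 z3.
  by rewrite /=; ring.
rewrite exchange_big; apply: eq_bigr => x _; rewrite exchange_big; apply: eq_bigr => y _.
by rewrite mulr_sumr.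
Qed.

End BraidPairing.

(** * The matrix of a braid *)

Section BraidMatrix.
Variables (R : realType) (n : nat) (ops : seq (strand n * strand n)) (place : strand n -> nat)
  (twx : strand n -> bool).
Hypothesis ops_neq : forall o, o \in ops -> o.1 != o.2.
Hypothesis place_inj : injective place.
Hypothesis place_lt : forall x, (place x < n.*2)%N.
Notation N := (size ops).*2.
Notation pc := (port_column ops place).
Implicit Types (x y u v : strand n) (s : 'I_n) (om : 'I_n -> int) (o : strand n * strand n).

Definition op_slip o y x : int := ((x == o.2) && (y == o.1))%:Z - ((x == o.1) && (y == o.2))%:Z.

Lemma idle_column r x : pc r.*2 x = (place x).*2.+1.
Proof. by rewrite /port_column odd_double. Qed.

Lemma op_column o0 r x : (r < size ops)%N -> let o := nth o0 ops r in
  pc r.*2.+1 x = if x == o.1 then (place o.1).*2.+2 else if x == o.2 then (place o.1).*2.+1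
    else (place x).*2.+1.
Proof.
move=> rR o; rewrite /port_column /= odd_double /= uphalf_double (drop_nth o0 rR) /=.
by rewrite -/o; case: (o).
Qed.

(** Passages across third strands on the way out are undone on the way back. Between u and v there
    is one defect: on the way out v leaves by the very column through which u enters, a tie that
    [<=] counts and that does not recur on the way back. *)
Lemma slip_port o0 r x y : (r < size ops)%N -> x != y ->
  slip ops place r.*2 y x + slip ops place r.*2.+1 y x = op_slip (nth o0 ops r) y x.
Proof.
move=> rR xy; rewrite /slip -!doubleS !idle_column !(op_column o0) //.
have := ops_neq (mem_nth o0 rR); move: (nth o0 ops r) => [u v] /= uv; rewrite /op_slip /=.
have P z z' : z != z' -> place z != place z' by rewrite (inj_eq place_inj).
have pxy := P _ _ xy; have puv := P _ _ uv.
case: (eqVneq x u) => [Ex|xu]; case: (eqVneq y u) => [Ey|yu]; first by rewrite Ex Ey eqxx in xy.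
- rewrite Ex (negPf uv) /=; have pyu := P _ _ yu.
  by case: (eqVneq y v) => [->|yv]; lia.
- rewrite Ey (negPf uv) ?andbF ?andbT /=; have pxu := P _ _ xu.
  by case: (eqVneq x v) => [->|xv]; lia.
have pyu := P _ _ yu; have pxu := P _ _ xu; rewrite ?andbF /=.
case: (eqVneq x v) => [Ex|xv]; case: (eqVneq y v) => [Ey|yv]; first by rewrite Ex Ey eqxx in xy.
- by rewrite Ex in pxy pxu *; lia.
- by rewrite Ey in pxy pyu *; lia.
by lia.
Qed.

Lemma sum_pairs (f : nat -> int) r : \sum_(k < r.*2) f k = \sum_(i < r) (f i.*2 + f i.*2.+1).
Proof.
elim: r => [|r IH]; first by rewrite !big_ord0.
by rewrite [RHS]big_ord_recr -IH doubleS 2!big_ord_recr /= addrA.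
Qed.

Lemma sum_slip x y : x != y -> \sum_(k < N) slip ops place k y x = \sum_(o <- ops) op_slip o y x.
Proof.
move=> xy; rewrite (sum_pairs (fun k => slip ops place k y x)) (big_nth (x, y)) big_mkord.
by apply: eq_bigr => i _; apply: slip_port.
Qed.

Definition op_matrix o (s s' : 'I_n) : int := order_sign o.1 o.2 * ssign o.1 * ssign o.2 *
  (((s == o.2.1) && (s' == o.1.1))%:Z + ((s == o.1.1) && (s' == o.2.1))%:Z).

Definition top_matrix (s s' : 'I_n) : int :=
  - order_sign (s', false) (s, false) * \sum_(b : bool) \sum_(b' : bool)
     ssign (s, b) * ssign (s', b') * (place (s', b') <= place (s, b))%N%:Z.

Definition twist_matrix (s s' : 'I_n) : int :=
  ((twx (s, true))%:Z + (twx (s, false))%:Z) *+ (s == s').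

Definition braid_matrix (s s' : 'I_n) : int :=
  \sum_(o <- ops) op_matrix o s s' + top_matrix s s' - twist_matrix s s'.

Definition form (A : 'I_n -> 'I_n -> int) om om' : int := \sum_s \sum_s' om s * om' s' * A s s'.

Lemma form_add A B om om' : form (fun s s' => A s s' + B s s') om om' = form A om om' + form B om om'.
Proof.
rewrite -big_split; apply: eq_bigr => s _; rewrite -big_split; apply: eq_bigr => s' _.
by rewrite /= mulrDr.
Qed.

Lemma form_op o om om' : o.1 != o.2 ->
  \sum_x \sum_y weight om x * weight om' y * order_sign y x * op_slip o y x = form (op_matrix o) om om'.
Proof.
case: o => u v /= uv; rewrite /op_slip /form /op_matrix /=.
have pick (T : finType) (F : T -> T -> int) (a b : T) :
    \sum_x \sum_y F x y * ((x == a) && (y == b))%:Z = F a b.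
  rewrite pair_big -(sum_delta (a, b) (fun p => F p.1 p.2)); apply: eq_bigr => -[x y] _.
  by rewrite xpair_eqE [a == x]eq_sym [b == y]eq_sym.
under eq_bigr do under eq_bigr do rewrite mulrBr; under eq_bigr do rewrite sumrB; rewrite sumrB.
rewrite (pick _ (fun x y => weight om x * weight om' y * order_sign y x)).
rewrite (pick _ (fun x y => weight om x * weight om' y * order_sign y x)).
under [RHS]eq_bigr do under eq_bigr do rewrite mulrA mulrDr.
under [RHS]eq_bigr do rewrite big_split; rewrite big_split /=.
rewrite (pick _ (fun s s' => om s * om' s' * (order_sign u v * ssign u * ssign v))).
rewrite (pick _ (fun s s' => om s * om' s' * (order_sign u v * ssign u * ssign v))).
rewrite (order_signC u v) /weight; ring.
Qed.

Lemma form_top om om' : top_term ops place om om' = form top_matrix om om'.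
Proof.
rewrite /top_term sum_strand; apply: eq_bigr => s _; rewrite !mulr_sumr -big_split; apply: eq_bigr => s' _.
rewrite /top_matrix !big_bool !idle_column /= !ltnS !leq_double /weight.
move: (order_sign _ _) (om s) (om' s') => z a b.
move: (place (s', true) <= place (s, true))%N (place (s', false) <= place (s, true))%N
  (place (s', true) <= place (s, false))%N (place (s', false) <= place (s, false))%N => b1 b2 b3 b4.
by rewrite /=; ring.
Qed.

Lemma form_twist om om' : \sum_x (weight om x * weight om' x) *+ twx x = form twist_matrix om om'.
Proof.
rewrite sum_strand; apply: eq_bigr => s _; rewrite (bigD1 s) //= big1 ?addr0 => [|s' /negPf ss].
  rewrite /twist_matrix eqxx /weight /ssign /=; case: (twx _); case: (twx _); rewrite /= ?mulr0n ?mulr1n; ring.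
by rewrite /twist_matrix eq_sym ss mulr0n mulr0.
Qed.

Theorem pairing_matrix om om' : pairing (braid_layout R ops twx place_inj place_lt)
   (@strand_flow n ops place twx place_inj place_lt om) (@strand_flow n ops place twx place_inj place_lt om')
  = form braid_matrix om om'.
Proof.
rewrite pairing_slip form_top form_twist.
transitivity (form (fun s s' => \sum_(o <- ops) op_matrix o s s') om om' + form top_matrix om om' - form twist_matrix om om').
  congr (_ + _ - _).
  transitivity (\sum_(o <- ops) \sum_x \sum_y weight om x * weight om' y * order_sign y x * op_slip o y x).
    rewrite [RHS]exchange_big; apply: eq_bigr => x _; rewrite [RHS]exchange_big; apply: eq_bigr => y _ /=.
    rewrite -mulr_sumr; case: (eqVneq x y) => [->|xy]; last by rewrite sum_slip.
    by rewrite /order_sign eqxx mulr0 !mul0r.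
  rewrite (eq_big_seq (fun o => form (op_matrix o) om om')) => [|o oo]; last exact/form_op/ops_neq.
  rewrite /form exchange_big; apply: eq_bigr => s _; rewrite exchange_big; apply: eq_bigr => s' _.
  by rewrite mulr_sumr.
rewrite /braid_matrix form_add -form_add.
congr (_ + _); rewrite /form -sumrN; apply: eq_bigr => s _; rewrite -sumrN.
by apply: eq_bigr => s' _; rewrite mulrN.
Qed.
End BraidMatrix.

(** * Connectedness of the boundary *)

Section RimWalk.
Variables (m : nat) (D : diagram m) (T : Type).
Notation Zm := 'I_m.+2.
Notation fv := (fvertex m (node D) (gate D)).
Variable f : fv -> T.
Hypothesis f_edge : forall u v, boundary_edge (fcomplex D) u v -> f u = f v.
Implicit Types (g : gate D) (j k : Zm) (e s : bool).

Lemma f_gate s g e : f (gv s g) = f (att s g e).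
Proof. exact/f_edge/rail_edge. Qed.

Variable n : node D.
Hypothesis col_pos : forall g e, nd g e = n -> (0 < col g)%N.

(** The rim in cyclic order from [Pb n 0]. Here [f] stands for the component in the boundary graph,
    so that connecting two vertices amounts to equating their values. *)
Definition rim_walk (i : nat) : fv :=
  if odd i then Pc n (opp_spoke n (inord i./2) false) else Pb n (inord i./2).
(** Index i of the rim edge from i to i + 1 which the strip covers. Columns being positive, the
    predecessor is a true one, and the edge closing up the rim is always free. *)
Definition arm_step g e : nat := if e then (col g).*2.-1 else (col g).*2.

Lemma rim_walkPb j : rim_walk j.*2 = Pb n j.
Proof. by rewrite /rim_walk odd_double doubleK inord_val. Qed.
Lemma rim_walkPc j : rim_walk j.*2.+1 = Pc n (opp_spoke n j false).
Proof. by rewrite /rim_walk /= odd_double /= uphalf_double inord_val. Qed.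

Lemma free_cell j e : (forall g, nd g e = n -> arm_step g e != if e then (j.*2.-1)%N else j.*2) ->
  ((0 < j)%N || ~~ e) -> f (Pb n j) = f (Pc n (opp_spoke n j e)).
Proof.
move=> free j0; apply: f_edge; apply: free_rim_edge; case: cell_gateP => // g En Ec.
by have := free g En; rewrite /arm_step Ec; case: (e); rewrite eqxx.
Qed.

Lemma rim_step i : (i.+1 < m.+2.*2)%N -> (forall g e, nd g e = n -> arm_step g e != i) ->
  f (rim_walk i) = f (rim_walk i.+1).
Proof.
move=> iN free; case: (boolP (odd i)) => oi.
  have Ei : i = i./2.*2.+1 by rewrite -[LHS]odd_double_half oi.
  have hN : (i./2.+1 < m.+2)%N by lia.
  have hN' : (i./2 < m.+2)%N by lia.
  have E1 : rim_walk i = Pc n (opp_spoke n (inord i./2) false) by rewrite /rim_walk oi.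
  have E2 : rim_walk i.+1 = Pb n (inord i./2.+1).
    by rewrite /rim_walk /= oi /= uphalf_half oi.
  rewrite E1 E2 inord_next //; set j : Zm := inord i./2.
  have -> : opp_spoke n j false = opp_spoke n (j + 1) true.
    by rewrite /opp_spoke mulr0n mulr1n; ring.
  have jv : nat_of_ord (j + 1 : Zm) = i./2.+1 by rewrite /j -inord_next // inordK.
  apply/esym/free_cell; last by rewrite jv.
  have Ej : (nat_of_ord (j + 1 : Zm)).*2.-1 = i by rewrite jv; lia.
  by move=> g En; rewrite Ej; apply: free.
have Ei : i = i./2.*2 by rewrite -[LHS]odd_double_half (negPf oi).
have hN' : (i./2 < m.+2)%N by lia.
have -> : rim_walk i = Pb n (inord i./2) by rewrite /rim_walk (negPf oi).
have -> : rim_walk i.+1 = Pc n (opp_spoke n (inord i./2) false).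
  by rewrite /rim_walk /= oi uphalf_half (negPf oi).
apply: free_cell; last by rewrite orbT.
have Ej : (nat_of_ord (inord i./2 : Zm)).*2 = i by rewrite inordK.
by move=> g En; rewrite Ej; apply: free.
Qed.

Lemma rim_segment a b : (a <= b < m.+2.*2)%N ->
  (forall g e, nd g e = n -> ~~ (a <= arm_step g e < b)%N) -> f (rim_walk a) = f (rim_walk b).
Proof.
move=> /andP[ab bN] free; elim: b ab bN free => [|b IH] ab bN free.
  by move: ab; rewrite leqn0 => /eqP->.
have [->//|ne] := eqVneq a b.+1.
have ab' : (a <= b)%N by rewrite -ltnS ltn_neqAle ne.
have -> : f (rim_walk a) = f (rim_walk b).
  apply: IH ab' (ltnW bN) _ => g e En.
  by apply: contra (free g e En) => /andP[h1 h2]; rewrite h1 ltnS ltnW.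
by apply: rim_step => // g e En; apply/eqP => E; have := free g e En; rewrite E ab' ltnSn.
Qed.

Lemma rim_wrap : f (rim_walk m.+1.*2.+1) = f (rim_walk 0).
Proof.
have -> : rim_walk 0 = Pb n 0 by rewrite -(rim_walkPb 0).
have -> : rim_walk m.+1.*2.+1 = Pc n (opp_spoke n 0 true).
  rewrite -[m.+1]/(nat_of_ord (ord_max : Zm)) rim_walkPc; congr (Pc _ _).
  have E : (ord_max + 1 : Zm) = 0 by apply: val_inj; rewrite /= modnDmr addn1 modnn.
  by rewrite /opp_spoke -E mulr0n mulr1n; ring.
apply/esym/f_edge/free_rim_edge; case: cell_gateP => // g En Ec.
by have := col_pos En; rewrite Ec.
Qed.

(** If all strips lie between b and a, the other way around the rim is free and connects a to b. *)
Lemma rim_around a b : (a < m.+2.*2)%N -> (b < m.+2.*2)%N ->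
  (forall g e, nd g e = n -> (b <= arm_step g e < a)%N) -> f (rim_walk a) = f (rim_walk b).
Proof.
move=> aN bN arms; rewrite (@rim_segment a m.+1.*2.+1) //; last first.
- by move=> g e En; have := arms g e En; lia.
- by lia.
rewrite rim_wrap; apply: rim_segment; first by lia.
by move=> g e En; have := arms g e En; lia.
Qed.

Lemma arm_ends g e : nd g e = n ->
  rim_walk (col g).*2 = Pb n (col g) /\ rim_walk (if e then (col g).*2.-1 else (col g).*2.+1) = Pc n (kap g).
Proof.
move=> En; split; first exact: rim_walkPb.
have c0 := col_pos En; case: e En => En; last first.
  by rewrite rim_walkPc; congr (Pc _ _); rewrite (kapE g false) En.
have -> : (col g).*2.-1 = (col g).-1.*2.+1 by lia.
have -> : (col g).-1 = (col g - 1 : Zm) :> nat.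
  have c2 : ((col g).-1 < m.+2)%N := leq_ltn_trans (leq_pred _) (ltn_ord _).
  rewrite -[LHS](inordK c2); congr nat_of_ord; apply/eqP; rewrite eq_sym subr_eq -inord_next prednK //.
  by rewrite inord_val.
rewrite rim_walkPc; congr (Pc _ _); rewrite (kapE g true) En /opp_spoke mulr0n mulr1n; ring.
Qed.

Lemma rim_constant (c : T) (g0 : gate D) (e0 : bool) : nd g0 e0 = n ->
  (forall g e, nd g e = n -> f (Pb n (col g)) = c /\ f (Pc n (kap g)) = c) ->
  forall i, (i < m.+2.*2)%N -> f (rim_walk i) = c.
Proof.
move=> E0 ends.
have near g e : nd g e = n -> f (rim_walk (arm_step g e)) = c /\ f (rim_walk (arm_step g e).+1) = c.
  move=> En; have [h1 h2] := ends g e En; have [h3 h4] := arm_ends En.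
  rewrite -h3 in h1; rewrite -h4 in h2; have := col_pos En; rewrite /arm_step.
  by case: (e) h2 => h2 c0; rewrite ?prednK ?double_gt0.
have start : f (rim_walk 0) = c.
  have sN : (arm_step g0 e0 < m.+2.*2)%N by rewrite /arm_step; have := ltn_ord (col g0); case: (e0); lia.
  have [+ _] := near _ _ E0; elim: (arm_step g0 e0) sN => [//|i IH] iN fi.
  apply: IH; first exact: ltnW.
  have [[g [e [En Es]]]|none] := pselect (exists g e, nd g e = n /\ arm_step g e = i).
    by have [h _] := near _ _ En; rewrite -Es.
  rewrite rim_step // => g e En; apply/eqP => E; apply: none.
  by exists g, e.
elim=> [//|i IH] iN; have fi := IH (ltnW iN).
have [[g [e [En Es]]]|none] := pselect (exists g e, nd g e = n /\ arm_step g e = i).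
  by have [_ h] := near _ _ En; rewrite -Es.
rewrite -rim_step // => g e En; apply/eqP => E; apply: none.
by exists g, e.
Qed.

Lemma rim_vertices (c : T) : (forall i, (i < m.+2.*2)%N -> f (rim_walk i) = c) ->
  (forall j, f (Pb n j) = c) /\ (forall k, f (Pc n k) = c).
Proof.
move=> H; split=> [j|k].
  by rewrite -rim_walkPb H //; have := ltn_ord j; lia.
rewrite -(opp_spokeK n false k) -rim_walkPc H //.
by have := ltn_ord (opp_spoke n k false); lia.
Qed.
End RimWalk.

(** * Gates of a braid, and the rim flow at its base *)

Section BraidBoundary.
Variables (n : nat) (ops : seq (strand n * strand n)) (place : strand n -> nat)
  (twx : strand n -> bool).
Hypothesis place_inj : injective place.
Hypothesis place_lt : forall x, (place x < n.*2)%N.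
Notation N := (size ops).*2.
Notation D := (braid_diagram ops twx place_inj place_lt).
Notation m := (braid_size ops).
Notation Zm := 'I_m.+2.
Notation pc := (port_column ops place).
Notation fv := (fvertex m (node D) (gate D)).
Notation pg := (port_gate ops twx place_inj place_lt).
Notation W := (@strand_flow n ops place twx place_inj place_lt).
Notation mid := (mid_node twx place_inj place_lt).
Notation top := (top_node ops twx place_inj place_lt).
Notation base := (base_node ops twx place_inj place_lt).
Implicit Types (x y : strand n) (s : 'I_n) (k : 'I_N) (g : gate D) (e : bool) (j : Zm).

Lemma gate_eq g i x : g.1 = i :> nat -> g.2 = x -> g = pg i x.
Proof. by case: g => a b /= <- <-; apply: port_gateE. Qed.

Lemma gate_inv g : exists i x, (i <= N)%N /\ g = pg i x.
Proof. by exists g.1, g.2; split; [rewrite -ltnS ltn_ord|apply: gate_eq]. Qed.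

Lemma braid_col_pos g : (0 < col g)%N.
Proof.
have [i [x [iN ->]]] := gate_inv g; rewrite val_pc //.
by have /andP[] := port_column_bounds ops place_lt i x.
Qed.

Lemma arms_mid g e k x : nd g e = mid k x ->
  (e = true /\ g = pg k x) \/ (e = false /\ g = pg k.+1 x).
Proof.
case: e => /= /eqP; first by rewrite upp_mid => /andP[/eqP h1 /eqP h2]; left; split=> //; apply: gate_eq.
by rewrite low_mid => /andP[/eqP h1 /eqP h2]; right; split=> //; apply: gate_eq.
Qed.

Lemma arms_top g e s : nd g e = top s -> e = true /\ exists b, g = pg N (s, b).
Proof.
case: e => /= /eqP; last by rewrite low_top.
rewrite upp_top => /andP[/eqP h1 /eqP h2]; split=> //; exists g.2.2; apply: gate_eq => //.
by rewrite -h2; case: (g.2).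
Qed.

Lemma arms_base g e : nd g e = base -> e = false /\ exists x, g = pg 0 x.
Proof.
case: e => /= /eqP; first by rewrite upp_base.
by rewrite low_base => /eqP h; split=> //; exists g.2; apply: gate_eq.
Qed.

Lemma tw_pg i x : (i <= N)%N -> tw (pg i x) = (i == 0%N) && twx x.
Proof. by move=> iN; rewrite /= -(inj_eq val_inj) /= inordK. Qed.

Lemma idle_top x : pc N x = (place x).*2.+1. Proof. exact: idle_column. Qed.
Lemma idle_base x : pc 0 x = (place x).*2.+1. Proof. exact: (idle_column ops place 0). Qed.

Section Flat.
Hypothesis flat : forall x, twx x -> forall s, (place (s, true) < place x)%N = (place (s, false) < place x)%N.

Lemma raised_base v j : raised v j -> v = base /\ exists2 x, twx x & j = col (pg 0 x).
Proof.
move=> /raisedP[g [tg <- <-]]; have Eb := low_tw tg; split=> //.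
have [_ [x Eg]] := @arms_base g false Eb; exists x; last by rewrite Eg.
by move: tg; rewrite Eg tw_pg.
Qed.

Lemma base_rim_inflow om j : rim_inflow false (W om) base j =
  \sum_(g : gate D) W om g *+ ((low g == base) && (col g == j)).
Proof.
rewrite /rim_inflow /inflow -big_split; apply: eq_bigr => g _ /=.
have off v' : v' = Pb base j \/ v' = Pc base (opp_spoke base j false) -> (att false g true == v') = false.
  move=> E; apply/eqP => Ev; have : upp g == base; last by rewrite upp_base.
  by move: Ev; rewrite /att /rim andbF /=; case: E => -> // -[->].
have aE : att false g false = if tw g then Pc (low g) (kap g) else Pb (low g) (col g).
  by rewrite /att /rim andbT.
rewrite !off; [|by right|by left]; rewrite !mulr0n !add0r aE {aE}.
have slot : low g == base -> (kap g == opp_spoke base j false) = (col g == j).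
  move=> /eqP El; rewrite (arm_slotE g false) (El : nd g false = base).
  exact: (inj_eq (inv_inj (opp_spokeK base false))).
case: (tw g); rewrite !fvertex_eqE ?mulr0n ?add0r ?addr0 //; congr (_ *+ nat_of_bool _).
by case: (low g == base) slot => //= ->.
Qed.

(** The rim flow at the place of [x] is minus the total weight of the strands before it. By [flat]
    the two strands of a loop are on the same side of [x], and their weights cancel. On the side
    false a twisted strip is attached at [Pc], so nothing leaves at the raised corner itself. *)
Lemma base_flat om j e : raised base j ->
  rim_flow false (W om) base j e = 0.
Proof.
move=> rj; have [_ [x tx Ej]] := raised_base rj.
rewrite /rim_flow.
have -> : inflow false (W om) (Pb base j) = 0.
  rewrite /inflow big1 // => g _.
  have -> : (att false g true == Pb base j) = false.
    apply/eqP; rewrite /att /rim andbF => E.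
    have Eu : upp g = base by case: E.
    by have := upp_base g; rewrite Eu eqxx.
  have -> : (att false g false == Pb base j) = false; last by rewrite !mulr0n addr0.
  apply/eqP; rewrite /att /rim andbT; case tg: (tw g) => // E.
  have [El Ec] : low g = base /\ col g = j by case: E => E1 E2; split; [exact: E1|exact: E2].
  have [_ [y Eg]] := @arms_base g false El; move: Ec tg; rewrite Ej Eg => /(congr1 (@nat_of_ord _)).
  by rewrite !val_pc // => /(port_column_inj place_inj) ->; rewrite tw_pg //= tx.
rewrite if_same subr0; apply/eqP; rewrite oppr_eq0; apply/eqP.
under eq_bigr do rewrite base_rim_inflow; rewrite exchange_big /=.
transitivity (\sum_(g : gate D) W om g *+ ((low g == base) && (col g < j)%N)).
  apply: eq_bigr => g _; case: (low (g : gate D) == base); last by rewrite big1.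
  exact: (sum_prefix_delta (col (g : gate D)) j (W om g)).
rewrite sum_gates big_ord_recl [X in _ + X]big1 => [|i _]; last first.
  by rewrite big1 // => y _; rewrite low_base mulr0n.
rewrite addr0; transitivity (\sum_y weight om y *+ (place y < place x)%N).
  apply: eq_bigr => y _; rewrite (port_gateE twx place_inj place_lt) low_base Ej !val_pc //.
  by rewrite /= inordK // !idle_base ltnS ltn_double.
rewrite sum_strand big1 // => s _; rewrite (flat tx) /weight /ssign /=.
by case: (_ < _)%N; rewrite ?mulr0n ?mulr1n; ring.
Qed.
End Flat.
End BraidBoundary.

Section BraidConnected.
Variables (n : nat) (ops : seq (strand n * strand n)) (place : strand n -> nat)
  (twx : strand n -> bool).
Hypothesis place_inj : injective place.
Hypothesis place_lt : forall x, (place x < n.*2)%N.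
Notation N := (size ops).*2.
Notation D := (braid_diagram ops twx place_inj place_lt).
Notation m := (braid_size ops).
Notation Zm := 'I_m.+2.
Notation pc := (port_column ops place).
Notation fv := (fvertex m (node D) (gate D)).
Notation pg := (port_gate ops twx place_inj place_lt).
Notation mid := (mid_node twx place_inj place_lt).
Notation top := (top_node ops twx place_inj place_lt).
Notation base := (base_node ops twx place_inj place_lt).
Variables (T : Type) (f : fv -> T).
Hypothesis f_edge : forall u v, boundary_edge (fcomplex D) u v -> f u = f v.
Implicit Types (x y : strand n) (s : 'I_n) (k : 'I_N) (g : gate D) (e b : bool) (j : Zm) (v : node D).

Lemma f_upp b g : f (gv b g) = f (rim b (upp g) (col g) (kap g)).
Proof. by rewrite (f_gate f_edge b g true) /att andbF addbF. Qed.

Lemma f_low b g : f (gv b g) = f (rim (b (+) tw g) (low g) (col g) (kap g)).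
Proof. by rewrite (f_gate f_edge b g false) /att andbT. Qed.

Let col_pos v g e (_ : nd g e = v) : (0 < col g)%N := braid_col_pos g.

Lemma walk_lt (c : Zm) : (c.*2.+1 < m.+2.*2)%N.
Proof. by have := ltn_ord c; lia. Qed.

(** A disc with one strip entering and one leaving connects equal corners, directly or around the
    rim according to the order of the columns. This is why the operations do not affect the
    boundary. *)
Lemma mid_pass b k x : f (gv b (pg k x)) = f (gv b (pg k.+1 x)).
Proof.
rewrite f_upp f_low upp_pg low_pg tw_pg // addbF; set v := mid k x.
have [L1 L2] := arm_ends (col_pos (v := v)) (upp_pg twx place_inj place_lt k x : nd _ true = v).
have [U1 U2] := arm_ends (col_pos (v := v)) (low_pg twx place_inj place_lt k x : nd _ false = v).
have steps g e : nd g e = v -> arm_step g e = (col (pg k x)).*2.-1 \/ arm_step g e = (col (pg k.+1 x)).*2.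
  by move=> /arms_mid[] [-> ->]; [left|right].
have p1 := braid_col_pos (pg k x); have q1 := walk_lt (col (pg k x)); have q2 := walk_lt (col (pg k.+1 x)).
move: (col (pg k x)) (col (pg k.+1 x)) (kap (pg k x)) (kap (pg k.+1 x)) L1 L2 U1 U2 steps p1 q1 q2.
move=> c1 c2 k1 k2 L1 L2 U1 U2 steps p1 q1 q2; rewrite /rim.
case: b; [rewrite -L2 -U2|rewrite -L1 -U1].
  case: (ltnP c2 c1) => cc.
    apply/esym/(rim_segment f_edge); first by lia.
    by move=> g e /steps[]->; lia.
  apply/esym/(rim_around f_edge (col_pos (v := v))); try lia.
  by move=> g e /steps[]->; lia.
case: (leqP c1 c2) => cc.
  apply: (rim_segment f_edge); first by lia.
  by move=> g e /steps[]->; lia.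
apply: (rim_around f_edge (col_pos (v := v))); try lia.
by move=> g e /steps[]->; lia.
Qed.

Lemma strand_pass b i x : (i <= N)%N -> f (gv b (pg i x)) = f (gv b (pg 0 x)).
Proof.
elim: i => [//|i IH] iN; rewrite -IH 1?ltnW //.
exact/esym/(mid_pass b (Ordinal iN)).
Qed.

(** On the rim of a top disc the corners follow in the order [Pc], [Pb], [Pc], [Pb]: the inner two
    are connected between the strips, the outer two around the disc. *)
Lemma top_pass s : (place (s, false) < place (s, true))%N ->
  f (Rb (pg 0 (s, false))) = f (Rc (pg 0 (s, true))) /\ f (Rb (pg 0 (s, true))) = f (Rc (pg 0 (s, false))).
Proof.
move=> ord; have S b x := esym (@strand_pass b N x (leqnn _)).
rewrite (S false (s, false)) (S false (s, true)) (S true (s, false)) (S true (s, true)).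
have Tb b : upp (pg N (s, b)) = top s := upp_pgN ops twx place_inj place_lt (s, b).
rewrite !f_upp !Tb /rim; set v := top s.
have E0 : nd (pg N (s, false)) true = v by exact: Tb.
have E1 : nd (pg N (s, true)) true = v by exact: Tb.
have [L1 L2] := arm_ends (col_pos (v := v)) E0; have [U1 U2] := arm_ends (col_pos (v := v)) E1.
have steps g e : nd g e = v -> arm_step g e = (col (pg N (s, false))).*2.-1 \/ arm_step g e = (col (pg N (s, true))).*2.-1.
  by move=> /arms_top[-> [[] ->]]; [right|left].
have c12 : (col (pg N (s, false)) < col (pg N (s, true)))%N.
  by rewrite !val_pc // !idle_top ltnS ltn_double.
have p1 := braid_col_pos (pg N (s, false)); have q2 := walk_lt (col (pg N (s, true))).
move: (col (pg N (s, false))) (col (pg N (s, true))) (kap (pg N (s, false))) (kap (pg N (s, true))) L1 L2 U1 U2 steps p1 q2 c12.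
move=> c1 c2 k1 k2 L1 L2 U1 U2 steps p1 q2 c12; rewrite -L1 -L2 -U1 -U2; split.
  apply: (rim_segment f_edge); first by lia.
  by move=> g e /steps[]->; lia.
apply: (rim_around f_edge (col_pos (v := v))); try lia.
by move=> g e /steps[]->; lia.
Qed.

(** Between neighbouring places a free arc of the base rim joins the last corner of [x] to the first
    corner of [y]; a twist exchanges the sides of a strand. *)
Lemma base_pass x y : place y = (place x).+1 ->
  f (gv (~~ twx x) (pg 0 x)) = f (gv (twx y) (pg 0 y)).
Proof.
move=> xy; have lowE z : nd (pg 0 z) false = base.
  by apply/eqP; rewrite low_base /= inordK.
rewrite !f_low !(lowE _ : low _ = base) !tw_pg //= addNb !addbb /=.
have [L1 L2] := arm_ends (col_pos (v := base)) (lowE x); have [U1 U2] := arm_ends (col_pos (v := base)) (lowE y).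
have colE z : (col (pg 0 z) : nat) = (place z).*2.+1 by rewrite val_pc // idle_base.
have q2 := walk_lt (col (pg 0 y)).
rewrite -U1 -L2; apply: (rim_segment f_edge); first by rewrite !colE xy in q2 *; lia.
move=> g e /arms_base[-> [z ->]]; rewrite /arm_step !colE xy.
by lia.
Qed.

Lemma boundary_constant : (forall s, (place (s, false) < place (s, true))%N) ->
  (forall x y, f (Rb (pg 0 x)) = f (Rb (pg 0 y)) /\ f (Rc (pg 0 x)) = f (Rb (pg 0 y))) ->
  forall p q : fv, on_boundary p -> on_boundary q -> f p = f q.
Proof.
move=> ord conn.
have walk0 v i : (forall g e, nd g e <> v) -> (i < m.+2.*2)%N -> f (rim_walk v i) = f (rim_walk v 0).
  move=> none iN; apply/esym/(rim_segment f_edge); first by rewrite iN.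
  by move=> g e En; case: (none g e).
suff [c H] : exists c, forall p, on_boundary p -> f p = c by move=> p q bp bq; rewrite !H.
(* Without strands, the only disc is the base, whose rim is free. *)
have [[x0]|none] := pselect (inhabited (strand n)); last first.
  have ns (x : strand n) : False by apply: none.
  exists (f (rim_walk base 0)).
  have rims v : (forall j, f (Pb v j) = f (rim_walk base 0)) /\ (forall j, f (Pc v j) = f (rim_walk base 0)).
    apply: rim_vertices => i iN; have -> : v = base by case: v => [[[k x]|s]|]; [case: (ns x)|case: (ns (s, true))|].
    by apply: walk0 => // g; case: (ns g.2).
  case=> [//|v j|v j|g|g] _; [by case: (rims v)|by case: (rims v)|case: (ns g.2)|case: (ns g.2)].
set c := f (Rb (pg 0 x0)).
have gates b g : f (gv b g) = c.
  have [i [x [iN ->]]] := gate_inv g; rewrite strand_pass //.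
  by have [h1 h2] := conn x x0; case: b.
have rims v : (forall j, f (Pb v j) = c) /\ (forall j, f (Pc v j) = c).
  apply: rim_vertices.
  have [g0 [e0 E0]] : exists g e, nd g e = v.
    case: v => [[[k x]|s]|].
    - by exists (pg k x), true; apply: upp_pg.
    - by exists (pg N (s, true)), true; apply: upp_pgN.
    - by exists (pg 0 x0), false; apply/eqP; rewrite low_base /= inordK.
  apply: (rim_constant f_edge (col_pos (v := v)) E0) => g e En.
  have att_c b : f (att b g e) = c by rewrite -(f_gate f_edge) gates.
  rewrite -En; have [[|] [h1 h2]] := att_pair g e false.
    by have := att_c false; have := att_c true; rewrite -[true]/(~~ false) h1 h2.
  by have := att_c false; have := att_c true; rewrite -[true]/(~~ false) h1 h2.
exists c; case=> [//|v j|v j|g|g] _; [by case: (rims v)|by case: (rims v)|exact: (gates false)|exact: (gates true)].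
Qed.
End BraidConnected.

(** * Realization of matrices *)

Section Realizable.
Variable n : nat.
Implicit Types (s : 'I_n) (A : 'I_n -> 'I_n -> int) (o : strand n * strand n)
  (ops : seq (strand n * strand n)).

Definition realizable A := exists2 ops, (forall o, o \in ops -> o.1 != o.2) &
  forall s s', \sum_(o <- ops) op_matrix o s s' = A s s'.

Lemma realizable_ext A B : (forall s s', A s s' = B s s') -> realizable A -> realizable B.
Proof. by move=> AB [ops ne E]; exists ops => // s s'; rewrite E. Qed.

Lemma realizable0 : realizable (fun _ _ => 0).
Proof. by exists [::] => // s s'; rewrite big_nil. Qed.

Lemma realizable_add A B : realizable A -> realizable B -> realizable (fun s s' => A s s' + B s s').
Proof.
move=> [o1 n1 E1] [o2 n2 E2]; exists (o1 ++ o2) => [o|s s']; last by rewrite big_cat E1 E2.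
by rewrite mem_cat => /orP[/n1|/n2].
Qed.

Lemma realizable_sum (I : finType) (A : I -> 'I_n -> 'I_n -> int) :
  (forall i, realizable (A i)) -> realizable (fun s s' => \sum_i A i s s').
Proof.
move=> H; elim: (index_enum I) => [|i r IH].
  by apply: realizable_ext realizable0 => s s'; rewrite big_nil.
by apply: realizable_ext (realizable_add (H i) IH) => s s'; rewrite big_cons.
Qed.

(** Exchanging the two strands of an operation negates its matrix, which provides negative
    multiples. *)
Lemma realizable_op o (z : int) : o.1 != o.2 -> realizable (fun s s' => z * op_matrix o s s').
Proof.
move=> ne; have mul o' k : o'.1 != o'.2 -> realizable (fun s s' => op_matrix o' s s' *+ k).
  move=> ne'; exists (nseq k o') => [o1 /nseqP[-> //]|s s'].
  by elim: (k) => [|k' IH]; rewrite ?big_nil //= big_cons IH mulrS.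
case: z => k; first by apply: realizable_ext (mul o k ne) => s s'; rewrite mulrC -mulr_natr natz.
have ne' : (o.2, o.1).1 != (o.2, o.1).2 by rewrite eq_sym.
apply: realizable_ext (mul (o.2, o.1) k.+1 ne') => s s'.
rewrite /op_matrix /= (order_signC o.1 o.2) NegzE -mulr_natr natz; ring.
Qed.

(** For a < b, an operation on (a, false) and (b, false) adds 1 at (a, b) and at (b, a). One on the
    two strands of the loop a adds -2 at (a, a), whence the coefficient - h a. *)
Lemma realizable_even A : (forall s s', A s s' = A s' s) -> (forall s, exists z, A s s = z + z) ->
  realizable A.
Proof.
move=> sym /choice[h hE].
pose op (p : 'I_n * 'I_n) : strand n * strand n := ((p.1, false), (p.2, p.1 == p.2)).
pose F (a b : 'I_n) : int := if (a < b)%N then A a b else if a == b then h a else 0.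
have good p : (op p).1 != (op p).2.
  rewrite /op /= xpair_eqE; case: (p.1 == p.2) => //.
pose z (p : 'I_n * 'I_n) : int := if (p.1 < p.2)%N then A p.1 p.2 else if p.1 == p.2 then - h p.1 else 0.
apply: realizable_ext (realizable_sum (fun p => realizable_op (z p) (good p))) => s s'.
have E p : z p * op_matrix (op p) s s' =
    F p.1 p.2 * (((p.2, p.1) == (s, s'))%:Z + (p == (s, s'))%:Z).
  case: p => a b; rewrite /z /F /op_matrix /op /= !xpair_eqE.
  rewrite [b == s]eq_sym [a == s']eq_sym [a == s]eq_sym [b == s']eq_sym.
  case: ltngtP => [lt|gt|/val_inj Eab].
  - have -> : (a == b) = false by apply/negbTE; rewrite -(inj_eq val_inj) neq_ltn lt.
    rewrite /order_sign /ssign /rank /= !addn0 ltn_double lt.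
    by rewrite xpair_eqE -[a == b](inj_eq val_inj) ltn_eqF //= !mulr1 mul1r.
  - have -> : (a == b) = false by apply/negbTE; rewrite -(inj_eq val_inj) neq_ltn gt orbT.
    by rewrite !mul0r.
  rewrite -Eab eqxx /order_sign /ssign /rank /= addn0 addn1 ltnSn xpair_eqE andbF /=; ring.
under eq_bigr do rewrite E mulrDr; rewrite big_split /=.
have pick (G : 'I_n -> 'I_n -> int) (a b : 'I_n) : \sum_p G p.1 p.2 * (p == (a, b))%:Z = G a b.
  by rewrite -[RHS](sum_delta (a, b) (fun p => G p.1 p.2)); apply: eq_bigr => p _; rewrite eq_sym.
rewrite pick (_ : \sum_p _ = F s' s).
  rewrite /F (eq_sym s' s); case: (ltngtP s s') => [lt|lt|/val_inj Es].
  - by rewrite -(inj_eq val_inj) ltn_eqF // add0r.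
  - by rewrite -(inj_eq val_inj) gtn_eqF // addr0 sym.
  by rewrite -Es eqxx hE.
rewrite -(pick F s' s); apply: eq_bigr => -[a b] _.
by rewrite !xpair_eqE andbC.
Qed.
End Realizable.

(** For distinct loops, exchanging the arguments turns each indicator into one minus itself. The
    constants cancel, as the strand signs of a loop add up to 0, and [order_sign] absorbs the
    sign. *)
Lemma top_matrix_sym n (place : strand n -> nat) s s' : injective place ->
  top_matrix place s s' = top_matrix place s' s.
Proof.
move=> pinj; rewrite /top_matrix (order_signC (s, false) (s', false)) opprK.
case: (eqVneq s s') => [->|ne]; first by rewrite /order_sign eqxx oppr0 !mul0r.
have flip b b' : (place (s', b') <= place (s, b))%N%:Z = 1 - (place (s, b) <= place (s', b'))%N%:Z.
  have : place (s, b) != place (s', b') by rewrite (inj_eq pinj) xpair_eqE (negPf ne).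
  by case: ltngtP.
rewrite !big_bool !flip /ssign /=; move: (order_sign _ _) => z; ring.
Qed.

(** * From a braid to a knot with prescribed pairing *)

Section BraidTheorem.
Variables (R : realType) (n : nat) (ops : seq (strand n * strand n)) (place : strand n -> nat)
  (twx : strand n -> bool).
Hypothesis ops_neq : forall o, o \in ops -> o.1 != o.2.
Hypothesis place_inj : injective place.
Hypothesis place_lt : forall x, (place x < n.*2)%N.
Hypothesis flat : forall x, twx x ->
  forall s, (place (s, true) < place x)%N = (place (s, false) < place x)%N.
Hypothesis place_order : forall s, (place (s, false) < place (s, true))%N.
(** [B b x] stands for the boundary component through the corner [b] of the strand [x]. The two
    premises are the identifications made by the top discs and by the base, so connectedness becomes
    a statement on [place] and [twx] alone. *)
Hypothesis place_conn : forall (T : Type) (B : bool -> strand n -> T),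
  (forall s, B false (s, false) = B true (s, true) /\ B false (s, true) = B true (s, false)) ->
  (forall x y, place y = (place x).+1 -> B (~~ twx x) x = B (twx y) y) ->
  forall x y, B false x = B false y /\ B true x = B false y.

Theorem braid_realizes (M : 'M[int]_n) (P : 'I_n -> 'I_n -> int) :
  (forall om : 'I_n -> int, exists k : 'I_n -> int, forall s, om s = \sum_i k i * P i s) ->
  (forall k : 'I_n -> int, (forall s, \sum_i k i * P i s = 0) -> forall i, k i = 0) ->
  (forall i j, form (braid_matrix ops place twx) (P i) (P j) = M i j) ->
  exists (S : oriented_surface) (m : nat) (K : 'I_m -> tpoint R S)
         (F : embedded_surface R S)
         (z : 'I_n -> fvert F -> fvert F -> int),
    [/\ knot K, spanning_surface F K, basis_H1 (fcplx F) z
      & forall i j : 'I_n, gordon_litherland (z i) (z j) (M i j)].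
Proof.
move=> gen free formM.
pose D := braid_diagram ops twx place_inj place_lt.
pose Y : layout R D := braid_layout R ops twx place_inj place_lt.
pose W := @strand_flow n ops place twx place_inj place_lt.
pose pg := port_gate ops twx place_inj place_lt.
have Bsym := sym_connect_sym (@boundary_edge_sym _ D).
have conn u v : on_boundary u -> on_boundary v -> connect (boundary_edge (fcomplex D)) u v.
  move=> bu bv; rewrite -(root_connect Bsym); apply/eqP.
  have f_edge x y : boundary_edge (fcomplex D) x y -> fingraph.root (boundary_edge (fcomplex D)) x = fingraph.root (boundary_edge (fcomplex D)) y.
    by move=> /connect1; rewrite -(root_connect Bsym) => /eqP.
  apply: (boundary_constant f_edge place_order) bu bv.
  apply: (place_conn (B := fun b x => fingraph.root (boundary_edge (fcomplex D)) (gv b (pg 0%N x)))).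
    by move=> s; apply: (top_pass f_edge).
  by move=> x y xy; apply: (base_pass f_edge).
have [|l [K [knotK spanK]]] := @spanning_knot R _ D Y (Pb (base_node ops twx place_inj place_lt) 0) _ conn; first by [].
exists (tripartite_surface (braid_size ops)), l, K, (diagram_surface Y).
exists (fun i => flow_chain false (W (P i))); split=> //.
- apply: flow_basis => [i|w fw|k k0 i]; first exact: flow_strand_flow.
    have [om Eom] := strand_flow_inv fw; have [k Ek] := gen om.
    exists k => g; rewrite Eom /strand_flow Ek mulr_sumr; apply: eq_bigr => i _.
    by rewrite /W /strand_flow mulrCA.
  apply: free => s; have := k0 (pg 0%N (s, false)).
  by rewrite /W /strand_flow /ssign /=; under eq_bigr do rewrite mul1r.
move=> i j; rewrite -formM -(pairing_matrix R twx ops_neq place_inj place_lt).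
apply: gordon_litherland_flow; [exact: flow_strand_flow|exact: flow_strand_flow|].
move=> v k e rv; have [Ev _] := raised_base rv; rewrite Ev in rv *.
exact: base_flat.
Qed.
End BraidTheorem.

Lemma ord_chain n (T : Type) (c : 'I_n -> T) :
  (forall s s' : 'I_n, s' = s.+1 :> nat -> c s = c s') -> forall s s' : 'I_n, c s = c s'.
Proof.
move=> step; suff H (i : nat) (s s' : 'I_n) : s' = (s + i)%N :> nat -> c s = c s'.
  by move=> s s'; case: (leqP s s') => ss; [|symmetry]; apply: (H _ _ _ (esym (subnKC _))); rewrite // ltnW.
elim: i s' => [|i IH] s' E; first by congr c; apply: val_inj; rewrite /= E addn0.
have iN : (s + i < n)%N by have := ltn_ord s'; lia.
by rewrite (IH (Ordinal iN) erefl); apply: step; rewrite /= E addnS.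
Qed.

(** [top_matrix] vanishes on the diagonal, so its off-diagonal part is corrected by operations and
    only the twists enter the parity condition. *)
Lemma realize_matrix n (A : 'I_n -> 'I_n -> int) (place : strand n -> nat) (twx : strand n -> bool) :
  injective place -> (forall s s', A s s' = A s' s) ->
  (forall s, exists z, A s s + twist_matrix twx s s = z + z) ->
  exists2 ops, (forall o, o \in ops -> o.1 != o.2) &
    forall s s', braid_matrix ops place twx s s' = A s s'.
Proof.
move=> pinj sym even.
have [||ops ne E] := @realizable_even n (fun s s' => A s s' - top_matrix place s s' + twist_matrix twx s s').
- move=> s s'; rewrite (top_matrix_sym s s' pinj) (sym s) /twist_matrix (eq_sym s').
  by case: eqP => [->|_].
- by move=> s; rewrite /top_matrix /order_sign eqxx oppr0 mul0r subr0; apply: even.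
by exists ops => // s s'; rewrite /braid_matrix E; ring.
Qed.

(** * The two initial diagrams: twisted loops and interlaced pairs *)

Section TwistedCase.
Variable n : nat.
(** One strand of each loop is twisted, which makes the loop a Moebius band. With the two strands of
    a loop adjacent in [rank], no twisted strand separates those of another loop. *)
Definition base_twist (x : strand n) : bool := ~~ x.2.

Lemma twisted_flat x : base_twist x ->
  forall s : 'I_n, (rank (s, true) < rank x)%N = (rank (s, false) < rank x)%N.
Proof. by case: x => s0 [] //= _ s; rewrite /rank /=; lia. Qed.

Lemma twisted_order (s : 'I_n) : (rank (s, false) < rank (s, true))%N.
Proof. by rewrite /rank /=; lia. Qed.

Lemma twisted_connected (T : Type) (B : bool -> strand n -> T) :
  (forall s, B false (s, false) = B true (s, true) /\ B false (s, true) = B true (s, false)) ->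
  (forall x y, rank y = (rank x).+1 -> B (~~ base_twist x) x = B (base_twist y) y) ->
  forall x y, B false x = B false y /\ B true x = B false y.
Proof.
move=> tops bases.
have same s b c : B b (s, c) = B false (s, false).
  have [h1 h2] := tops s; have := bases (s, false) (s, true); rewrite /rank /base_twist /= => h3.
  by case: b; case: c; rewrite -?h1 -?h2 // -h3 //; lia.
have const := @ord_chain n T (fun s => B false (s, false)).
have next s s' : B false (s, false) = B false (s', false).
  apply: const => {}s {}s' E; rewrite -(same s true true) -(same s' true false).
  by apply: (bases (s, true) (s', false)); rewrite /rank /= E; lia.
by move=> [s b] [s' b']; rewrite !same; split; apply: next.
Qed.
End TwistedCase.

Section EvenCase.
Variable n : nat.
(** The loops 2 r and 2 r + 1 occupy four consecutive places in alternation, as in a punctured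
    torus, whose boundary is connected. *)
Definition linked_place (x : strand n) : nat := x.1./2.*2.*2 + x.2.*2 + odd x.1.

Lemma linked_inj : injective linked_place.
Proof.
move=> [[s sn] b] [[s' sn'] b']; rewrite /linked_place /= => E.
have [Es Eb] : s = s' /\ b = b'.
  have := odd_double_half s; have := odd_double_half s'.
  by case: b b' (odd s) (odd s') E => -[] [] [] /=; lia.
by rewrite Eb; congr (_, _); apply: val_inj.
Qed.

Lemma linked_order (s : 'I_n) : (linked_place (s, false) < linked_place (s, true))%N.
Proof. by rewrite /linked_place /=; lia. Qed.

Hypothesis n_even : ~~ odd n.

Lemma linked_lt x : (linked_place x < n.*2)%N.
Proof.
case: x => -[s sn] b; rewrite /linked_place /=; have := odd_double_half s; have := odd_double_half n.
by rewrite (negPf n_even); case: b; case: (odd s) => /=; lia.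
Qed.

Lemma linked_connected (T : Type) (B : bool -> strand n -> T) :
  (forall s, B false (s, false) = B true (s, true) /\ B false (s, true) = B true (s, false)) ->
  (forall x y, linked_place y = (linked_place x).+1 -> B true x = B false y) ->
  forall x y, B false x = B false y /\ B true x = B false y.
Proof.
move=> tops bases.
have pair (s s' : 'I_n) : ~~ odd s -> s' = s.+1 :> nat ->
    forall b c, B b (s, c) = B false (s, false) /\ B b (s', c) = B false (s, false).
  move=> se E; have [h1 h2] := tops s; have [h3 h4] := tops s'.
  have E1 : s'./2 = s./2 by rewrite E /= uphalf_half (negPf se).
  have E2 : odd s' by rewrite E /= se.
  have k1 : B true (s, false) = B false (s', false).
    by apply: bases; rewrite /linked_place /= E1 E2 (negPf se); lia.
  have k2 : B true (s', false) = B false (s, true).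
    by apply: bases; rewrite /linked_place /= E1 E2 (negPf se); lia.
  have k3 : B true (s, true) = B false (s', true).
    by apply: bases; rewrite /linked_place /= E1 E2 (negPf se); lia.
  have q1 : B true (s, true) = B false (s, false) by [].
  have q2 : B false (s', true) = B false (s, false) by rewrite -k3.
  have q3 : B true (s', false) = B false (s, false) by rewrite -h4.
  have q4 : B false (s, true) = B false (s, false) by rewrite -k2.
  have q5 : B true (s, false) = B false (s, false) by rewrite -h2.
  have q6 : B false (s', false) = B false (s, false) by rewrite -k1.
  have q7 : B true (s', true) = B false (s, false) by rewrite -h3.
  by case=> -[]; split.
have partner (s : 'I_n) : exists2 t : 'I_n, B false (t, false) = B false (s, false) & 
    forall b c, B b (s, c) = B false (t, false).
  case: (boolP (odd s)) => [os|es].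
    have sn : (s.-1 < n)%N := leq_ltn_trans (leq_pred _) (ltn_ord s).
    have s0 : (0 < s)%N by case: (nat_of_ord s) os.
    have e1 : ~~ odd (Ordinal sn) by move: os; rewrite -{1}(prednK s0).
    have H := pair (Ordinal sn) s e1 (esym (prednK s0)).
    exists (Ordinal sn); last by move=> b c; case: (H b c).
    by case: (H false false).
  have sn : (s.+1 < n)%N.
    have := ltn_ord s; rewrite leq_eqVlt => /orP[/eqP En|//].
    by have := congr1 odd En; rewrite /= es (negPf n_even).
  have H := pair s (Ordinal sn) es erefl.
  by exists s => // b c; case: (H b c).
have same s b c : B b (s, c) = B false (s, false) by have [t <- ->] := partner s.
have next s s' : B false (s, false) = B false (s', false).
  apply: (@ord_chain n T (fun s => B false (s, false))) => {}s {}s' E.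
  case: (boolP (odd s)) => [os|es]; last by have [_ ->] := pair s s' es E false false.
  rewrite -(same s true true); apply: bases; rewrite /linked_place /= E /= os uphalf_half os.
  by lia.
by move=> [s b] [s' b']; rewrite !same; split; apply: next.
Qed.
End EvenCase.

Lemma odd_int (z : int) : odd `|z|%N -> exists y, z + 1 = y + y.
Proof.
move=> oz; exists ((z + 1) %/ 2)%Z; case: z oz => k /=; lia.
Qed.

Lemma even_int (z : int) : ~~ odd `|z|%N -> exists y, z = y + y.
Proof.
move=> oz; exists (z %/ 2)%Z; case: z oz => k /=; lia.
Qed.

Theorem theorem3p5 (R : realType) (n : nat) (M : 'M[int]_n)
  (hM : allowable M) :
  exists (S : oriented_surface) (m : nat) (K : 'I_m -> tpoint R S)
         (F : embedded_surface R S)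
         (z : 'I_n -> fvert F -> fvert F -> int),
    [/\ knot K,
        spanning_surface F K,
        basis_H1 (fcplx F) z
      & forall i j : 'I_n, gordon_litherland (z i) (z j) (M i j)].
Proof.
have [trM par] := hM; have sym i j : M i j = M j i by rewrite -{1}trM mxE.
have sum_l (i : 'I_n) (F : 'I_n -> int) : \sum_j F j * (j == i)%:Z = F i.
  by rewrite -[RHS](sum_delta i F); apply: eq_bigr => j _; rewrite eq_sym.
have [[i0 odd0]|no_odd] := pselect (exists i, odd `|M i i|%N).
  (* The change of basis is e_s + c_s e_i0, where c_s = 1 for an even entry M s s: the diagonal
     entry then changes by 2 M s i0 + M i0 i0, which is odd. *)
  pose c i : int := (~~ odd `|M i i|%N)%:Z.
  have c0 : c i0 = 0 by rewrite /c odd0.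
  pose A s s' := M s s' + c s * M i0 s' + c s' * M s i0 + c s * c s' * M i0 i0.
  have Asym s s' : A s s' = A s' s by rewrite /A (sym s s') (sym i0 s') (sym s i0); ring.
  have Aodd s : exists z, A s s + twist_matrix (@base_twist n) s s = z + z.
    have [y0 E0] := odd_int odd0.
    rewrite /twist_matrix eqxx mulr1n /= /A /c; case: (boolP (odd `|M s s|%N)) => [/odd_int[y Ey]|/even_int[y Ey]].
      by exists y; rewrite -Ey /=; lia.
    by exists (y + y0 + M s i0); rewrite (sym i0 s) Ey /=; lia.
  have [ops ne E] := realize_matrix (@rank_inj n) Asym Aodd.
  (* Coordinates of the original basis in the new one; as c_i0 = 0, the change of basis is inverted
     by a change of sign. *)
  pose P i s : int := (s == i)%:Z - c i * (s == i0)%:Z.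
  apply: (braid_realizes R ne (@rank_inj n) (@rank_lt n) (@twisted_flat n) (@twisted_order n)
    (@twisted_connected n) (P := P)).
  (* The inverse shear; its coefficient sum is unaffected by the added term because c_i0 = 0. *)
  - move=> om; exists (fun i => om i + (\sum_j om j * c j) * (i == i0)%:Z) => s; rewrite /P.
    under eq_bigr do rewrite mulrBr mulrA; rewrite sumrB -mulr_suml sum_delta.
    under [X in _ - X * _]eq_bigr do rewrite mulrDl mulrAC; rewrite big_split /=.
    by rewrite (sum_l i0 (fun j => (\sum_j om j * c j) * c j)) c0; ring.
  - move=> k k0; have kE s : k s = (\sum_i k i * c i) * (s == i0)%:Z.
      have := k0 s; rewrite /P; under eq_bigr do rewrite mulrBr mulrA; rewrite sumrB -mulr_suml.
      by rewrite sum_delta => /eqP; rewrite subr_eq0 => /eqP.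
    suff Z : \sum_i k i * c i = 0 by move=> i; rewrite kE Z mul0r.
    apply: big1 => i _; rewrite kE; case: (eqVneq i i0) => [->|_]; first by rewrite c0 mulr0.
    by rewrite mulr0 mul0r.
  move=> i j; rewrite /form; transitivity (\sum_s \sum_s' P i s * P j s' * A s s').
    by apply: eq_bigr => s _; apply: eq_bigr => s' _; rewrite E.
  have inner s : \sum_s' P i s * P j s' * A s s' = P i s * (A s j - c j * A s i0).
    under eq_bigr do rewrite -mulrA; rewrite -mulr_sumr; congr (_ * _).
    under eq_bigr do rewrite /P mulrBl mulrC -mulrA [_ * A s _]mulrC; rewrite sumrB sum_l -mulr_sumr sum_l.
    by [].
  under eq_bigr do rewrite inner.
  under eq_bigr do rewrite /P mulrBl mulrC -mulrA [_ * (A _ j - _)]mulrC; rewrite sumrB sum_l -mulr_sumr sum_l.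
  by rewrite /A c0; ring.
have n_even : ~~ odd n by case: par => // -[i oi]; case: no_odd; exists i.
have Meven s : exists z, M s s + twist_matrix (fun _ : strand n => false) s s = z + z.
  have [|z Ez] := @even_int (M s s); first by apply/negP => os; apply: no_odd; exists s.
  by exists z; rewrite -Ez /twist_matrix eqxx mulr1n /=; lia.
have [ops ne E] := realize_matrix (@linked_inj n) sym Meven.
apply: (braid_realizes R ne (@linked_inj n) (linked_lt n_even) (twx := fun=> false)
  _ (@linked_order n) (@linked_connected n n_even) (P := fun i s => (s == i)%:Z)) => //.
- move=> om; exists om => s; by rewrite sum_delta.
- by move=> k k0 i; have := k0 i; rewrite sum_delta.
move=> i j; rewrite /form; transitivity (\sum_s \sum_s' (s == i)%:Z * (s' == j)%:Z * M s s').
  by apply: eq_bigr => s _; apply: eq_bigr => s' _; rewrite E.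
have inner s : \sum_s' (s == i)%:Z * (s' == j)%:Z * M s s' = M s j * (s == i)%:Z.
  by under eq_bigr do rewrite mulrAC; rewrite sum_l mulrC.
by under eq_bigr do rewrite inner; rewrite sum_l.
Qed.
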